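(* Let $d\ge1$ be an integer, let $\frac d4+\frac{d}{2(d+2)}<s<\frac d2$, let $1\le\alpha'<2$, and let $\gamma_0\in\mathfrak S^{\alpha',s}(L^2(\mathbb T^d))$ be self-adjoint. Put $\gamma(t)=e^{it\Delta}\gamma_0e^{-it\Delta}$. Then the densities $\rho_{\gamma_0}$ and $\rho_{\gamma(t)}$ are well defined, and $$\lim_{t\to0}\rho_{\gamma(t)}(x)=\rho_{\gamma_0}(x)\qquad\text{for a.e. }x\in\mathbb T^d.$$
   Context: $\mathbb T=\mathbb R/\mathbb Z$. With $\widehat f(k)=\int_{\mathbb T^d}f(x)e^{-2\pi ix\cdot k}dx$, $k\in\mathbb Z^d$, the operators $\langle\nabla\rangle^{\sigma}$ and $e^{it\Delta}$ are the Fourier multipliers with symbols $(1+|k|^2)^{\sigma/2}$ and $e^{2\pi it|k|^2}$. $H^{\sigma}=\langle\nabla\rangle^{-\sigma}L^2$. Schatten spaces: $\mathfrak S^{\alpha}(\mathcal H)$ is the set of compact operators $A$ on the Hilbert space $\mathcal H$ with $\|A\|_{\mathfrak S^\alpha}=(\operatorname{Tr}|A|^\alpha)^{1/\alpha}<\infty$. Sobolev–Schatten space: $\mathfrak S^{\alpha',s}(L^2(\mathbb T^d))$ is the set of compact operators $\gamma:H^{-s}(\mathbb T^d)\to H^{s}(\mathbb T^d)$ with $\|\langle\nabla\rangle^s\gamma\langle\nabla\rangle^s\|_{\mathfrak S^{\alpha'}(L^2(\mathbb T^d))}<\infty$. The function $\gamma(t)=e^{it\Delta}\gamma_0e^{-it\Delta}$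 is the solution of $i\partial_t\gamma=[-\Delta,\gamma]$, $\gamma|_{t=0}=\gamma_0$. Densities: a self-adjoint $\gamma_0\in\mathfrak S^{\alpha',s}$ can be written $\gamma_0=\sum_j\lambda_j\langle\nabla\rangle^{-s}|f_j\rangle\langle f_j|\langle\nabla\rangle^{-s}$ with $(\lambda_j)_j\in\ell^{\alpha'}$ real and $(f_j)_j$ orthonormal in $L^2(\mathbb T^d)$, where $|f\rangle\langle g|$ is the operator $h\mapsto\langle g,h\rangle f$. Then $\rho_{\gamma_0}=\sum_j\lambda_j|\langle\nabla\rangle^{-s}f_j|^2$ and $\rho_{\gamma(t)}=\sum_j\lambda_j|e^{it\Delta}\langle\nabla\rangle^{-s}f_j|^2$; ''well defined'' means that for each $t$ the partial sums converge in $L^2(\mathbb T^d)$. Pointwise values of $\rho_{\gamma(t)}$ are the sums of this series at the given point, where pointwise values of $e^{it\Delta}g$ for $g\in H^s$ are $\lim_{N\to\infty}\sum_{k}\eta(k/N)e^{2\pi i(x\cdot k+t|k|^2)}\widehat g(k)$ over dyadic $N$, with $\eta(\zeta)=\prod_i\eta_1(\zeta_i)$ and $\eta_1:\mathbb R\to[0,1]$ smooth, even, equal to $1$ on $[-1,1]$ and $0$ outside $(-2,2)$. *)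

(* Defs.v *)
From HB Require Import structures.
From mathcomp Require Import all_boot all_order all_algebra.
From mathcomp Require Import complex.
From mathcomp Require Import all_classical all_reals all_analysis.

Set Implicit Arguments.
Unset Strict Implicit.
Unset Printing Implicit Defensive.

Import Order.TTheory GRing.Theory Num.Theory.
Import numFieldNormedType.Exports.

Local Open Scope classical_set_scope.
Local Open Scope ring_scope.
Local Open Scope complex_scope.

(* A function on the torus (R/Z)^d is represented by its restriction to the
   fundamental cube [0,1]^d: the measure [torus] below lives on d-tuples of
   reals and is supported by that cube.  The library has no d-fold product
   measure, so it is built by iterating the binary product. *)
Definition tuple_cons (R : realType) (d : nat)
  (p : measurableTypeR R * d.-tuple R) : d.+1.-tuple R := [tuple of p.1 :: p.2].

Lemma measurable_tuple_cons (R : realType) (d : nat) :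
  measurable_fun [set: measurableTypeR R * d.-tuple R] (@tuple_cons R d).
Proof. exact: measurable_cons. Qed.

HB.instance Definition _ (R : realType) (d : nat) :=
  isMeasurableFun.Build _ _ _ _ (@tuple_cons R d)
    (@measurable_tuple_cons R d).

Fixpoint torus (R : realType) (d : nat) : probability (d.-tuple R) R :=
  match d with
  | 0 => \d_([tuple])
  | n.+1 => distribution (uniform_prob (@ltr01 R) \x torus R n)%E
              (@tuple_cons R n)
  end.

Section Fourier.
Variables (R : realType) (d : nat).
Implicit Types (f : d.-tuple R -> R[i]) (x : d.-tuple R) (k : d.-tuple int).

Definition dotp k x : R := \sum_(i < d) (tnth k i)%:~R * tnth x i.

Definition sqnorm k : R := \sum_(i < d) (tnth k i)%:~R ^+ 2.

Definition cexp (theta : R) : R[i] :=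
  cos (2 * pi * theta) +i* sin (2 * pi * theta).

Definition sqmod (z : R[i]) : R := complex.Re z ^+ 2 + complex.Im z ^+ 2.

Definition cintegral f : R[i] :=
  (\int[torus R d]_x complex.Re (f x)) +i*
  (\int[torus R d]_x complex.Im (f x)).

Definition L2fun f : Prop :=
  (fun x => complex.Re (f x)) \in Lfun (torus R d) 2%:E /\
  (fun x => complex.Im (f x)) \in Lfun (torus R d) 2%:E.

Definition fourier f k : R[i] := cintegral (fun x => f x * cexp (- dotp k x)).

End Fourier.

(* A distribution on the torus is given by its family of Fourier
   coefficients, so that Fourier multipliers act by multiplication and H^sigma
   makes sense for negative sigma.  L^2 is embedded by f |-> \hat f, which
   identifies functions that are equal almost everywhere. *)
Definition dist (R : realType) (d : nat) : Type := d.-tuple int -> R[i].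

Definition operator (R : realType) (d : nat) : Type := dist R d -> dist R d.

Section SobolevSpaces.
Variables (R : realType) (d : nat).
Implicit Types (u v : dist R d) (sigma t : R).

Definition inL2 u : Prop :=
  exists2 f : d.-tuple R -> R[i], L2fun f & fourier f = u.

(* A square-integrable function with Fourier coefficients u, unique up to
   equality a.e.; the default value 0 is only taken outside L^2. *)
Definition L2repr u : d.-tuple R -> R[i] :=
  xget (fun=> 0) [set f : d.-tuple R -> R[i] | L2fun f /\ fourier f = u].

(* linear in the second argument *)
Definition dotL2 u v : R[i] :=
  cintegral (fun x => conjc (L2repr u x) * L2repr v x).

Definition normL2 u : R := Num.sqrt (complex.Re (dotL2 u u)).

(* <nabla>^sigma *)
Definition bessel sigma u : dist R d :=
  fun k => ((1 + sqnorm R k) `^ (sigma / 2))%:C * u k.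

(* e^(i t Delta), with symbol e^(2 i pi t |k|^2) *)
Definition schrod t u : dist R d := fun k => cexp (t * sqnorm R k) * u k.

Definition inH sigma u : Prop := inL2 (bessel sigma u).

Definition normH sigma u : R := normL2 (bessel sigma u).

Definition cvgH sigma (u_ : nat -> dist R d) u : Prop :=
  [/\ forall n, inH sigma (u_ n), inH sigma u &
      normH sigma (fun k => u_ n k - u k) @[n --> \oo] --> (0 : R)].

End SobolevSpaces.

(* Operators are total functions on distributions of which only the values on
   the stated domain matter.  L^2 is H^0. *)
Section Operators.
Variables (R : realType) (d : nat).
Implicit Types (A P Q : operator R d) (u v : dist R d) (sigma tau alpha : R).

Definition linear_op sigma tau A : Prop :=
  (forall u, inH sigma u -> inH tau (A u)) /\
  (forall (a : R[i]) u v, inH sigma u -> inH sigma v ->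
     A (fun k => a * u k + v k) = fun k => a * A u k + A v k).

Definition compact_op sigma tau A : Prop :=
  linear_op sigma tau A /\
  forall u_ : nat -> dist R d,
    (forall n, inH sigma (u_ n)) ->
    (exists M : R, forall n, normH sigma (u_ n) <= M) ->
    exists phi : nat -> nat, {homo phi : m n / (m < n)%N} /\
    exists v, cvgH tau (fun n => A (u_ (phi n))) v.

Definition bounded_op A : Prop :=
  linear_op 0 0 A /\
  exists M : R, forall u, inL2 u -> normL2 (A u) <= M * normL2 u.

Definition positive_op A : Prop :=
  bounded_op A /\ forall u, inL2 u -> 0 <= dotL2 u (A u).

(* P = |A| = (A^* A)^(1/2) *)
Definition abs_op A P : Prop :=
  positive_op P /\
  exists B : operator R d,
    [/\ bounded_op B,
        forall u v, inL2 u -> inL2 v -> dotL2 (A u) v = dotL2 u (B v) &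
        forall u, inL2 u -> P (P u) = B (A u)].

Definition orthonormal_seq (e : nat -> dist R d) : Prop :=
  (forall i, inL2 (e i)) /\ forall i j, dotL2 (e i) (e j) = (i == j)%:R.

Definition orthonormal_basis (e : nat -> dist R d) : Prop :=
  orthonormal_seq e /\
  forall u, inL2 u -> (forall i, dotL2 (e i) u = 0) -> u = fun=> 0.

(* Q = P^alpha for a positive compact operator P: functional calculus in an
   orthonormal basis of eigenvectors. *)
Definition power_op P alpha Q : Prop :=
  bounded_op Q /\
  exists (e : nat -> dist R d) (mu : nat -> R), orthonormal_basis e /\
    forall n, [/\ 0 <= mu n, P (e n) = (fun k => (mu n)%:C * e n k) &
                  Q (e n) = (fun k => (mu n `^ alpha)%:C * e n k)].

(* the character x |-> e^(2 i pi k.x) *)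
Definition character (k : d.-tuple int) : dist R d := fun l => (l == k)%:R.

(* Trace of a positive operator, computed in the orthonormal basis of
   characters. *)
Definition trace A : \bar R :=
  \esum_(k in [set: d.-tuple int])
    (complex.Re (dotL2 (character k) (A (character k))))%:E.

(* ||A||_alpha = (Tr |A|^alpha)^(1/alpha) < oo *)
Definition schatten alpha A : Prop :=
  compact_op 0 0 A /\
  exists P Q, [/\ abs_op A P, power_op P alpha Q &
                  (trace Q `^ alpha^-1 < +oo)%E].

Definition sobolev_schatten alpha (s : R) A : Prop :=
  compact_op (- s) s A /\
  schatten alpha (fun u => bessel s (A (bessel s u))).

Definition self_adjoint A : Prop :=
  forall u v, inL2 u -> inL2 v -> dotL2 (A u) v = dotL2 u (A v).

Definition evolution A (t : R) : operator R d :=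
  fun u => schrod t (A (schrod (- t) u)).

(* A = sum_j lam_j <nabla>^(-s) |f_j><f_j| <nabla>^(-s) with (lam_j) in
   l^alpha and (f_j) orthonormal in L^2. *)
Definition decomposition alpha (s : R) A
    (lam : nat -> R) (f : nat -> dist R d) : Prop :=
  [/\ (\sum_(0 <= j <oo) (`|lam j| `^ alpha)%:E < +oo)%E,
      orthonormal_seq f &
      forall u, inH (- s) u ->
        cvgH s
          (fun n k => \sum_(j < n) (lam j)%:C *
             dotL2 (f j) (bessel (- s) u) * bessel (- s) (f j) k)
          (A u)].

End Operators.

Section Densities.
Variables (R : realType) (d : nat).
Implicit Types (lam : nat -> R) (g : nat -> dist R d) (x : d.-tuple R).

Definition density_partial lam g (n : nat) x : R :=
  \sum_(j < n) lam j * sqmod (L2repr (g j) x).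

Definition density_well_defined lam g : Prop :=
  (forall n, density_partial lam g n \in Lfun (torus R d) 2%:E) /\
  exists2 rho : d.-tuple R -> R, rho \in Lfun (torus R d) 2%:E &
    (Lnorm (torus R d) 2%:E (fun x => (density_partial lam g n x - rho x)%:E)
      @[n --> \oo] --> 0)%E.

Definition cutoff (eta1 : R -> R) : Prop :=
  [/\ forall (n : nat) (z : R), derivable (derive1n n eta1) z 1,
      forall z, 0 <= eta1 z <= 1,
      forall z, eta1 (- z) = eta1 z,
      forall z, `|z| <= 1 -> eta1 z = 1 &
      forall z, 2 <= `|z| -> eta1 z = 0].

(* z is the value at x of the function with Fourier coefficients u; the sum
   over k has finite support because of the cutoff. *)
Definition pointwise_value (eta1 : R -> R) (u : dist R d) x (z : R[i]) : Prop :=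
  ((\sum_(k \in [set: d.-tuple int])
      (\prod_(i < d) eta1 ((tnth k i)%:~R / 2 ^+ m))%:C *
      cexp (dotp k x) * u k) : R[i]^o) @[m --> \oo] --> (z : R[i]^o).

Definition density_at (eta1 : R -> R) lam g x (v : R) : Prop :=
  exists2 z : nat -> R[i], (forall j, pointwise_value eta1 (g j) x (z j)) &
    series (fun j => lam j * sqmod (z j)) @ \oo --> v.

End Densities.

(* Main.v *)
(* Split e^(it Delta) <nabla>^(-s) f_j into dyadic frequency bands.  As
   alpha' < 2, there are weights w in l^2 and eps_j -> 0 with
   |lam_j| <= eps_j w_j.  On the band of frequencies k of size at most L, the
   weighted density sum_j w_j |.|^2 is a sum over pairs (k, l) of exponentials
   in (t, x), whose coefficients have l^2 norm at most ||w||_2 up to the symbol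
   L^(-2s), by orthonormality.  Cauchy-Schwarz over the O(L^2) time
   frequencies, Parseval in x and a count of the pairs with given k - l and
   |k|^2 - |l|^2 bound the L^2_x norm of the supremum over t.  The bounds are
   summable over the bands when s > (d + 1) / 4, which is enough for d >= 2.
   For d = 1 each function g is treated separately, with g^2 conj(g) instead of
   |g|^2; the divisor bound counts the triples, and this covers s > 5 / 12.

   Hence for almost every x the weighted density of the N-th band is at most
   q^(2N) S(x) for all t, with q < 1 and S in L^2.  For such x the band pieces
   can be summed uniformly in t, and since eps_j -> 0 the density series has
   uniformly small tails, so its sum is continuous in t.

   The decomposition of gamma_0 exists because A = <nabla>^s gamma_0 <nabla>^s
   is self-adjoint with A^2 = |A|^2: if (e_n) diagonalises |A| with eigenvalues
   mu_n, the vectors A e_n +- mu_n e_n are eigenvectors of A, Gram-Schmidt makes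
   them a basis, and Tr |A|^alpha' can be computed in that basis. *)

(* No supremum over t is ever formed, so its measurability is never an issue: each estimate produces
   an integrable majorant independent of t. The resulting bounds hold for all t at once outside one
   null set, and off this set only deterministic summation remains; gamma_0 is never approximated by
   smooth or finite rank operators.

   The maximal bound lives in l^2 of the weights because orthonormality enters through the
   Hilbert-Schmidt norm of sum_j w_j |f_j><f_j|. The gap between alpha' and 2 is what leaves the
   factor eps_j.

   For d >= 2 one has d / (2 (d + 2)) >= 1/4, so the hypothesis gives s > (d + 1) / 4. For d = 1
   that bound would need s > 1/2; the sixth moment of one function costs L^(2 + epsilon), and
   optimising two interpolation parameters bounds the integral of the squared maximal density by
   L^(5/3 + epsilon - 4 s).

   Densities are evaluated in two ways, through [L2repr], an arbitrary representative, and through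
   the smoothed sums of [pointwise_value]. Both are compared with the same band sums, since the
   bands are differences of the very cutoffs that define pointwise values. *)
Require Import Defs.
From HB Require Import structures.
From mathcomp Require Import all_boot all_order all_algebra.
From mathcomp Require Import complex.
From mathcomp Require Import all_classical all_reals all_analysis measurable_realfun.
From mathcomp Require Import ring lra zify.
Import Order.TTheory GRing.Theory Num.Theory.
Import numFieldNormedType.Exports.
Local Open Scope classical_set_scope.
Local Open Scope ring_scope.
Set Implicit Arguments.
Unset Strict Implicit.
Unset Printing Implicit Defensive.

(** * Integration on the torus *)

Section ComplexModulus.
Variable R : realType.
Implicit Types (z w : R[i]) (r a b : R).
Local Open Scope complex_scope.
Local Notation normc := (@ComplexField.Normc.normc R).

Lemma sqmodE z : sqmod z = normc z ^+ 2.
Proof. by case: z => a b; rewrite /sqmod /= sqr_sqrtr // addr_ge0 ?sqr_ge0. Qed.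

Lemma sqmod_ge0 z : 0 <= sqmod z.
Proof. by rewrite sqmodE sqr_ge0. Qed.

Lemma normcE z : normc z = Num.sqrt (sqmod z).
Proof. by case: z => a b. Qed.

Lemma normc_ge0 z : 0 <= normc z.
Proof. by rewrite normcE sqrtr_ge0. Qed.

Lemma sqmodM z w : sqmod (z * w) = sqmod z * sqmod w.
Proof. by rewrite !sqmodE ComplexField.Normc.normcM exprMn. Qed.

Lemma sqmodN z : sqmod (- z) = sqmod z.
Proof. by case: z => a b; rewrite /sqmod /= !sqrrN. Qed.

Lemma sqmodJ z : sqmod (conjc z) = sqmod z.
Proof. by case: z => a b; rewrite /sqmod /= sqrrN. Qed.

Lemma sqmod_real r : sqmod r%:C = r ^+ 2.
Proof. by rewrite /sqmod /= expr0n addr0. Qed.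

Lemma sqmod0 : sqmod (0 : R[i]) = 0.
Proof. by rewrite /sqmod /= expr0n addr0. Qed.

Lemma sqmod1 : sqmod (1 : R[i]) = 1.
Proof. by rewrite /sqmod /= expr0n addr0 expr1n. Qed.

Lemma sqmod_eq0 z : sqmod z = 0 -> z = 0.
Proof.
move=> h; apply: ComplexField.Normc.eq0_normc.
by rewrite normcE h sqrtr0.
Qed.

Lemma mulJc z : conjc z * z = (sqmod z)%:C.
Proof.
case: z => a b; rewrite /sqmod; apply/eqP; rewrite eq_complex /=.
by apply/andP; split; apply/eqP; ring.
Qed.

Lemma mulcJ z : z * conjc z = (sqmod z)%:C.
Proof. by rewrite mulrC mulJc. Qed.

Lemma Re_sum (I : Type) (s : seq I) (P : pred I) (F : I -> R[i]) :
  complex.Re (\sum_(i <- s | P i) F i) = \sum_(i <- s | P i) complex.Re (F i).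
Proof. by apply: big_morph => [[a b] [c e]|]. Qed.

Lemma Im_sum (I : Type) (s : seq I) (P : pred I) (F : I -> R[i]) :
  complex.Im (\sum_(i <- s | P i) F i) = \sum_(i <- s | P i) complex.Im (F i).
Proof. by apply: big_morph => [[a b] [c e]|]. Qed.

Lemma ReD z w : complex.Re (z + w) = complex.Re z + complex.Re w.
Proof. by case: z w => a b [c e]. Qed.

Lemma ImD z w : complex.Im (z + w) = complex.Im z + complex.Im w.
Proof. by case: z w => a b [c e]. Qed.

Lemma ReN z : complex.Re (- z) = - complex.Re z.
Proof. by case: z. Qed.

Lemma ImN z : complex.Im (- z) = - complex.Im z.
Proof. by case: z. Qed.

Lemma ReM z w : complex.Re (z * w) =
  complex.Re z * complex.Re w - complex.Im z * complex.Im w.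
Proof. by case: z w => a b [c e]. Qed.

Lemma ImM z w : complex.Im (z * w) =
  complex.Re z * complex.Im w + complex.Im z * complex.Re w.
Proof. by case: z w => a b [c e]. Qed.

Lemma complexP z w :
  complex.Re z = complex.Re w -> complex.Im z = complex.Im w -> z = w.
Proof. by case: z w => a b [c e] /= -> ->. Qed.

Lemma Re_le_sqmod z : complex.Re z ^+ 2 <= sqmod z.
Proof. by rewrite /sqmod lerDl sqr_ge0. Qed.

Lemma Im_le_sqmod z : complex.Im z ^+ 2 <= sqmod z.
Proof. by rewrite /sqmod lerDr sqr_ge0. Qed.

Lemma sqmodD_le z w : sqmod (z + w) <= 2 * sqmod z + 2 * sqmod w.
Proof.
rewrite -subr_ge0 (_ : _ - _ = sqmod (z - w)) ?sqmod_ge0 //.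
by case: z w => a b [c e]; rewrite /sqmod /=; ring.
Qed.

Lemma sum_sqr_ge0 (I : Type) (s : seq I) (P : pred I) (F : I -> R[i]) :
  0 <= \sum_(i <- s | P i) sqmod (F i).
Proof. by apply: sumr_ge0 => i _; exact: sqmod_ge0. Qed.

(** Cauchy-Schwarz by induction on the list: the cross term 2 a b |S| of the new square is absorbed
    by a^2 Y + X b^2, which is the inequality of arithmetic and geometric means. *)
Lemma sqmod_sum_mul (I : Type) (s : seq I) (P : pred I) (F G : I -> R[i]) :
  sqmod (\sum_(i <- s | P i) F i * G i) <=
  (\sum_(i <- s | P i) sqmod (F i)) * (\sum_(i <- s | P i) sqmod (G i)).
Proof.
elim: s => [|i s IH]; first by rewrite !big_nil sqmod0 mul0r.
rewrite !big_cons; case: (P i) => //.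
move: IH; set S := \sum_(_ <- _ | _) _ * _; set X := \sum_(_ <- _ | _) sqmod _.
set Y := \sum_(_ <- _ | _) sqmod _ => IH.
have X0 : 0 <= X by exact: sum_sqr_ge0.
have Y0 : 0 <= Y by exact: sum_sqr_ge0.
rewrite !sqmodE.
have a0 := normc_ge0 (F i); have b0 := normc_ge0 (G i).
set a := normc (F i) in a0 *; set b := normc (G i) in b0 *.
apply: (@le_trans _ _ ((a * b + normc S) ^+ 2)).
  rewrite ler_pXn2r ?nnegrE ?normc_ge0 ?addr_ge0 ?mulr_ge0 ?normc_ge0 //.
  by rewrite -ComplexField.Normc.normcM le_normcD.
have S0 := normc_ge0 S; rewrite sqmodE in IH.
have h : 2 * (a * b) * normc S <= a ^+ 2 * Y + X * b ^+ 2.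
  rewrite -(@ler_pXn2r _ 2) ?nnegrE ?addr_ge0 ?mulr_ge0 ?sqr_ge0 //.
  apply: (@le_trans _ _ (4 * (a * b) ^+ 2 * (X * Y))).
    rewrite -[4 * _]/(4 * _) exprMn [(2 * (a * b)) ^+ 2]exprMn -natrX /=.
    by apply: ler_wpM2l => //; rewrite mulr_ge0 ?sqr_ge0.
  rewrite -subr_ge0; have -> : (a ^+ 2 * Y + X * b ^+ 2) ^+ 2 -
    4 * (a * b) ^+ 2 * (X * Y) = (a ^+ 2 * Y - X * b ^+ 2) ^+ 2 by ring.
  exact: sqr_ge0.
move: IH h; nra.
Qed.

Lemma sqmod_sum_le (I : Type) (s : seq I) (P : pred I) (F : I -> R[i]) :
  sqmod (\sum_(i <- s | P i) F i) <=
  (\sum_(i <- s | P i) 1) * (\sum_(i <- s | P i) sqmod (F i)).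
Proof.
have := sqmod_sum_mul s P (fun=> 1) F.
under [X in sqmod X]eq_bigr do rewrite mul1r.
by under [X in X * _]eq_bigr do rewrite sqmod1.
Qed.

Lemma sqr_sum_mul (I : Type) (s : seq I) (P : pred I) (F G : I -> R) :
  (\sum_(i <- s | P i) F i * G i) ^+ 2 <=
  (\sum_(i <- s | P i) F i ^+ 2) * (\sum_(i <- s | P i) G i ^+ 2).
Proof.
have := sqmod_sum_mul s P (fun i => (F i)%:C) (fun i => (G i)%:C).
have -> : \sum_(i <- s | P i) (F i)%:C * (G i)%:C =
    (\sum_(i <- s | P i) F i * G i)%:C.
  by rewrite rmorph_sum; apply: eq_bigr => i _; rewrite rmorphM.
under [X in X * _]eq_bigr do rewrite sqmod_real.
by under [X in _ * X]eq_bigr do rewrite sqmod_real; rewrite sqmod_real.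
Qed.

Lemma cexpD a b : cexp (a + b) = cexp a * cexp b.
Proof.
apply: complexP; rewrite ?ReM ?ImM /cexp /= mulrDr ?cosD ?sinD //.
by rewrite addrC [X in _ + X]mulrC [X in X + _]mulrC.
Qed.

Lemma cexp0 : cexp (0 : R) = 1.
Proof. by apply: complexP; rewrite /cexp /= mulr0 ?cos0 ?sin0. Qed.

Lemma cexpN a : cexp (- a) = conjc (cexp a).
Proof. by rewrite /cexp /= mulrN cosN sinN. Qed.

Lemma sqmod_cexp a : sqmod (cexp a) = 1.
Proof. by rewrite /sqmod /= cos2Dsin2. Qed.

Lemma sqmodZ r z : sqmod (r%:C * z) = r ^+ 2 * sqmod z.
Proof. by rewrite sqmodM sqmod_real. Qed.

Lemma conjc_add z w : conjc (z + w) = conjc z + conjc w.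
Proof. by case: z w => a b [c e]; apply: complexP => //=; rewrite opprD. Qed.

Lemma conjc_mul z w : conjc (z * w) = conjc z * conjc w.
Proof. by case: z w => a b [c e]; apply: complexP => /=; ring. Qed.

Lemma conjc_sum (I : Type) (s : seq I) (P : pred I) (F : I -> R[i]) :
  conjc (\sum_(i <- s | P i) F i) = \sum_(i <- s | P i) conjc (F i).
Proof. by apply: big_morph => [z w|]; rewrite ?conjc_add ?conjc0. Qed.

End ComplexModulus.

Section TorusIntegral.
Variable R : realType.
Local Open Scope ereal_scope.

Lemma ge0_integral_torusS (n : nat) (f : n.+1.-tuple R -> \bar R) :
  measurable_fun setT f -> (forall x, 0 <= f x) ->
  \int[torus R n.+1]_x f x =
  \int[uniform_prob (@ltr01 R)]_y \int[torus R n]_z f (tuple_cons (y, z)).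
Proof.
move=> mf f0 /=; rewrite ge0_integral_distribution//.
rewrite (@fubini_tonelli1 _ _ _ _ _ _ _ (f \o @tuple_cons R n)).
- by [].
- apply: (measurableT_comp mf); exact: measurable_tuple_cons.
- by move=> x /=; exact: f0.
Qed.

(** The summand 1 makes the integrand nonnegative, so that [ge0_integral_torusS] applies without an
    integrability proof. The phase [theta] is there for the induction on the dimension, where it
    absorbs the coordinate already split off. *)
Lemma uniform_cos (theta : R) (k : int) :
  \int[uniform_prob (@ltr01 R)]_y (1 + cos (2 * pi * (theta + k%:~R * y)))%:E =
  (1 + (k == 0)%:R * cos (2 * pi * theta))%:E.
Proof.
have mcos : continuous (fun y : R => 1 + cos (2 * pi * (theta + k%:~R * y)) : R)%R.
  move=> y; apply: cvgD; first exact: cvg_cst.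
  apply: (@continuous_comp _ _ _ (fun y : R => 2 * pi * (theta + k%:~R * y))%R cos);
    last exact: continuous_cos.
  apply: cvgM; first exact: cvg_cst.
  apply: cvgD; first exact: cvg_cst.
  by apply: cvgM; [exact: cvg_cst|exact: cvg_id].
rewrite integral_uniform; last 2 first.
- apply/measurable_EFinP; exact: continuous_measurable_fun.
- by move=> y; rewrite lee_fin -lerBlDl sub0r cos_geN1.
rewrite subr0 invr1 mul1e.
have [->|k0] := eqVneq k 0%R.
  under eq_integral do rewrite mul0r addr0.
  by rewrite integral_cst//= lebesgue_measure_itv/= lte_fin ltr01 sube0 mule1 mul1r.
pose F (y : R) : R := (y + (2 * pi * k%:~R)^-1 * sin (2 * pi * (theta + k%:~R * y)))%R.
have kpi : (2 * pi * k%:~R != 0 :> R)%R.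
  by rewrite !mulf_eq0 !negb_or intr_eq0 k0 andbT pnatr_eq0 /= gt_eqF ?pi_gt0.
have dF (y : R) : is_derive y 1%R F (1 + cos (2 * pi * (theta + k%:~R * y)))%R.
  rewrite /F; apply: is_derive_eq.
  rewrite add0r mul1r /GRing.scale /= mulr1.
  by congr (_ + _)%R; rewrite mulrCA mulVf// mulr1.
have dF' y : derivable F y 1%R by have [] := dF y.
rewrite (@continuous_FTC2 _ _ F 0%R 1%R)//.
- rewrite /F -EFinB mulr1 mulr0 addr0 add0r mul0r addr0; congr EFin.
  have -> : sin (2 * pi * (theta + k%:~R)) = sin (2 * pi * theta) :> R.
    have hn (n : nat) (x : R) : sin (2 * pi * (x + n%:R)) = sin (2 * pi * x) :> R.
      elim: n x => [|n IH] x; first by rewrite addr0.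
      rewrite -[n.+1%:R]natr1 addrA.
      have -> : (2 * pi * (x + n%:R + 1) = 2 * pi * (x + n%:R) + pi *+ 2)%R.
        by rewrite -mulr_natl; ring.
      by rewrite sinD2pi IH.
    case: k {k0 mcos F kpi dF dF'} => n; first exact: hn.
    by rewrite NegzE -[LHS](hn n.+1) mulrNz -addrA addNr addr0.
  lra.
- by apply: continuous_subspaceT.
- split => //.
  + apply: cvg_at_right_filter; apply: differentiable_continuous.
    exact/derivable1_diffP/dF'.
  + apply: cvg_at_left_filter; apply: differentiable_continuous.
    exact/derivable1_diffP/dF'.
- by move=> y _; rewrite derive1E derive_val.
Qed.

Lemma measurable_dotp (d : nat) (k : d.-tuple int) :
  measurable_fun setT (dotp k : d.-tuple R -> R).
Proof.
rewrite /dotp; apply: measurable_sum => i; apply: measurable_funM => //.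
exact: measurable_tnth.
Qed.

Lemma measurable_cos_dotp (d : nat) (k : d.-tuple int) (theta : R) :
  measurable_fun setT (fun x => cos (2 * pi * (theta + dotp k x)))%R.
Proof.
apply: measurableT_comp; first by apply: continuous_measurable_fun => y; exact: continuous_cos.
apply: measurable_funM => //; apply: measurable_funD => //.
exact: measurable_dotp.
Qed.

Lemma ge0_torus_cos (d : nat) (k : d.-tuple int) (theta : R) :
  \int[torus R d]_x (1 + cos (2 * pi * (theta + dotp k x)))%:E =
  (1 + [forall i, tnth k i == 0%R]%:R * cos (2 * pi * theta))%:E.
Proof.
have c0 (y : R) : 0 <= (1 + cos y)%:E by rewrite lee_fin -lerBlDl sub0r cos_geN1.
elim: d k theta => [|d IH] k theta.
  rewrite (_ : [forall i, _] = true); last by apply/forallP => -[].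
  rewrite /= integral_dirac//; last first.
    by apply/measurable_EFinP/measurable_funD => //; exact: measurable_cos_dotp.
  by rewrite diracT mul1e /dotp big_ord0 addr0 mul1r.
rewrite ge0_integral_torusS//; last first.
  by apply/measurable_EFinP/measurable_funD => //; exact: measurable_cos_dotp.
case/tupleP: k => k0 k.
have dE (y : R) (z : d.-tuple R) :
    dotp [tuple of k0 :: k] (tuple_cons (y, z)) = (k0%:~R * y + dotp k z)%R.
  rewrite /dotp big_ord_recl !tnth0; congr (_ + _)%R.
  by apply: eq_bigr => i _; rewrite !tnthS.
under eq_integral => y _.
  under eq_integral do rewrite dE addrA.
  rewrite IH.
  over.
have -> : [forall i, tnth [tuple of k0 :: k] i == 0%R] =
    [forall i, tnth k i == 0%R] && (k0 == 0%R).
  apply/forallP/andP => [h|[/forallP h /eqP h0] i].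
    split; last by have := h ord0; rewrite tnth0.
    by apply/forallP => i; have := h (lift ord0 i); rewrite tnthS.
  by case: (unliftP ord0 i) => [j ->|->]; rewrite ?tnthS ?tnth0 ?h0.
case: [forall i, _] => /=.
  by under eq_integral do rewrite mul1r; rewrite uniform_cos.
under eq_integral do rewrite mul0r addr0.
rewrite integral_cst//.
by rewrite mul1e mul0r addr0; exact: (@probability_setT _ _ _ (uniform_prob (@ltr01 R))).
Qed.

End TorusIntegral.

(** * Integrable real functions on a probability space *)

Section RealIntegral.
Context {disp : measure_display} {T : measurableType disp} {R : realType}.
Variable mu : probability T R.
Implicit Types (f g h : T -> R).
Local Notation intR f := (mu.-integrable [set: T] (EFin \o f)).

Lemma intR_measurable f : intR f -> measurable_fun setT f.
Proof. by move=> /integrableP[/measurable_EFinP]. Qed.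

Lemma intR_bounded f (M : R) :
  measurable_fun setT f -> (forall x, `|f x| <= M) -> intR f.
Proof.
move=> mf fM; apply: measurable_bounded_integrable => //.
  by rewrite [X in (X < _)%E](@probability_setT _ _ _ mu) ltry.
exists M; split; first exact: num_real.
by move=> N MN x _; exact: le_trans (fM x) (ltW MN).
Qed.

Lemma intR_le f g : measurable_fun setT f -> intR g ->
  (forall x, `|f x| <= g x) -> intR f.
Proof.
move=> mf ig fg; apply: (le_integrable measurableT _ _ ig).
  exact/measurable_EFinP.
by move=> x _ /=; rewrite lee_fin (le_trans (fg x))// ler_norm.
Qed.

Lemma intR_ae f g : measurable_fun setT f -> intR g ->
  (forall x, 0 <= g x) ->
  {ae mu, forall x, `|f x| <= g x} -> intR f.
Proof.
move=> mf ig g0 fg; apply/integrableP; split; first exact/measurable_EFinP.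
have /integrableP[_] := ig; apply: le_lt_trans.
have mg := intR_measurable ig.
apply: ae_ge0_le_integral => //.
- by do 2 apply: measurableT_comp => //.
- by do 2 apply: measurableT_comp => //.
- by apply: filterS fg => x fgx _ /=; rewrite lee_fin (le_trans fgx)// ler_norm.
Qed.

Lemma intR_D f g : intR f -> intR g -> intR (fun x => f x + g x).
Proof. by move=> fi gi; have := integrableD measurableT fi gi. Qed.

Lemma intR_N f : intR f -> intR (fun x => - f x).
Proof. by move=> fi; have := integrableN fi. Qed.

Lemma intR_B f g : intR f -> intR g -> intR (fun x => f x - g x).
Proof. by move=> fi gi; exact: intR_D (intR_N gi). Qed.

Lemma intR_Z (a : R) f : intR f -> intR (fun x => a * f x).
Proof. by move=> fi; have := integrableZl measurableT a fi. Qed.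

Lemma intR_cst (a : R) : intR (fun=> a).
Proof. by apply: (@intR_bounded _ `|a|). Qed.

Lemma intR_sum (I : Type) (s : seq I) (P : pred I) (F : I -> T -> R) :
  (forall i, intR (F i)) -> intR (fun x => \sum_(i <- s | P i) F i x).
Proof.
move=> iF; elim: s => [|i s IH].
  by under [X in EFin \o X]funext do rewrite big_nil; exact: intR_cst.
under [X in EFin \o X]funext do rewrite big_cons.
by case: (P i) => //; exact: intR_D.
Qed.

Lemma intR_Mb f g (M : R) : measurable_fun setT f -> (forall x, `|f x| <= M) ->
  intR g -> intR (fun x => f x * g x).
Proof.
move=> mf fM ig; apply: (@intR_le _ (fun x => M * `|g x|)).
- by apply: measurable_funM => //; exact: intR_measurable.
- apply: intR_Z; have /integrableP[mg gi] := ig; apply/integrableP; split.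
    by apply/measurable_EFinP/measurableT_comp => //; exact/measurable_EFinP.
  by apply: le_lt_trans gi; under eq_integral do rewrite /= normr_id.
- by move=> x; rewrite normrM ler_wpM2r.
Qed.

Lemma Rintegral_sum (I : Type) (s : seq I) (P : pred I) (F : I -> T -> R) :
  (forall i, intR (F i)) ->
  \int[mu]_x (\sum_(i <- s | P i) F i x) = \sum_(i <- s | P i) \int[mu]_x F i x.
Proof.
move=> iF; elim: s => [|i s IH].
  under eq_Rintegral do rewrite big_nil.
  by rewrite Rintegral_cst// mul0r big_nil.
under eq_Rintegral do rewrite big_cons.
rewrite big_cons; case: (P i) => //.
by rewrite RintegralD// ?IH//; exact: intR_sum.
Qed.

Lemma EFin_Rintegral f : intR f -> (\int[mu]_x f x)%:E = (\int[mu]_x (f x)%:E)%E.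
Proof. by move=> fi; rewrite /Rintegral fineK//; exact: integrable_fin_num. Qed.

Lemma ae_eq_Rintegral f g : measurable_fun setT f -> measurable_fun setT g ->
  {ae mu, forall x, f x = g x} -> \int[mu]_x f x = \int[mu]_x g x.
Proof.
move=> mf mg fg; rewrite /Rintegral; congr fine; apply: ae_eq_integral => //.
- exact/measurable_EFinP.
- exact/measurable_EFinP.
- by apply: filterS fg => x -> _.
Qed.

Lemma Rintegral_dominated (f_ : nat -> T -> R) f g :
  (forall n, measurable_fun setT (f_ n)) -> measurable_fun setT f -> intR g ->
  {ae mu, forall x, f_ ^~ x @ \oo --> f x} ->
  {ae mu, forall x, forall n, `|f_ n x| <= g x} ->
  intR f /\ (\int[mu]_x f_ n x @[n --> \oo] --> \int[mu]_x f x).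
Proof.
move=> mf_ mf ig ff fg.
have [] := @dominated_convergence _ _ _ mu setT measurableT
  (fun n x => (f_ n x)%:E) (fun x => (f x)%:E) (fun x => (g x)%:E).
- by move=> n; exact/measurable_EFinP.
- exact/measurable_EFinP.
- by apply: filterS ff => x fx _; apply/fine_cvgP; split => //; exact: nearW.
- exact: ig.
- by apply: filterS fg => x fx n _ /=; rewrite lee_fin.
move=> fi _ cf.
split => //.
by move: cf; rewrite -EFin_Rintegral// => /fine_cvgP[].
Qed.

Lemma Lfun2P f : f \in Lfun mu 2%:E <->
  measurable_fun setT f /\ intR (fun x => f x ^+ 2).
Proof.
split => [fL|[mf fi]].
  split; last exact: Lfun2_integrable_sqr.
  by move: fL; rewrite inE => /andP[]; rewrite inE.
rewrite inE; apply/andP; split; rewrite inE //= /finite_norm unlock poweR_lty//.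
have /integrableP[_] := fi; apply: le_lt_trans; rewrite le_eqVlt; apply/orP; left.
apply/eqP; apply: eq_integral => x _ /=.
by rewrite powR_mulrn// -normrX.
Qed.

Lemma intR_sqr_M f g : measurable_fun setT f -> measurable_fun setT g ->
  intR (fun x => f x ^+ 2) -> intR (fun x => g x ^+ 2) ->
  intR (fun x => f x * g x).
Proof.
move=> mf mg fi gi; apply: (@intR_le _ (fun x => f x ^+ 2 + g x ^+ 2)).
- exact: measurable_funM.
- exact: intR_D.
- move=> x; rewrite ler_norml.
  have := sqr_ge0 (f x + g x); have := sqr_ge0 (f x - g x).
  have := sqr_ge0 (f x); have := sqr_ge0 (g x).
  by move=> *; apply/andP; split; nra.
Qed.

Lemma intR_sqr_intR f : measurable_fun setT f -> intR (fun x => f x ^+ 2) -> intR f.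
Proof.
move=> mf fi.
have := @intR_sqr_M f (fun=> 1) mf (measurable_cst _) fi (intR_cst _).
by under [X in EFin \o X]funext do rewrite mulr1.
Qed.

Lemma ae_forall_nat (P : nat -> T -> Prop) :
  (forall n, {ae mu, forall x, P n x}) -> {ae mu, forall x, forall n, P n x}.
Proof. by move=> h; apply/ae_foralln. Qed.

End RealIntegral.

(** * Uniqueness of Fourier coefficients *)

Section PeakLimit.
Variable R : realType.
Implicit Types (a y : R) (n : nat).

Lemma bernoulli_le y n : -1 <= y -> 1 + n%:R * y <= (1 + y) ^+ n.
Proof.
move=> y1; elim: n => [|n IH]; first by rewrite mul0r addr0 expr0.
rewrite exprS; have : (1 + y) * (1 + n%:R * y) <= (1 + y) * (1 + y) ^+ n.
  by apply: ler_wpM2l => //; lra.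
have n0 : 0 <= n%:R :> R by [].
rewrite -[n.+1%:R]natr1; have := mulr_ge0 n0 (sqr_ge0 y); lra.
Qed.

Lemma cvg_squeeze0 (u v : nat -> R) (l : R) :
  (forall n, `|u n - l| <= v n) -> v @ \oo --> 0 -> u @ \oo --> l.
Proof.
move=> uv v0; apply/cvgrPdist_lt => e e0.
have /cvgrPdist_lt/(_ e e0) := v0; apply: filterS => n.
rewrite sub0r normrN distrC => h; apply: le_lt_trans (uv n) _.
by apply: le_lt_trans h; rewrite ler_norm.
Qed.

(** With a = r^2, one factor r^n absorbs n, because (1 - r) n r^n is at most (1 - r)(1 + r + ... +
    r^(n-1)) = 1 - r^n; the other factor tends to 0. *)
Lemma cvg_mulrn_expr a : 0 <= a -> a < 1 -> (fun n => n%:R * a ^+ n) @ \oo --> (0 : R).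
Proof.
move=> a0 a1; pose r := Num.sqrt a.
have r0 : 0 <= r by exact: sqrtr_ge0.
have r1 : r < 1 by rewrite -[ltRHS]sqrtr1 ltr_sqrt.
apply: (@cvg_squeeze0 _ (fun n => (1 - r)^-1 * r ^+ n)).
  move=> n; rewrite subr0 ger0_norm ?mulr_ge0 ?exprn_ge0//.
  rewrite -(sqr_sqrtr a0) -/r -exprM mul2n -addnn exprD mulrA.
  apply: ler_wpM2r; first by rewrite exprn_ge0.
  rewrite -(ler_pM2l (_ : 0 < 1 - r)) ?subr_gt0// divff ?gt_eqF ?subr_gt0//.
  have h k : (k <= n)%N -> (1 - r) * (k%:R * r ^+ n) <= 1 - r ^+ k.
    elim: k => [|k IH] kn; first by rewrite mul0r mulr0 expr0 subrr.
    have := IH (ltnW kn); rewrite -[k.+1%:R]natr1 exprS.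
    have : r ^+ n <= r ^+ k.
      by rewrite ler_wiXn2l// ?ltW// ltnW.
    have := @exprn_ge0 _ n r r0; move: (r ^+ n) (r ^+ k) => x y x0 xy; nra.
  by apply: le_trans (h n (leqnn n)) _; rewrite gerBl exprn_ge0.
rewrite -(mulr0 (1 - r)^-1); apply: cvgM; first exact: cvg_cst.
by apply: cvg_expr; rewrite ger0_norm.
Qed.

(* For 0 <= a <= 1 this tends to 1 if a >= 1/2 and to 0 otherwise; evaluated at a
   squared cosine it gives trigonometric polynomials tending to the indicator of
   a half circle. *)
Definition peak (n : nat) (a : R) : R := 1 - (1 - a ^+ n) ^+ (n * 2 ^ n).

Lemma peak_itv n a : 0 <= a <= 1 -> 0 <= peak n a <= 1.
Proof.
move=> /andP[a0 a1]; rewrite /peak.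
have e0 := exprn_ge0 n a0; have e1 : a ^+ n <= 1 by rewrite exprn_ile1.
have b0 : 0 <= 1 - a ^+ n by lra.
have := exprn_ge0 (n * 2 ^ n) b0.
have : (1 - a ^+ n) ^+ (n * 2 ^ n) <= 1 by rewrite exprn_ile1//; lra.
lra.
Qed.

(** Put x = a^n and N = n 2^n. If a >= 1/2, then N x >= n, and (1 - x)^N (1 + x)^N <= 1 with
    Bernoulli gives (1 - x)^N <= 1 / (1 + n). If a < 1/2, Bernoulli bounds the peak by N x = n (2
    a)^n. *)
Lemma cvg_peak a : 0 <= a <= 1 ->
  peak ^~ a @ \oo --> ((2^-1 <= a)%R%:R : R).
Proof.
move=> /andP[a0 a1]; have e1 n : a ^+ n <= 1 by rewrite exprn_ile1.
have e0 n := exprn_ge0 n a0.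
have [a2|a2] := leP 2^-1 a.
  apply: (@cvg_squeeze0 _ (harmonic)); last exact: cvg_harmonic.
  move=> n; rewrite /peak mulr1n addrAC subrr sub0r normrN.
  set N := (n * 2 ^ n)%N; rewrite ger0_norm ?exprn_ge0 ?subr_ge0//.
  have h : 1 + n%:R <= (1 + a ^+ n) ^+ N.
    apply: le_trans (bernoulli_le _ _); last by have := e0 n; lra.
    rewrite lerD2l /N natrM -mulrA ler_peMr// natrX -exprMn exprn_ege1//.
    by rewrite -ler_pdivrMl// mulr1.
  have hN : (1 - a ^+ n) ^+ N * (1 + a ^+ n) ^+ N <= 1.
    by rewrite -exprMn exprn_ile1//; have := e0 n; have := e1 n; nra.
  rewrite /harmonic /= -[n.+1%:R]natr1 [_ + 1]addrC.
  have n1 : 0 < 1 + n%:R :> R by rewrite ltr_wpDr.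
  rewrite -[leRHS]mul1r ler_pdivlMr//; apply: le_trans hN.
  by apply: ler_wpM2l => //; rewrite exprn_ge0 ?subr_ge0.
apply: (@cvg_squeeze0 _ (fun n => n%:R * (2 * a) ^+ n)); last first.
  by apply: cvg_mulrn_expr; lra.
move=> n; rewrite subr0 ger0_norm; last first.
  by have /andP[] : 0 <= peak n a <= 1 by apply: peak_itv; rewrite a0.
rewrite /peak; have := @bernoulli_le (- a ^+ n) (n * 2 ^ n).
rewrite exprMn natrM natrX; have := e1 n; set x := a ^+ n.
move=> x1 h; have {}h := h ltac:(lra).
by move: h; rewrite mulrN; lra.
Qed.

End PeakLimit.

(** * Indicators as limits of trigonometric polynomials *)

Section TrigonometricApproximation.
Variables (R : realType) (d : nat).
Local Notation mu := (torus R d).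
Local Notation X := (d.-tuple R).
Local Notation intR f := (mu.-integrable [set: X] (EFin \o f)).

Lemma cos_bound (y : R) : `|cos y| <= 1.
Proof. by rewrite ler_norml cos_geN1 cos_le1. Qed.

Lemma intR_cos (k : d.-tuple int) (theta : R) :
  intR (fun x => cos (2 * pi * (theta + dotp k x))).
Proof.
apply: (@intR_bounded _ _ _ _ _ 1); first exact: measurable_cos_dotp.
by move=> x; exact: cos_bound.
Qed.

Lemma Rintegral_cos (k : d.-tuple int) (theta : R) :
  \int[mu]_x cos (2 * pi * (theta + dotp k x)) =
  [forall i, tnth k i == 0]%:R * cos (2 * pi * theta).
Proof.
have := ge0_torus_cos k theta; rewrite -EFin_Rintegral; last first.
  by apply: intR_D; [exact: intR_cst|exact: intR_cos].
rewrite RintegralD//; [|exact: intR_cst|exact: intR_cos].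
rewrite Rintegral_cst// [X in fine X](@probability_setT _ _ _ mu) mulr1.
by case=> /addrI.
Qed.

(** The phase supplies the sines, so that closure under products rests on a single product-to-sum
    formula. *)
Inductive trigpoly : (X -> R) -> Prop :=
| trigpoly_cos (theta : R) (k : d.-tuple int) :
    trigpoly (fun x => cos (2 * pi * (theta + dotp k x)))
| trigpolyD (f g : X -> R) :
    trigpoly f -> trigpoly g -> trigpoly (fun x => f x + g x)
| trigpolyZ (a : R) (f : X -> R) : trigpoly f -> trigpoly (fun x => a * f x).

Lemma trigpoly_eq (f g : X -> R) : trigpoly f -> f =1 g -> trigpoly g.
Proof. by move=> tf /funext <-. Qed.

Lemma dotpD (k l : d.-tuple int) (x : X) :
  dotp [tuple tnth k i + tnth l i | i < d] x = dotp k x + dotp l x.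
Proof.
rewrite /dotp -big_split; apply: eq_bigr => i _.
by rewrite tnth_mktuple rmorphD mulrDl.
Qed.

Lemma dotpB (k l : d.-tuple int) (x : X) :
  dotp [tuple tnth k i - tnth l i | i < d] x = dotp k x - dotp l x.
Proof.
rewrite /dotp -sumrB; apply: eq_bigr => i _.
by rewrite tnth_mktuple rmorphB mulrBl.
Qed.

Lemma trigpoly_cst (a : R) : trigpoly (fun=> a).
Proof.
apply: (trigpoly_eq (trigpolyZ a (trigpoly_cos 0 [tuple 0 | i < d]))) => x.
rewrite /dotp big1 ?addr0 ?mulr0 ?cos0 ?mulr1// => i _.
by rewrite tnth_mktuple mul0r.
Qed.

Lemma trigpolyM (f g : X -> R) :
  trigpoly f -> trigpoly g -> trigpoly (fun x => f x * g x).
Proof.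
move=> tf tg; elim: tf g tg => [a k|f1 f2 tf1 IH1 tf2 IH2|a f1 tf1 IH1] g tg.
- elim: tg => [b l|g1 g2 tg1 IH1 tg2 IH2|b g1 tg1 IH1].
  + apply: (trigpoly_eq (trigpolyD
      (trigpolyZ 2^-1 (trigpoly_cos (a + b) [tuple tnth k i + tnth l i | i < d]))
      (trigpolyZ 2^-1 (trigpoly_cos (a - b) [tuple tnth k i - tnth l i | i < d])))) => x.
    rewrite dotpD dotpB.
    have -> : 2 * pi * (a + b + (dotp k x + dotp l x)) =
      2 * pi * (a + dotp k x) + 2 * pi * (b + dotp l x) :> R by ring.
    have -> : 2 * pi * (a - b + (dotp k x - dotp l x)) =
      2 * pi * (a + dotp k x) - 2 * pi * (b + dotp l x) :> R by ring.
    rewrite cosD cosB; lra.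
  + by apply: (trigpoly_eq (trigpolyD IH1 IH2)) => x; rewrite [RHS]mulrDr.
  + by apply: (trigpoly_eq (trigpolyZ b IH1)) => x; rewrite [RHS]mulrCA.
- by apply: (trigpoly_eq (trigpolyD (IH1 g tg) (IH2 g tg))) => x; rewrite [RHS]mulrDl.
- by apply: (trigpoly_eq (trigpolyZ a (IH1 g tg))) => x; rewrite -[RHS]mulrA.
Qed.

Lemma trigpolyX (f : X -> R) (n : nat) :
  trigpoly f -> trigpoly (fun x => f x ^+ n).
Proof.
move=> tf; elim: n => [|n IH]; first exact: trigpoly_cst.
by apply: (trigpoly_eq (trigpolyM tf IH)) => x; rewrite exprS.
Qed.

Lemma trigpolyC (f : X -> R) : trigpoly f -> trigpoly (fun x => 1 - f x).
Proof.
move=> tf; apply: (trigpoly_eq (trigpolyD (trigpoly_cst 1) (trigpolyZ (-1) tf))).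
by move=> x; rewrite mulN1r.
Qed.

Lemma measurable_trigpoly (f : X -> R) : trigpoly f -> measurable_fun setT f.
Proof.
elim=> [a k|f1 f2 _ m1 _ m2|a f1 _ m1]; first exact: measurable_cos_dotp.
  exact: measurable_funD.
exact: measurable_funM.
Qed.

Lemma bounded_trigpoly (f : X -> R) :
  trigpoly f -> exists M, forall x, `|f x| <= M.
Proof.
elim=> [a k|f1 f2 _ [M1 m1] _ [M2 m2]|a f1 _ [M m1]].
- by exists 1 => x; exact: cos_bound.
- by exists (M1 + M2) => x; rewrite (le_trans (ler_normD _ _))// lerD.
- by exists (`|a| * M) => x; rewrite normrM ler_wpM2l.
Qed.

Definition open_cube : set X := [set x | forall i, 0 < tnth x i < 1].

(** Convergence is required only on the open cube, which has full measure: periodic functions agree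
    on opposite faces, an indicator need not. The bounds 0 and 1 serve dominated convergence and
    make intersections and complements pass to the limit. *)
Definition approximable (A : set X) := exists T_ : nat -> X -> R,
  [/\ forall n, trigpoly (T_ n), forall n x, 0 <= T_ n x <= 1 &
      forall x, open_cube x -> T_ ^~ x @ \oo --> (\1_A x : R)].

Lemma approximable_eq (A B : set X) : approximable A ->
  (forall x, open_cube x -> A x <-> B x) -> approximable B.
Proof.
move=> [T_ [t b c]] AB; exists T_; split => // x Qx.
rewrite indicE; have -> : (x \in B) = (x \in A).
  by apply/idP/idP; rewrite !inE => /AB; apply.
by rewrite -indicE; exact: c.
Qed.

Lemma approximableI (A B : set X) :
  approximable A -> approximable B -> approximable (A `&` B).
Proof.
move=> [T_ [t b c]] [S_ [t' b' c']]; exists (fun n x => T_ n x * S_ n x); split.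
- by move=> n; exact: trigpolyM.
- move=> n x; have /andP[? ?] := b n x; have /andP[? ?] := b' n x.
  by rewrite mulr_ge0//= mulr_ile1.
- by move=> x Qx; rewrite indicI; apply: cvgM; [exact: c|exact: c'].
Qed.

Lemma approximableC (A : set X) : approximable A -> approximable (~` A).
Proof.
move=> [T_ [t b c]]; exists (fun n x => 1 - T_ n x); split.
- by move=> n; exact: trigpolyC.
- by move=> n x; have /andP[? ?] := b n x; apply/andP; split; lra.
- move=> x Qx; have -> : \1_(~` A) x = 1 - \1_A x :> R.
    by rewrite !indicE in_setC; case: (x \in A); rewrite ?subrr ?subr0.
  by apply: cvgB; [exact: cvg_cst|exact: c].
Qed.

Lemma approximableT : approximable setT.
Proof.
exists (fun=> fun=> 1); split => [n|n x|x _]; first exact: trigpoly_cst.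
  by rewrite ler01 lexx.
by rewrite indicT; exact: cvg_cst.
Qed.

Lemma approximableU (A B : set X) :
  approximable A -> approximable B -> approximable (A `|` B).
Proof.
move=> a b; rewrite -[A `|` B]setCK setCU; apply: approximableC.
by apply: approximableI; exact: approximableC.
Qed.

Lemma trigpoly_coord (i : 'I_d) (c : R) :
  trigpoly (fun x => cos (2 * pi * (tnth x i - c))).
Proof.
apply: (trigpoly_eq (trigpoly_cos (- c) [tuple (j == i)%:R | j < d])) => x.
congr (cos (_ * _)); rewrite addrC; congr (_ - c).
rewrite /dotp (bigD1 i)//= tnth_mktuple eqxx mul1r big1 ?addr0// => j ji.
by rewrite tnth_mktuple (negbTE ji) mul0r.
Qed.

Lemma approximable_half (i : 'I_d) (c : R) :
  approximable [set x | 0 <= cos (2 * pi * (tnth x i - c))].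
Proof.
pose u (x : X) := (1 + cos (2 * pi * (tnth x i - c))) / 2.
have u01 x : 0 <= u x <= 1.
  by have := cos_bound (2 * pi * (tnth x i - c)); rewrite /u ler_norml => /andP[]; lra.
exists (fun n x => peak n (u x)); split.
- move=> n; apply: trigpolyC; apply: trigpolyX; apply: trigpolyC.
  apply: trigpolyX; rewrite /u.
  apply: (trigpoly_eq (trigpolyZ 2^-1 (trigpolyD (trigpoly_cst 1) (trigpoly_coord i c)))).
  by move=> x; rewrite mulrC.
- by move=> n x; exact: peak_itv.
- move=> x _; rewrite indicE.
  have -> : (x \in [set x | 0 <= cos (2 * pi * (tnth x i - c))]) = (2^-1 <= u x).
    by apply/idP/idP; rewrite inE /u /=; lra.
  exact: cvg_peak.
Qed.

Lemma cos_ge0_shift (y : R) : `|y| <= 5 / 4 ->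
  (0 <= cos (2 * pi * y)) = (`|y| <= 4^-1) || (3 / 4 <= `|y|).
Proof.
wlog y0 : y / 0 <= y => [hwlog|].
  have [|y0] := leP 0 y; first exact: hwlog.
  by have := hwlog (- y); rewrite normrN mulrN cosN; apply; lra.
have p0 := pi_gt0 R; rewrite ger0_norm// => y1.
have [y4|y4] := leP y 4^-1.
  by rewrite cos_ge0_pihalf//; apply/andP; split; nra.
have [y34|y34] := leP (3 / 4) y; last first.
  have -> : 2 * pi * y = 2 * pi * (y - 2^-1) + pi by lra.
  rewrite cosDpi /= oppr_ge0 leNgt cos_gt0_pihalf//.
  by apply/andP; split; nra.
have -> : 2 * pi * y = 2 * pi * (y - 1) + pi *+ 2 by rewrite -mulr_natl; lra.
by rewrite cosD2pi cos_ge0_pihalf//; apply/andP; split; nra.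
Qed.

(** A half circle centred at c is [c - 1/4, c + 1/4] modulo 1. For b <= 1/2 the ray is the
    intersection of the half circles [0, 1/2] and [b - 1/2, b]; for b > 1/2 it is [0, 1/2] together
    with the intersection of [1/2, 1] and [b - 1/2, b]. *)
Lemma approximable_ray (i : 'I_d) (b : R) : approximable [set x | tnth x i <= b].
Proof.
have [b0|b0] := leP b 0.
  apply: (approximable_eq (approximableC approximableT)) => x /(_ i)/andP[x0 _].
  by split => [/(_ I)//|/= xb]; lra.
have [b1|b1] := leP 1 b.
  apply: (approximable_eq approximableT) => x /(_ i)/andP[x0 x1].
  by split => //= _; lra.
have H c x : open_cube x -> -4^-1 <= c <= 3 / 4 ->
    [set x | 0 <= cos (2 * pi * (tnth x i - c))] x <->
    (c - 4^-1 <= tnth x i <= c + 4^-1) || (tnth x i <= c - 3 / 4)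
      || (c + 3 / 4 <= tnth x i).
  move=> /(_ i)/andP[x0 x1] /andP[c0 c1] /=; rewrite cos_ge0_shift; last first.
    by rewrite ler_norml; apply/andP; split; lra.
  rewrite ler_distl ler_normr.
  rewrite (_ : (3 / 4 <= tnth x i - c) = (c + 3 / 4 <= tnth x i)); last by lra.
  rewrite (_ : (3 / 4 <= - (tnth x i - c)) = (tnth x i <= c - 3 / 4)); last by lra.
  by rewrite -orbA [X in _ || X]orbC.
have [b2|b2] := leP b 2^-1.
  apply: (approximable_eq (approximableI (approximable_half i 4^-1)
    (approximable_half i (b - 4^-1)))) => x Qx.
  have /andP[x0 x1] := Qx i.
  have e1 := H 4^-1 x Qx ltac:(lra).
  have e2 := H (b - 4^-1) x Qx ltac:(lra).
  rewrite /setI; split => [[/e1 h1 /e2 h2]|/= xb]; first by rewrite /=; lra.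
  by split; [apply/e1; lra|apply/e2; lra].
apply: (approximable_eq (approximableU (approximable_half i 4^-1)
  (approximableI (approximable_half i (3 / 4)) (approximable_half i (b - 4^-1))))) => x Qx.
have /andP[x0 x1] := Qx i.
have e1 := H 4^-1 x Qx ltac:(lra).
have e2 := H (3 / 4) x Qx ltac:(lra).
have e3 := H (b - 4^-1) x Qx ltac:(lra).
rewrite /setI /setU; split => [[/e1 h|[/e2 h1 /e3 h2]]|/= xb].
- by rewrite /=; lra.
- by rewrite /=; lra.
- have [x2|x2] := leP (tnth x i) 2^-1; [left|right; split].
  + by apply/e1; lra.
  + by apply/e2; lra.
  + by apply/e3; lra.
Qed.

End TrigonometricApproximation.

Section FourierUniqueness.
Variable R : realType.

Lemma measurable_open_cube (d : nat) : measurable (@open_cube R d).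
Proof.
rewrite (_ : @open_cube R d = \bigcap_(i in [set: 'I_d]) ((fun x => tnth x i) @^-1` `]0, 1[)).
  apply: fin_bigcap_measurable => // i _.
  by rewrite -[X in measurable X]setTI; apply: measurable_tnth => //; exact: measurable_itv.
apply/seteqP; split => [x h i _|x h i]; first by rewrite /= in_itv /=; exact: h.
by have := h i I; rewrite /= in_itv.
Qed.

Lemma torus_open_cube (d : nat) : torus R d (@open_cube R d) = 1%E.
Proof.
elim: d => [|d IH].
  rewrite /= diracE (_ : _ \in _ = true)//; apply/mem_set => -[].
  by [].
rewrite /= /distribution /pushforward.
have -> : @tuple_cons R d @^-1` @open_cube R d.+1 = `]0, 1[%classic `*` @open_cube R d.
  apply/seteqP; split => [[y z] h|[y z] [/= h1 h2] i] /=.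
    split; first by have := h ord0; rewrite tnth0 /= in_itv.
    by move=> i; have := h (lift ord0 i); rewrite tnthS.
  have [j ->|->] := unliftP ord0 i; first by rewrite tnthS; exact: h2.
  by rewrite tnth0; move: h1; rewrite in_itv.
rewrite product_measure1E//; [|exact: measurable_open_cube].
rewrite [X in (_ * X)%E]IH mule1 /= /uniform_prob.
rewrite (eq_integral (fun=> 1%E)); last first.
  move=> y; rewrite inE /= in_itv /= /uniform_pdf => /andP[y0 y1].
  by rewrite (ltW y0) (ltW y1) subr0 invr1.
by rewrite integral_cst//= lebesgue_measure_itv/= lte_fin ltr01 sube0 mule1.
Qed.

Lemma ae_open_cube (d : nat) : {ae torus R d, forall x, @open_cube R d x}.
Proof.
exists (~` @open_cube R d); split => //.
- by apply: measurableC; exact: measurable_open_cube.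
- have := @probability_setC _ _ _ (torus R d) _ (@measurable_open_cube d).
  by rewrite torus_open_cube subee.
Qed.

Section Annihilator.
Variable d : nat.
Local Notation mu := (torus R d).
Local Notation X := (d.-tuple R).
Local Notation intR f := (mu.-integrable [set: X] (EFin \o f)).
Variable h : X -> R.
Hypothesis ih : intR h.
Hypothesis h0 : forall (theta : R) (k : d.-tuple int),
  \int[mu]_x (h x * cos (2 * pi * (theta + dotp k x))) = 0.

Lemma intR_trigpolyM f : trigpoly f -> intR (fun x => h x * f x).
Proof.
move=> tf; have [M fM] := bounded_trigpoly tf.
under [X in EFin \o X]funext do rewrite mulrC.
by apply: (intR_Mb _ fM) => //; exact: measurable_trigpoly.
Qed.

Lemma annihilate_trigpoly f : trigpoly f -> \int[mu]_x (h x * f x) = 0.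
Proof.
elim=> [theta k|f1 f2 t1 i1 t2 i2|a f1 t1 i1]; first exact: h0.
- under eq_Rintegral do rewrite mulrDr.
  by rewrite RintegralD// ?i1 ?i2 ?addr0//; exact: intR_trigpolyM.
- under eq_Rintegral do rewrite mulrCA.
  by rewrite RintegralZl// ?i1 ?mulr0//; exact: intR_trigpolyM.
Qed.

Lemma intR_indicM (A : set X) : measurable A -> intR (fun x => \1_A x * h x).
Proof.
move=> mA; apply: (@intR_Mb _ _ _ _ _ _ 1) => // x.
by rewrite indicE; case: (x \in A); rewrite ?normr1 ?normr0.
Qed.

Lemma annihilate_approximable (A : set X) : measurable A -> approximable A ->
  \int[mu]_x (\1_A x * h x) = 0.
Proof.
move=> mA [T_ [t b c]].
have [|||||_] := @Rintegral_dominated _ _ _ mu (fun n x => h x * T_ n x)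
  (fun x => \1_A x * h x) (fun x => `|h x|).
- by move=> n; apply: intR_measurable; exact: intR_trigpolyM.
- exact: intR_measurable (intR_indicM mA).
- have /integrableP[mh hi] := ih; apply/integrableP; split.
    by apply/measurable_EFinP/measurableT_comp => //; exact/measurable_EFinP.
  by apply: le_lt_trans hi; under eq_integral do rewrite /= normr_id.
- apply: filterS (ae_open_cube d) => x Qx; rewrite [X in _ --> X]mulrC.
  by apply: cvgM; [exact: cvg_cst|exact: c].
- apply: aeW => x n; rewrite normrM ler_piMr//.
  by have /andP[? ?] := b n x; rewrite ger0_norm.
under eq_fun do rewrite (annihilate_trigpoly (t _)).
by move=> /cvg_lim <- //; rewrite lim_cst.
Qed.

(** A pi-lambda argument: the approximable measurable sets are closed under intersection and contain
    complements of coordinate rays, hence generate the product sigma-algebra, while the sets over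
    which h integrates to 0 form a lambda-system containing them. *)
Lemma ae_eq0_annihilator : {ae mu, forall x, h x = 0}.
Proof.
pose H : set (set X) := [set A | measurable A /\ \int[mu]_x (\1_A x * h x) = 0].
pose G : set (set X) := [set A | measurable A /\ approximable A].
have GH : G `<=` H by move=> A [mA aA]; split => //; exact: annihilate_approximable.
have GI : setI_closed G.
  move=> A B [mA aA] [mB aB]; split; first exact: measurableI.
  exact: approximableI.
have lH : lambda_system setT H.
  split => //.
  - by apply: GH; split => //; exact: approximableT.
  - move=> B A AB [mB iB] [mA iA]; split; first exact: measurableD.
    transitivity (\int[mu]_x (\1_B x * h x - \1_A x * h x)).
      apply: eq_Rintegral => x _; rewrite -mulrBl; congr (_ * _).
      rewrite !indicE in_setD; have [xA|xA] := boolP (x \in A).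
        by rewrite (mem_set (AB _ (set_mem xA))) subrr.
      by rewrite subr0 andbT.
    by rewrite RintegralB// ?iA ?iB ?subr0//; exact: intR_indicM.
  - move=> F ndF FH; have mF : measurable (\bigcup_n F n).
      by apply: bigcup_measurable => n _; exact: (FH n).1.
    split => //.
    have [|||||_] := @Rintegral_dominated _ _ _ mu (fun n x => \1_(F n) x * h x)
      (fun x => \1_(\bigcup_n F n) x * h x) (fun x => `|h x|).
    + by move=> n; exact: intR_measurable (intR_indicM (FH n).1).
    + exact: intR_measurable (intR_indicM mF).
    + have /integrableP[mh hi] := ih; apply/integrableP; split.
        by apply/measurable_EFinP/measurableT_comp => //; exact/measurable_EFinP.
      by apply: le_lt_trans hi; under eq_integral do rewrite /= normr_id.
    + apply: aeW => x; apply: cvgM; last exact: cvg_cst.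
      have [[m _ Fmx]|nFx] := pselect ((\bigcup_n F n) x).
        apply/cvg_ballP => e e0; exists m => // n /= mn.
        rewrite !indicE !mem_set//; first exact: ballxx.
          by have /subsetPset := ndF _ _ mn; apply.
        by exists m.
      rewrite indicE memNset//; apply/cvg_ballP => e e0; near=> n.
      rewrite indicE memNset; first exact: ballxx.
      by move=> Fnx; apply: nFx; exists n.
    + apply: aeW => x n; rewrite normrM ler_piMl//.
      by rewrite indicE; case: (x \in F n); rewrite ?normr1 ?normr0.
    under eq_fun do rewrite (FH _).2.
    by move=> /cvg_lim <- //; rewrite lim_cst.
have sub (A : set X) : measurable A -> <<s setT, G >> A.
  move: A; apply: smallest_sub; first exact: smallest_sigma_algebra.
  move=> A; rewrite -bigcup_seq => -[i _ [B mB <-]].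
  have mt : measurable_fun setT ((fun x : X => tnth x i) : g_sigma_algebraType G -> R).
    apply: (measurability _ (RGenOInfty.measurableE R)).
    move=> _ [_ [b ->] <-]; rewrite setTI; apply: sub_sigma_algebra; split.
      rewrite -[X in measurable X]setTI.
      by apply: measurable_tnth => //; exact: measurable_itv.
    apply: (approximable_eq (approximableC (approximable_ray i b))) => x _ /=.
    by rewrite in_itv/= andbT ltNge; split => /negP.
  exact: mt.
have ann (A : set X) : measurable A -> \int[mu]_x (\1_A x * h x) = 0.
  move=> mA.
  by have [] := @lambda_system_subset _ G GI setT H lH GH (fun Y _ => @subsetT _ Y) A (sub A mA).
have ae : ae_eq mu setT (EFin \o h) (fun=> 0%E).
  apply: integral_ae_eq => // E _ mE; rewrite integral0.
  have : (\int[mu]_x (\1_E x * h x))%:E = 0%E by rewrite ann.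
  rewrite EFin_Rintegral; last exact: intR_indicM.
  move=> <-; rewrite integral_mkcond; apply: eq_integral => x _.
  by rewrite patchE indicE /=; case: (x \in E); rewrite ?mul1r ?mul0r.
by apply: filterS ae => x /(_ I)[].
Unshelve. all: by end_near.
Qed.

End Annihilator.
End FourierUniqueness.

(** * The Hilbert space of square-integrable functions *)

Section SquareIntegrable.
Variables (R : realType) (d : nat).
Local Notation mu := (torus R d).
Local Notation X := (d.-tuple R).
Local Notation intR f := (mu.-integrable [set: X] (EFin \o f)).
Local Notation Re := complex.Re.
Local Notation Im := complex.Im.
Implicit Types (F G H : X -> R[i]) (a : R[i]) (k l : d.-tuple int).

Definition cmeasurable F :=
  measurable_fun setT (fun x => Re (F x)) /\ measurable_fun setT (fun x => Im (F x)).

Definition cintegrable F :=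
  intR (fun x => Re (F x)) /\ intR (fun x => Im (F x)).

Lemma cmeasurableD F G : cmeasurable F -> cmeasurable G ->
  cmeasurable (fun x => F x + G x).
Proof.
move=> [F1 F2] [G1 G2]; split.
  by under eq_fun do rewrite ReD; exact: measurable_funD.
by under eq_fun do rewrite ImD; exact: measurable_funD.
Qed.

Lemma cmeasurableM F G : cmeasurable F -> cmeasurable G ->
  cmeasurable (fun x => F x * G x).
Proof.
move=> [F1 F2] [G1 G2]; split.
  under eq_fun do rewrite ReM.
  by apply: measurable_funB; exact: measurable_funM.
under eq_fun do rewrite ImM.
by apply: measurable_funD; exact: measurable_funM.
Qed.

Lemma cmeasurable_cst a : cmeasurable (fun=> a).
Proof. by split; exact: measurable_cst. Qed.

Lemma cmeasurableJ F : cmeasurable F -> cmeasurable (fun x => conjc (F x)).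
Proof.
move=> [F1 F2]; split.
  rewrite (_ : (fun x => _) = (fun x => Re (F x)))//.
  by apply/funext => x; case: (F x).
rewrite (_ : (fun x => _) = (fun x => - Im (F x))); first exact: measurableT_comp.
by apply/funext => x; case: (F x).
Qed.

Lemma cmeasurable_sum (I : Type) (s : seq I) (P : pred I) (H : I -> X -> R[i]) :
  (forall i, cmeasurable (H i)) -> cmeasurable (fun x => \sum_(i <- s | P i) H i x).
Proof.
move=> mH; elim: s => [|i s IH].
  by under eq_fun do rewrite big_nil; exact: cmeasurable_cst.
under eq_fun do rewrite big_cons.
by case: (P i) => //; exact: cmeasurableD.
Qed.

Lemma cmeasurable_cexp k (theta : R) : cmeasurable (fun x => cexp (theta + dotp k x)).
Proof.
split; first exact: measurable_cos_dotp.
(* The sine is the cosine delayed by a quarter period. *)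
rewrite (_ : (fun x => _) = (fun x => cos (2 * pi * ((theta - 4^-1) + dotp k x)))).
  exact: measurable_cos_dotp.
apply/funext => x; rewrite /cexp /=.
have -> : 2 * pi * (theta - 4^-1 + dotp k x) =
  2 * pi * (theta + dotp k x) - pi / 2 :> R by field.
by rewrite cosB cos_pihalf sin_pihalf mulr0 add0r mulr1.
Qed.

Lemma measurable_sqmod F : cmeasurable F -> measurable_fun setT (fun x => sqmod (F x)).
Proof. by move=> [F1 F2]; apply: measurable_funD; exact: measurable_funX. Qed.

Lemma L2funP F :
  L2fun F <-> cmeasurable F /\ intR (fun x => sqmod (F x)).
Proof.
split => [[/Lfun2P[m1 i1] /Lfun2P[m2 i2]]|[[m1 m2] i]].
  by split => //; exact: intR_D.
split; apply/Lfun2P; split => //.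
  apply: (intR_le _ i); first exact: measurable_funX.
  by move=> x; rewrite ger0_norm ?sqr_ge0 ?Re_le_sqmod.
apply: (intR_le _ i); first exact: measurable_funX.
by move=> x; rewrite ger0_norm ?sqr_ge0 ?Im_le_sqmod.
Qed.

Lemma L2funD F G : L2fun F -> L2fun G -> L2fun (fun x => F x + G x).
Proof.
move=> /L2funP[mF iF] /L2funP[mG iG]; apply/L2funP; split; first exact: cmeasurableD.
apply: (@intR_le _ _ _ _ _ (fun x => 2 * sqmod (F x) + 2 * sqmod (G x))).
- by apply: measurable_sqmod; exact: cmeasurableD.
- by apply: intR_D; exact: intR_Z.
- by move=> x; rewrite ger0_norm ?sqmod_ge0 ?sqmodD_le.
Qed.

Lemma L2funZ a F : L2fun F -> L2fun (fun x => a * F x).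
Proof.
move=> /L2funP[mF iF]; apply/L2funP; split.
  by apply: cmeasurableM => //; exact: cmeasurable_cst.
by under [X in EFin \o X]funext do rewrite sqmodM; exact: intR_Z.
Qed.

Lemma L2fun_bounded F (M : R) : cmeasurable F -> (forall x, sqmod (F x) <= M) -> L2fun F.
Proof.
move=> mF bF; apply/L2funP; split => //.
apply: (@intR_bounded _ _ _ _ _ M); first exact: measurable_sqmod.
by move=> x; rewrite ger0_norm ?sqmod_ge0.
Qed.

Lemma L2fun_sum (I : Type) (s : seq I) (P : pred I) (H : I -> X -> R[i]) :
  (forall i, L2fun (H i)) -> L2fun (fun x => \sum_(i <- s | P i) H i x).
Proof.
move=> mH; elim: s => [|i s IH].
  under eq_fun do rewrite big_nil; apply: (@L2fun_bounded _ 0).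
    exact: cmeasurable_cst.
  by rewrite sqmod0.
under eq_fun do rewrite big_cons.
by case: (P i) => //; exact: L2funD.
Qed.

Lemma L2fun_cexp k : L2fun (fun x : X => cexp (dotp k x)).
Proof.
apply: (@L2fun_bounded _ 1); last by move=> x; rewrite sqmod_cexp.
by have := cmeasurable_cexp k 0; under eq_fun do rewrite add0r.
Qed.

Lemma cintegrable_mulJ F G : L2fun F -> L2fun G ->
  cintegrable (fun x => conjc (F x) * G x).
Proof.
move=> /[dup] /L2funP[mF _] [/Lfun2P[F1 F2] /Lfun2P[F3 F4]].
move=> [/Lfun2P[G1 G2] /Lfun2P[G3 G4]]; split.
  rewrite (_ : (fun x => _) = (fun x => Re (F x) * Re (G x) + Im (F x) * Im (G x))).
    by apply: intR_D; exact: intR_sqr_M.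
  by apply/funext => x; case: (F x) (G x) => p q [r s] /=; lra.
rewrite (_ : (fun x => _) = (fun x => Re (F x) * Im (G x) - Im (F x) * Re (G x))).
  by apply: intR_B; exact: intR_sqr_M.
by apply/funext => x; case: (F x) (G x) => p q [r s] /=; lra.
Qed.

Lemma cintegralD F G : cintegrable F -> cintegrable G ->
  cintegral (fun x => F x + G x) = cintegral F + cintegral G.
Proof.
move=> [F1 F2] [G1 G2]; apply: complexP.
  by rewrite ReD /=; under eq_Rintegral do rewrite ReD; rewrite RintegralD.
by rewrite ImD /=; under eq_Rintegral do rewrite ImD; rewrite RintegralD.
Qed.

Lemma cintegralZ a F : cintegrable F ->
  cintegral (fun x => a * F x) = a * cintegral F.
Proof.
move=> [F1 F2]; apply: complexP.
  rewrite ReM /=; under eq_Rintegral do rewrite ReM.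
  by rewrite RintegralB ?RintegralZl//; exact: intR_Z.
rewrite ImM /=; under eq_Rintegral do rewrite ImM.
by rewrite RintegralD ?RintegralZl//; exact: intR_Z.
Qed.

Lemma cintegralJ F : cintegrable F ->
  cintegral (fun x => conjc (F x)) = conjc (cintegral F).
Proof.
move=> [F1 F2]; apply: complexP; rewrite /=.
  by apply: eq_Rintegral => x _; case: (F x).
transitivity (\int[mu]_x (-1 * Im (F x))).
  by apply: eq_Rintegral => x _; rewrite mulN1r; case: (F x).
by rewrite RintegralZl// mulN1r.
Qed.

Lemma ae_eq_cintegral F G : cmeasurable F -> cmeasurable G ->
  {ae mu, forall x, F x = G x} -> cintegral F = cintegral G.
Proof.
move=> [F1 F2] [G1 G2] FG; apply: complexP; apply: ae_eq_Rintegral => //.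
  by apply: filterS FG => x ->.
by apply: filterS FG => x ->.
Qed.

Definition ipfun F G : R[i] := cintegral (fun x => conjc (F x) * G x).

Lemma ipfunD F G H : L2fun F -> L2fun G -> L2fun H ->
  ipfun F (fun x => G x + H x) = ipfun F G + ipfun F H.
Proof.
move=> iF iG iH; rewrite /ipfun -cintegralD; [|exact: cintegrable_mulJ..].
by congr cintegral; apply/funext => x; rewrite mulrDr.
Qed.

Lemma ipfunZ a F G : L2fun F -> L2fun G ->
  ipfun F (fun x => a * G x) = a * ipfun F G.
Proof.
move=> iF iG; rewrite /ipfun -cintegralZ; last exact: cintegrable_mulJ.
by congr cintegral; apply/funext => x; rewrite mulrCA.
Qed.

Lemma ipfunJ F G : L2fun F -> L2fun G -> ipfun G F = conjc (ipfun F G).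
Proof.
move=> iF iG; rewrite /ipfun -cintegralJ; last exact: cintegrable_mulJ.
congr cintegral; apply/funext => x; case: (F x) (G x) => p q [r t].
by apply: complexP => /=; lra.
Qed.

Lemma ipfunxx F : L2fun F -> ipfun F F = (\int[mu]_x sqmod (F x))%:C%C.
Proof.
move=> iF; apply: complexP; rewrite /=.
  by apply: eq_Rintegral => x _; rewrite mulJc.
by under eq_Rintegral do rewrite mulJc /=; rewrite Rintegral_cst// mul0r.
Qed.

Lemma ae_eq_ipfun F F' G G' : cmeasurable F -> cmeasurable F' ->
  cmeasurable G -> cmeasurable G' ->
  {ae mu, forall x, F x = F' x} -> {ae mu, forall x, G x = G' x} ->
  ipfun F G = ipfun F' G'.
Proof.
move=> mF mF' mG mG' FF' GG'; apply: ae_eq_cintegral.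
- by apply: cmeasurableM => //; exact: cmeasurableJ.
- by apply: cmeasurableM => //; exact: cmeasurableJ.
- by apply: filterS2 FF' GG' => x -> ->.
Qed.

Lemma fourierE F k : fourier F k = ipfun (fun x : X => cexp (dotp k x)) F.
Proof.
by congr cintegral; apply/funext => x; rewrite cexpN mulrC.
Qed.

Lemma fourierD F G : L2fun F -> L2fun G ->
  fourier (fun x => F x + G x) = fun k => fourier F k + fourier G k.
Proof.
move=> iF iG; apply/funext => k; rewrite !fourierE ipfunD//; exact: L2fun_cexp.
Qed.

Lemma fourierZ a F : L2fun F ->
  fourier (fun x => a * F x) = fun k => a * fourier F k.
Proof.
by move=> iF; apply/funext => k; rewrite !fourierE ipfunZ//; exact: L2fun_cexp.
Qed.

Lemma ae_eq_fourier F G : cmeasurable F -> cmeasurable G ->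
  {ae mu, forall x, F x = G x} -> fourier F = fourier G.
Proof.
move=> mF mG FG; apply/funext => k; rewrite !fourierE.
have /L2funP[mk _] := L2fun_cexp k.
by apply: ae_eq_ipfun => //; apply: aeW.
Qed.

Lemma ipfun_cexp k l :
  ipfun (fun x : X => cexp (dotp k x)) (fun x => cexp (dotp l x)) = (l == k)%:R.
Proof.
rewrite /ipfun (_ : (fun x => _) =
    fun x => cexp (dotp [tuple tnth l i - tnth k i | i < d] x)); last first.
  by apply/funext => x; rewrite dotpB cexpD cexpN mulrC.
have e : [forall i, tnth [tuple tnth l i - tnth k i | i < d] i == 0] = (l == k).
  apply/forallP/eqP => [h|-> i]; last by rewrite tnth_mktuple subrr.
  by apply: eq_from_tnth => i; have := h i; rewrite tnth_mktuple subr_eq0 => /eqP.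
set m := [tuple _ | _ < d] in e *.
have c := Rintegral_cos m (0 : R); have s := Rintegral_cos m (- 4^-1 : R).
apply: complexP; rewrite /cexp /=.
  under eq_Rintegral do rewrite -[dotp _ _]add0r.
  by rewrite c e mulr0 cos0 mulr1; case: (l == k).
transitivity (\int[mu]_x cos (2 * pi * (- 4^-1 + dotp m x))).
  apply: eq_Rintegral => x _.
  have -> : 2 * pi * (- 4^-1 + dotp m x) = 2 * pi * dotp m x - pi / 2 :> R by field.
  by rewrite cosB cos_pihalf sin_pihalf mulr0 add0r mulr1.
rewrite s (_ : 2 * pi * - 4^-1 = - (pi / 2)); last by field.
by rewrite cosN cos_pihalf mulr0; case: (l == k).
Qed.

(** [ae_eq0_annihilator] is about real functions, so the real and imaginary parts of F - G are
    treated separately. A single coefficient mixes their cosine and sine integrals; comparing k with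
    -k separates these. *)
Lemma fourier_inj F G : L2fun F -> L2fun G -> fourier F = fourier G ->
  {ae mu, forall x, F x = G x}.
Proof.
move=> iF iG FG; pose H x := F x + (-1) * G x.
have iH : L2fun H by apply: L2funD => //; exact: L2funZ.
have H0 k : fourier H k = 0.
  by rewrite fourierD// ?fourierZ// ?FG ?mulN1r ?subrr//; exact: L2funZ.
have /L2funP[[m1 m2] _] := iH; have [/Lfun2P[_ i1] /Lfun2P[_ i2]] := iH.
have j1 := intR_sqr_intR m1 i1; have j2 := intR_sqr_intR m2 i2.
pose c k x : R := cos (2 * pi * dotp k x); pose s k x : R := sin (2 * pi * dotp k x).
have cb f k theta : intR f ->
    intR (fun x => f x * cos (2 * pi * (theta + dotp k x))).
  move=> jf; under [X in EFin \o X]funext do rewrite mulrC.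
  apply: (@intR_Mb _ _ _ _ _ _ 1) => //; first exact: measurable_cos_dotp.
  by move=> x; exact: cos_bound.
have ic f k : intR f -> intR (fun x => f x * c k x).
  by move=> /(cb f k 0); under [X in EFin \o X]funext do rewrite add0r.
have sE x : sin x = cos (x - pi / 2) :> R.
  by rewrite cosB cos_pihalf sin_pihalf mulr0 add0r mulr1.
have is_ f k : intR f -> intR (fun x => f x * s k x).
  move=> /(cb f k (- 4^-1)); congr (_.-integrable _ _).
  apply/funext => x /=; congr (_ * _)%:E; rewrite /s sE; congr cos; by field.
have ReH : forall k, \int[mu]_x (Re (H x) * c k x) + \int[mu]_x (Im (H x) * s k x) = 0.
  move=> k.
  have := congr1 (fun z : R[i] => complex.Re z) (H0 k); rewrite /= => <-.
  rewrite -RintegralD//; [|exact: ic|exact: is_].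
  apply: eq_Rintegral => x _; rewrite ReM cexpN /= /c /s; lra.
have ImH : forall k, \int[mu]_x (Im (H x) * c k x) - \int[mu]_x (Re (H x) * s k x) = 0.
  move=> k.
  have := congr1 (fun z : R[i] => complex.Im z) (H0 k); rewrite /= => <-.
  rewrite -RintegralB//; [|exact: ic|exact: is_].
  apply: eq_Rintegral => x _; rewrite ImM cexpN /= /c /s; lra.
pose opp k : d.-tuple int := [tuple - tnth k i | i < d].
have dN k x : dotp (opp k) x = - dotp k x :> R.
  rewrite /dotp -sumrN; apply: eq_bigr => i _.
  by rewrite tnth_mktuple rmorphN mulNr.
have cN k f : \int[mu]_x (f x * c (opp k) x) = \int[mu]_x (f x * c k x).
  by apply: eq_Rintegral => x _; rewrite /c dN mulrN cosN.
have sN k f : intR f -> \int[mu]_x (f x * s (opp k) x) = - \int[mu]_x (f x * s k x).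
  move=> jf; rewrite -mulN1r -RintegralZl//; last exact: is_.
  by apply: eq_Rintegral => x _; rewrite /s dN mulrN sinN mulrN mulN1r.
have zero f : intR f -> (forall k, \int[mu]_x (f x * c k x) = 0) ->
    (forall k, \int[mu]_x (f x * s k x) = 0) -> {ae mu, forall x, f x = 0}.
  move=> jf fc fs; apply: ae_eq0_annihilator => // theta k.
  transitivity (cos (2 * pi * theta) * \int[mu]_x (f x * c k x) -
      sin (2 * pi * theta) * \int[mu]_x (f x * s k x)); last by rewrite fc fs !mulr0 subrr.
  rewrite -!RintegralZl//; [|exact: is_|exact: ic].
  rewrite -RintegralB//; last 2 first.
  - by apply: intR_Z; exact: ic.
  - by apply: intR_Z; exact: is_.
  by apply: eq_Rintegral => x _; rewrite mulrDr cosD /c /s; lra.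
have h1 : {ae mu, forall x, Re (H x) = 0}.
  apply: zero => // k.
    by have := ReH k; have := ReH (opp k); rewrite cN sN//; lra.
  by have := ImH k; have := ImH (opp k); rewrite cN sN//; lra.
have h2 : {ae mu, forall x, Im (H x) = 0}.
  apply: zero => // k.
    by have := ImH k; have := ImH (opp k); rewrite cN sN//; lra.
  by have := ReH k; have := ReH (opp k); rewrite cN sN//; lra.
apply: filterS2 h1 h2 => x e1 e2; apply/eqP; rewrite -subr_eq0 -mulN1r; apply/eqP.
exact: complexP.
Qed.

End SquareIntegrable.

(** * Almost everywhere convergence at a geometric rate *)

Section GeometricConvergence.
Variables (R : realType) (d : nat).
Local Notation mu := (torus R d).
Local Notation X := (d.-tuple R).
Local Notation intR f := (mu.-integrable [set: X] (EFin \o f)).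

Lemma cvg_ler (u : nat -> R) (l c : R) (N : nat) :
  u @ \oo --> l -> (forall n, (N <= n)%N -> u n <= c) -> l <= c.
Proof.
move=> ul uc; rewrite leNgt; apply/negP => cl.
have /cvgrPdist_lt/(_ (l - c)) := ul; rewrite subr_gt0 => /(_ cl)[m _ h].
have := h (maxn m N); rewrite /= leq_maxl => /(_ isT).
have := uc (maxn m N) (leq_maxr _ _).
by have := ler_norm (l - u (maxn m N)); lra.
Qed.

(** S is the sum of the functions kappa^-m D_m. One of the two factors kappa^m in the hypothesis
    makes their integrals summable, the other one survives as pointwise decay. *)
Lemma ae_weighted_bound (kappa C : R) (D : nat -> X -> \bar R) :
  0 < kappa -> kappa < 1 -> 0 <= C ->
  (forall m, measurable_fun setT (D m)) -> (forall m x, 0 <= D m x)%E ->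
  (forall m, \int[mu]_x D m x <= (C * kappa ^+ m * kappa ^+ m)%:E)%E ->
  exists S : X -> R, [/\ intR S, forall x, 0 <= S x &
    {ae mu, forall x, forall m, (D m x <= (kappa ^+ m * S x)%:E)%E}].
Proof.
move=> k0 k1 C0 mD D0 iD.
have km m : 0 < kappa ^+ m by rewrite exprn_gt0.
pose g m x := ((kappa ^+ m)^-1%:E * D m x)%E.
have g0 m x : (0 <= g m x)%E by rewrite mule_ge0// lee_fin invr_ge0 ltW.
have mg m : measurable_fun setT (g m) by exact: measurable_funeM.
pose S0 x := (\sum_(m <oo) g m x)%E.
have mS0 : measurable_fun setT S0.
  apply: (eq_measurable_fun (fun x => \sum_(i <oo | i \in xpredT) g i x)%E) => //.
  by apply: ge0_emeasurable_sum.
have S00 x : (0 <= S0 x)%E by exact: nneseries_ge0.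
have iS0 : mu.-integrable setT S0.
  apply/integrableP; split => //.
  under eq_integral do rewrite gee0_abs//.
  rewrite integral_nneseries//.
  apply: (@le_lt_trans _ _ (\sum_(m <oo) (C * kappa ^+ m)%:E)%E).
    apply: lee_nneseries => [m _ _|m _]; first exact: integral_ge0.
    rewrite ge0_integralZl//; last by rewrite lee_fin invr_ge0 ltW.
    apply: (@le_trans _ _ ((kappa ^+ m)^-1%:E * (C * kappa ^+ m * kappa ^+ m)%:E)%E).
      by rewrite lee_wpmul2l// lee_fin invr_ge0 ltW.
    by rewrite -EFinM lee_fin mulrC mulfK// gt_eqF.
  have cg : `|kappa| < 1 by rewrite gtr0_norm.
  have h : (\sum_(m <oo) (C * kappa ^+ m)%:E)%E = (C * (1 - kappa)^-1)%:E.
    apply/cvg_lim => //; rewrite (_ : (fun n => _) =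
        EFin \o series (geometric C kappa)); last first.
      by apply/funext => n; rewrite /series /= sumEFin.
    by apply: cvg_EFin; [exact: nearW|exact: cvg_geometric_series].
  by rewrite h ltry.
exists (fun x => fine (S0 x)); split.
- have /integrableP[_ fS] := iS0; apply/integrableP; split.
    apply/measurable_EFinP; exact: measurableT_comp.
  apply: le_lt_trans fS; apply: ge0_le_integral => //.
  + by apply: measurableT_comp => //; apply/measurable_EFinP; exact: measurableT_comp.
  + exact: measurableT_comp.
  + move=> x _ /=; case: (S0 x) => [r| |] /=; rewrite ?lexx ?leey //.
- by move=> x; exact: fine_ge0.
- apply: filterS (integrable_ae measurableT iS0) => x /(_ I) fx m.
  rewrite EFinM fineK//.
  have -> : D m x = ((kappa ^+ m)%:E * g m x)%E.
    by rewrite /g muleA -EFinM mulfV ?gt_eqF// mul1e.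
  apply: lee_wpmul2l; first by rewrite lee_fin ltW.
  apply: (@le_trans _ _ (\sum_(0 <= i < m.+1) g i x)%E).
    by rewrite big_nat_recr//= leeDr// sume_ge0.
  by apply: nneseries_lim_ge.
Qed.

Section GeometricSeries.
Variables (h : nat -> X -> R[i]) (q : R) (S : X -> R).
Hypotheses (q0 : 0 < q) (q1 : q < 1).
Hypothesis mh : forall m, cmeasurable (h m).
Hypothesis S0 : forall x, 0 <= S x.
Hypothesis hS : {ae mu, forall x, forall m, sqmod (h m x) <= (q ^+ 2) ^+ m * S x}.

Lemma geometric_series_limit : exists F : X -> R[i], cmeasurable F /\
  {ae mu, forall x, forall n,
    sqmod (F x - \sum_(m < n) h m x) <= (q ^+ 2) ^+ n * ((1 - q)^-2 * S x)}.
Proof.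
have [N [mN N0 hN]] := hS.
(* The terms are set to 0 on the exceptional set, so that the series converges at every point and
   its sum is measurable. *)
pose a m x := \1_(~` N) x * complex.Re (h m x).
pose b m x := \1_(~` N) x * complex.Im (h m x).
have mNC : measurable (~` N) by exact: measurableC.
have ma m : measurable_fun setT (a m).
  by apply: measurable_funM => //; exact: (mh m).1.
have mb m : measurable_fun setT (b m).
  by apply: measurable_funM => //; exact: (mh m).2.
have hE x : ~ N x -> forall m, sqmod (h m x) <= (q ^+ 2) ^+ m * S x.
  move=> Nx; apply: contrapT => nh; apply: Nx; exact: hN.
pose B x := Num.sqrt (S x).
have B0 x : 0 <= B x by exact: sqrtr_ge0.
have hB x : ~ N x -> forall m, ComplexField.Normc.normc (h m x) <= q ^+ m * B x.
  move=> Nx m; rewrite -(@ler_pXn2r _ 2) ?nnegrE ?normc_ge0 ?mulr_ge0 ?exprn_ge0 ?(ltW q0)//.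
  rewrite -sqmodE exprMn sqr_sqrtr// -exprM mulnC exprM; exact: hE.
have ab x m : `|a m x| <= B x * q ^+ m /\ `|b m x| <= B x * q ^+ m.
  rewrite /a /b indicE; have [Nx|Nx] := pselect ((~` N) x).
    rewrite mem_set// !mul1r [B x * _]mulrC; split; apply: le_trans (hB x Nx m);
      rewrite normcE -sqrtr_sqr ler_sqrt ?sqmod_ge0 ?Re_le_sqmod ?Im_le_sqmod//.
  by rewrite memNset// !mul0r normr0; split; rewrite mulr_ge0 ?exprn_ge0 ?(ltW q0).
have cvs (u : nat -> X -> R) x : (forall m, `|u m x| <= B x * q ^+ m) ->
    cvgn (series (u ^~ x)).
  move=> ub; apply: normed_cvg; apply: (@series_le_cvg _ _ (geometric (B x) q)).
  - by move=> n /=.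
  - by move=> n /=; rewrite mulr_ge0 ?exprn_ge0 ?(ltW q0).
  - by move=> n /=; exact: ub.
  - by apply: is_cvg_geometric_series; rewrite gtr0_norm.
have ca x : cvgn (series (a ^~ x)) by apply: cvs => m; have [] := ab x m.
have cb x : cvgn (series (b ^~ x)) by apply: cvs => m; have [] := ab x m.
pose F x := (limn (series (a ^~ x)) +i* limn (series (b ^~ x)))%C.
exists F; split.
  split.
    apply: (@measurable_fun_cvg _ _ _ _ (fun n x => series (a ^~ x) n)).
      by move=> n; apply: measurable_sum => m.
    by move=> x _; exact: ca.
  apply: (@measurable_fun_cvg _ _ _ _ (fun n x => series (b ^~ x) n)).
    by move=> n; apply: measurable_sum => m.
  by move=> x _; exact: cb.
exists N; split => // x /= nF; apply: contrapT => Nx; apply: nF => n.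
have aE m : a m x = complex.Re (h m x) by rewrite /a indicE mem_set ?mul1r.
have bE m : b m x = complex.Im (h m x) by rewrite /b indicE mem_set ?mul1r.
pose P m := \sum_(i < m) h i x.
have PE m : P m = (series (a ^~ x) m +i* series (b ^~ x) m)%C.
  apply: complexP; rewrite ?Re_sum ?Im_sum /series /= big_mkord; apply: eq_bigr => i _.
    by rewrite aE.
  by rewrite bE.
have step k : ComplexField.Normc.normc (P (k + n)%N - P n) <= q ^+ n * B x * (1 - q ^+ k) / (1 - q).
  elim: k => [|k IH]; first by rewrite subrr normcE sqmod0 sqrtr0 expr0 subrr mulr0 mul0r.
  rewrite addSn /P big_ord_recr /= -/(P _) addrAC.
  apply: (le_trans (le_normcD _ _)).
  have := hB x Nx (k + n)%N; rewrite exprD.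
  have -> : q ^+ n * B x * (1 - q ^+ k.+1) / (1 - q) =
    q ^+ n * B x * (1 - q ^+ k) / (1 - q) + q ^+ k * q ^+ n * B x.
    by rewrite exprS; field; rewrite subr_eq0 gt_eqF.
  by move=> h1; apply: lerD.
have fin m : (n <= m)%N -> sqmod (P m - P n) <= (q ^+ 2) ^+ n * ((1 - q)^-2 * S x).
  move=> nm; rewrite -(subnK nm) sqmodE.
  have p1 : 0 < 1 - q by rewrite subr_gt0.
  apply: (@le_trans _ _ ((q ^+ n * B x / (1 - q)) ^+ 2)).
    rewrite ler_pXn2r ?nnegrE ?normc_ge0 ?mulr_ge0 ?invr_ge0 ?exprn_ge0 ?(ltW q0) ?(ltW p1)//.
    apply: (le_trans (step _)); rewrite ler_pM2r ?invr_gt0// ler_piMr ?mulr_ge0 ?exprn_ge0 ?(ltW q0)//.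
    by rewrite gerBl exprn_ge0// ltW.
  have eB : B x ^+ 2 = S x by exact: sqr_sqrtr.
  rewrite -eB -exprM mulnC exprM le_eqVlt; apply/orP; left; apply/eqP.
  by field; rewrite subr_eq0 gt_eqF.
have lim : sqmod (P m - P n) @[m --> \oo] --> sqmod (F x - P n).
  under eq_fun do rewrite PE.
  rewrite /sqmod !ReD !ImD; apply: cvgD.
    under eq_fun do rewrite ReD.
    by rewrite !expr2; apply: cvgM; (apply: cvgD; [exact: ca|exact: cvg_cst]).
  under eq_fun do rewrite ImD.
  by rewrite !expr2; apply: cvgM; (apply: cvgD; [exact: cb|exact: cvg_cst]).
exact: cvg_ler lim fin.
Qed.

End GeometricSeries.
End GeometricConvergence.

Lemma ReJ (R : realType) (z : R[i]) : complex.Re (conjc z) = complex.Re z.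
Proof. by case: z. Qed.

(** * Scalar products, Bessel's inequality and the Riesz-Fischer theorem *)

Section HilbertSpace.
Variables (R : realType) (d : nat).
Local Notation mu := (torus R d).
Local Notation X := (d.-tuple R).
Local Notation Z := (d.-tuple int).
Local Notation D := (dist R d).
Local Notation intR f := (mu.-integrable [set: X] (EFin \o f)).
Implicit Types (u v w : dist R d) (a : R[i]) (k l : d.-tuple int).
Local Open Scope complex_scope.

Lemma L2reprP u : inL2 u -> L2fun (L2repr u) /\ fourier (L2repr u) = u.
Proof.
move=> [f f2 fu]; rewrite /L2repr.
by case: xgetP => [g _ //|/(_ f)[]].
Qed.

Lemma inL2_fourier (F : X -> R[i]) : L2fun F -> inL2 (fourier F).
Proof. by move=> iF; exists F. Qed.

Lemma L2repr_ae (F : X -> R[i]) : L2fun F ->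
  {ae mu, forall x, L2repr (fourier F) x = F x}.
Proof.
move=> iF; have [i e] := L2reprP (inL2_fourier iF); exact: fourier_inj.
Qed.

Lemma dotL2E (F G : X -> R[i]) : L2fun F -> L2fun G ->
  dotL2 (fourier F) (fourier G) = ipfun F G.
Proof.
move=> iF iG; have [jF _] := L2reprP (inL2_fourier iF).
have [jG _] := L2reprP (inL2_fourier iG).
move: (iF) (iG) (jF) (jG) => /L2funP[? _] /L2funP[? _] /L2funP[? _] /L2funP[? _].
by apply: ae_eq_ipfun => //; exact: L2repr_ae.
Qed.

Lemma inL2D u v : inL2 u -> inL2 v -> inL2 (fun k => u k + v k).
Proof.
by move=> [F iF <-] [G iG <-]; rewrite -fourierD//; apply: inL2_fourier; exact: L2funD.
Qed.

Lemma inL2Z a u : inL2 u -> inL2 (fun k => a * u k).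
Proof.
by move=> [F iF <-]; rewrite -fourierZ//; apply: inL2_fourier; exact: L2funZ.
Qed.

Lemma inL2_0 : inL2 ((fun=> 0) : D).
Proof.
have i0 : L2fun (fun _ : X => 0 : R[i]).
  by apply: (@L2fun_bounded _ _ _ 0) => [|x]; [exact: cmeasurable_cst|rewrite sqmod0].
have := inL2Z 0 (inL2_fourier i0); congr inL2.
by apply/funext => k; rewrite mul0r.
Qed.

Lemma inL2B u v : inL2 u -> inL2 v -> inL2 (fun k => u k - v k).
Proof.
move=> iu iv; have := inL2D iu (inL2Z (-1) iv); congr inL2.
by apply/funext => k; rewrite mulN1r.
Qed.

Lemma inL2_sum (I : Type) (s : seq I) (P : pred I) (e : I -> dist R d) :
  (forall i, P i -> inL2 (e i)) -> inL2 (fun k => \sum_(i <- s | P i) e i k).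
Proof.
move=> ie; elim: s => [|i s IH].
  by under eq_fun do rewrite big_nil; exact: inL2_0.
under eq_fun do rewrite big_cons.
by have [Pi|//] := boolP (P i); apply: inL2D => //; exact: ie.
Qed.

Lemma dotL2D w u v : inL2 w -> inL2 u -> inL2 v ->
  dotL2 w (fun k => u k + v k) = dotL2 w u + dotL2 w v.
Proof.
move=> [H iH <-] [F iF <-] [G iG <-]; rewrite -fourierD//.
by rewrite !dotL2E ?ipfunD//; exact: L2funD.
Qed.

Lemma dotL2Z a w u : inL2 w -> inL2 u ->
  dotL2 w (fun k => a * u k) = a * dotL2 w u.
Proof.
move=> [H iH <-] [F iF <-]; rewrite -fourierZ//.
by rewrite !dotL2E ?ipfunZ//; exact: L2funZ.
Qed.

Lemma dotL2J u v : inL2 u -> inL2 v -> dotL2 v u = conjc (dotL2 u v).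
Proof.
by move=> [F iF <-] [G iG <-]; rewrite !dotL2E// ipfunJ.
Qed.

Lemma dotL20 u : inL2 u -> dotL2 u (fun=> 0) = 0.
Proof.
move=> iu; transitivity (dotL2 u (fun k => 0 * u k)).
  by congr dotL2; apply/funext => k; rewrite mul0r.
by rewrite dotL2Z// mul0r.
Qed.

Lemma dotL2B w u v : inL2 w -> inL2 u -> inL2 v ->
  dotL2 w (fun k => u k - v k) = dotL2 w u - dotL2 w v.
Proof.
move=> iw iu iv; rewrite -[- dotL2 w v]mulN1r -dotL2Z// -dotL2D//; last exact: inL2Z.
by congr dotL2; apply/funext => k; rewrite mulN1r.
Qed.

Lemma dotL2_sumr (I : Type) (s : seq I) (P : pred I) w (e : I -> dist R d) :
  inL2 w -> (forall i, inL2 (e i)) ->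
  dotL2 w (fun k => \sum_(i <- s | P i) e i k) = \sum_(i <- s | P i) dotL2 w (e i).
Proof.
move=> iw ie; elim: s => [|i s IH].
  by under eq_fun do rewrite big_nil; rewrite dotL20// big_nil.
under eq_fun do rewrite big_cons.
rewrite big_cons; case: (P i) => //.
by rewrite dotL2D ?IH//; apply: inL2_sum.
Qed.

Lemma dotL2Dl w u v : inL2 w -> inL2 u -> inL2 v ->
  dotL2 (fun k => u k + v k) w = dotL2 u w + dotL2 v w.
Proof.
move=> iw iu iv; rewrite dotL2J//; last exact: inL2D.
by rewrite dotL2D// conjc_add -!dotL2J.
Qed.

Lemma dotL2Zl a w u : inL2 w -> inL2 u ->
  dotL2 (fun k => a * u k) w = conjc a * dotL2 u w.
Proof.
move=> iw iu; rewrite dotL2J//; last exact: inL2Z.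
by rewrite dotL2Z// conjc_mul -!dotL2J.
Qed.

Lemma dotL2_suml (I : Type) (s : seq I) (P : pred I) w (e : I -> dist R d) :
  inL2 w -> (forall i, inL2 (e i)) ->
  dotL2 (fun k => \sum_(i <- s | P i) e i k) w = \sum_(i <- s | P i) dotL2 (e i) w.
Proof.
move=> iw ie; rewrite dotL2J//; last exact: inL2_sum.
rewrite dotL2_sumr// conjc_sum; apply: eq_bigr => i _.
by rewrite -dotL2J.
Qed.

Definition nsq u : R := complex.Re (dotL2 u u).

Lemma nsqE (F : X -> R[i]) : L2fun F -> nsq (fourier F) = \int[mu]_x sqmod (F x).
Proof. by move=> iF; rewrite /nsq dotL2E// ipfunxx. Qed.

Lemma dotL2xx u : inL2 u -> dotL2 u u = (nsq u)%:C.
Proof.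
by move=> [F iF <-]; rewrite dotL2E// ipfunxx// nsqE.
Qed.

Lemma nsq_ge0 u : inL2 u -> 0 <= nsq u.
Proof.
by move=> [F iF <-]; rewrite nsqE//; apply: Rintegral_ge0 => x _; exact: sqmod_ge0.
Qed.

Lemma normL2_sqr u : inL2 u -> normL2 u ^+ 2 = nsq u.
Proof. by move=> iu; rewrite /normL2 sqr_sqrtr// nsq_ge0. Qed.

Lemma normL2_ge0 u : 0 <= normL2 u.
Proof. exact: sqrtr_ge0. Qed.

Lemma nsqD u v : inL2 u -> inL2 v ->
  nsq (fun k => u k + v k) = nsq u + nsq v + 2 * complex.Re (dotL2 u v).
Proof.
move=> iu iv; rewrite /nsq dotL2D ?dotL2Dl//; last exact: inL2D.
rewrite (dotL2J iu iv) !ReD ReJ; ring.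
Qed.

Lemma nsqZ a u : inL2 u -> nsq (fun k => a * u k) = sqmod a * nsq u.
Proof.
move=> iu; rewrite /nsq dotL2Z// ?dotL2Zl//; last exact: inL2Z.
by rewrite mulrA mulcJ dotL2xx// -rmorphM.
Qed.

Lemma nsqB u v : inL2 u -> inL2 v ->
  nsq (fun k => u k - v k) = nsq u + nsq v - 2 * complex.Re (dotL2 u v).
Proof.
move=> iu iv; rewrite (_ : (fun k => _) = fun k => u k + (-1) * v k); last first.
  by apply/funext => k; rewrite mulN1r.
rewrite nsqD ?nsqZ//; last exact: inL2Z.
rewrite sqmodN sqmod1 mul1r dotL2Z// mulN1r ReN; ring.
Qed.

Lemma nsqD_le u v : inL2 u -> inL2 v ->
  nsq (fun k => u k + v k) <= 2 * nsq u + 2 * nsq v.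
Proof.
move=> iu iv; have := nsq_ge0 (inL2B iu iv); rewrite nsqB// nsqD//; lra.
Qed.

Lemma nsq0 : nsq ((fun=> 0) : D) = 0.
Proof. by rewrite /nsq dotL20//; exact: inL2_0. Qed.

Lemma nsq_eq0 u : inL2 u -> nsq u = 0 -> u = fun=> 0.
Proof.
move=> [F iF <-]; rewrite nsqE// => F0.
have /L2funP[mF jF] := iF.
have ae0 : {ae mu, forall x, F x = 0}.
  have : ae_eq mu setT (EFin \o (fun x => sqmod (F x))) (fun=> 0%E).
    apply/ae_eq_integral_abs => //.
      by apply/measurable_EFinP; exact: measurable_sqmod.
    rewrite (eq_integral (fun x => (sqmod (F x))%:E)); last first.
      by move=> x _ /=; rewrite ger0_norm ?sqmod_ge0.
    by rewrite -EFin_Rintegral// F0.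
  by apply: filterS => x /(_ I)[] /sqmod_eq0.
rewrite (ae_eq_fourier mF (@cmeasurable_cst R d 0) ae0).
apply/funext => k; rewrite fourierE.
have i0 : L2fun (fun _ : X => 0 : R[i]).
  by apply: (@L2fun_bounded _ _ _ 0) => [|x]; [exact: cmeasurable_cst|rewrite sqmod0].
by have := ipfunZ 0 (L2fun_cexp R k) i0; rewrite !mul0r.
Qed.

Lemma fourier_cexp k : fourier (fun x : X => cexp (dotp k x)) = character R k.
Proof. by apply/funext => l; rewrite fourierE ipfun_cexp /character eq_sym. Qed.

Lemma inL2_character k : inL2 (character R k).
Proof. by rewrite -fourier_cexp; apply: inL2_fourier; exact: L2fun_cexp. Qed.

Lemma dotL2_character k u : inL2 u -> dotL2 (character R k) u = u k.
Proof.
move=> [F iF <-]; rewrite -fourier_cexp dotL2E// -?fourierE//; exact: L2fun_cexp.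
Qed.

Lemma dotL2_characterr k u : inL2 u -> dotL2 u (character R k) = conjc (u k).
Proof. by move=> iu; rewrite (dotL2J (inL2_character k) iu) dotL2_character. Qed.

Section Orthonormal.
Variables (I : eqType) (s : seq I) (e : I -> dist R d).
Hypothesis us : uniq s.
Hypothesis ie : forall i, inL2 (e i).
Hypothesis oe : forall i j, i \in s -> j \in s -> dotL2 (e i) (e j) = (i == j)%:R.

Lemma dotL2_orthonormal_sum (c : I -> R[i]) i : i \in s ->
  dotL2 (e i) (fun k => \sum_(j <- s) c j * e j k) = c i.
Proof.
move=> is_; rewrite dotL2_sumr => // [|j]; last exact: inL2Z.
rewrite (bigD1_seq i)//= big_seq_cond big1 => [|j /andP[js ji]].
  by rewrite dotL2Z// oe// eqxx mulr1 addr0.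
by rewrite dotL2Z// oe// eq_sym (negbTE ji) mulr0.
Qed.

Lemma nsq_orthonormal_sum (c : I -> R[i]) :
  nsq (fun k => \sum_(j <- s) c j * e j k) = \sum_(j <- s) sqmod (c j).
Proof.
rewrite /nsq dotL2_suml => [|//|i]; last 2 first.
- by apply: inL2_sum => j _; exact: inL2Z.
- exact: inL2Z.
rewrite Re_sum big_seq [RHS]big_seq; apply: eq_bigr => i is_.
rewrite dotL2Zl//; last by apply: inL2_sum => j _; exact: inL2Z.
by rewrite dotL2_orthonormal_sum// mulJc.
Qed.

Lemma bessel_pythagoras u : inL2 u ->
  nsq u = nsq (fun k => u k - \sum_(j <- s) dotL2 (e j) u * e j k) +
          \sum_(j <- s) sqmod (dotL2 (e j) u).
Proof.
move=> iu; have iP : inL2 (fun k => \sum_(j <- s) dotL2 (e j) u * e j k).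
  by apply: inL2_sum => j _; exact: inL2Z.
rewrite nsqB// nsq_orthonormal_sum dotL2_sumr => [|//|j]; last exact: inL2Z.
have -> : \sum_(i <- s) dotL2 u (fun k => dotL2 (e i) u * e i k) =
    (\sum_(i <- s) sqmod (dotL2 (e i) u))%:C.
  rewrite rmorph_sum; apply: eq_bigr => j _.
  by rewrite dotL2Z// (dotL2J (ie j) iu) mulcJ.
by rewrite /=; lra.
Qed.

Lemma bessel_le u : inL2 u -> \sum_(j <- s) sqmod (dotL2 (e j) u) <= nsq u.
Proof.
move=> iu; rewrite [leRHS]bessel_pythagoras// lerDr nsq_ge0//.
by apply: inL2B => //; apply: inL2_sum => j _; exact: inL2Z.
Qed.

End Orthonormal.

Lemma dotL2_characters (s : seq Z) k l : k \in s -> l \in s ->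
  dotL2 (character R k) (character R l) = (k == l)%:R.
Proof.
by move=> _ _; rewrite dotL2_character ?/character//; exact: inL2_character.
Qed.

Lemma bessel_characters (s : seq Z) u : uniq s -> inL2 u ->
  \sum_(k <- s) sqmod (u k) <= nsq u.
Proof.
move=> us iu; have := bessel_le us inL2_character (@dotL2_characters s) iu.
by under eq_bigr do rewrite dotL2_character//.
Qed.

Lemma sqmod_le_nsq u k : inL2 u -> sqmod (u k) <= nsq u.
Proof.
by move=> iu; have := @bessel_characters [:: k] u isT iu; rewrite big_seq1.
Qed.

Lemma cauchy_schwarz u v : inL2 u -> inL2 v ->
  sqmod (dotL2 u v) <= nsq u * nsq v.
Proof.
move=> iu iv; have u0 := nsq_ge0 iu.
have [u00|un0] := eqVneq (nsq u) 0.
  rewrite (dotL2J iv iu) (nsq_eq0 iu u00) dotL20//.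
  by rewrite sqmodJ sqmod0 nsq0 mul0r.
have up : 0 < nsq u by rewrite lt_def un0 u0.
pose c := dotL2 u v / (nsq u)%:C.
have := nsq_ge0 (inL2B iv (inL2Z c iu)).
rewrite nsqB ?nsqZ//; last exact: inL2Z.
rewrite dotL2Z// (dotL2J iu iv) /c mulrAC mulcJ sqmodM.
rewrite -rmorphV ?unitfE// -rmorphM /= sqmod_real.
rewrite -(ler_pM2l up) mulr0 => h.
have e : nsq u * (nsq v + sqmod (dotL2 u v) * (nsq u)^-1 ^+ 2 * nsq u -
    2 * (sqmod (dotL2 u v) / nsq u)) = nsq u * nsq v - sqmod (dotL2 u v).
  by field.
by move: h; rewrite e subr_ge0.
Qed.

Lemma le0_geometric (c q B : R) : 0 <= q -> q < 1 ->
  (forall n : nat, c <= q ^+ n * B) -> c <= 0.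
Proof.
move=> q0 q1 h; have : (fun n => c - q ^+ n * B) @ \oo --> c - 0 * B.
  apply: cvgB; first exact: cvg_cst.
  apply: cvgM; last exact: cvg_cst.
  by apply: cvg_expr; rewrite ger0_norm.
rewrite mul0r subr0 => cc; apply: (@cvg_ler _ _ c 0 0 cc) => n _.
by rewrite subr_le0.
Qed.

Lemma big_subset_split (s s' : seq Z) (f : Z -> R) :
  uniq s -> uniq s' -> {subset s <= s'} ->
  \sum_(k <- s') f k = \sum_(k <- s) f k + \sum_(k <- [seq k <- s' | k \notin s]) f k.
Proof.
move=> us us' ss; rewrite -big_cat /=; apply: perm_big; apply: uniq_perm => //.
  rewrite cat_uniq us filter_uniq// andbT; apply/hasPn => k.
  by rewrite mem_filter => /andP[].
move=> k; rewrite mem_cat mem_filter; have [ks|//] := boolP (k \in s).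
by rewrite ss.
Qed.

Lemma big_subset_splitC (s s' : seq Z) (f : Z -> R[i]) :
  uniq s -> uniq s' -> {subset s <= s'} ->
  \sum_(k <- s') f k = \sum_(k <- s) f k + \sum_(k <- [seq k <- s' | k \notin s]) f k.
Proof.
move=> us us' ss; apply: complexP; rewrite ?ReD ?ImD ?Re_sum ?Im_sum.
  exact: big_subset_split.
exact: big_subset_split.
Qed.

Definition trigsum (s : seq Z) u (x : X) : R[i] := \sum_(k <- s) u k * cexp (dotp k x).

Lemma L2fun_trigsum s u : L2fun (trigsum s u).
Proof. by apply: L2fun_sum => k; apply: L2funZ; exact: L2fun_cexp. Qed.

Lemma fourier_trigsum s u :
  fourier (trigsum s u) = fun l => \sum_(k <- s) u k * character R k l.
Proof.
rewrite /trigsum; elim: s => [|k s IH].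
  apply/funext => l; rewrite big_nil fourierE.
  under [X in ipfun _ X]funext do rewrite big_nil.
  have i0 : L2fun (fun _ : X => 0 : R[i]).
    by apply: (@L2fun_bounded _ _ _ 0) => [|x]; [exact: cmeasurable_cst|rewrite sqmod0].
  by have := ipfunZ 0 (L2fun_cexp R l) i0; rewrite !mul0r.
under [X in fourier X]funext do rewrite big_cons.
rewrite fourierD; [|by apply: L2funZ; exact: L2fun_cexp|exact: L2fun_trigsum].
rewrite IH fourierZ; last exact: L2fun_cexp.
by apply/funext => l; rewrite big_cons fourier_cexp.
Qed.

Lemma sum_character s u l : uniq s ->
  \sum_(k <- s) u k * character R k l = if l \in s then u l else 0.
Proof.
move=> us; have [ls|ls] := boolP (l \in s).
  rewrite (bigD1_seq l)//= /character eqxx mulr1 big1 ?addr0// => k kl.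
  by rewrite eq_sym (negbTE kl) mulr0.
rewrite big_seq big1// => k ks; rewrite /character; case: eqP => [e|]; rewrite ?mulr0//.
by move: ls; rewrite e ks.
Qed.

Lemma nsq_trigsum s u : uniq s ->
  \int[mu]_x sqmod (trigsum s u x) = \sum_(k <- s) sqmod (u k).
Proof.
move=> us; rewrite -nsqE; last exact: L2fun_trigsum.
rewrite fourier_trigsum; have := @nsq_orthonormal_sum _ s _ us inL2_character
  (@dotL2_characters s) u.
by [].
Qed.

(** Membership in L^2 asks for an actual function, so this is the way to show that a family of
    coefficients built by hand belongs to L^2. Finite sets that nearly attain the supremum of the
    partial sums cut the Fourier series into blocks with geometrically small norms; these converge
    almost everywhere, and their sum is the function sought. *)
Theorem riesz_fischer u (M : R) :
  (forall s : seq Z, uniq s -> \sum_(k <- s) sqmod (u k) <= M) ->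
  inL2 u /\ nsq u <= M.
Proof.
move=> uM; pose T (s : seq Z) := \sum_(k <- s) sqmod (u k).
pose A := sup [set T s | s in [set s : seq Z | uniq s]].
have hsup : has_sup [set T s | s in [set s : seq Z | uniq s]].
  split; first by exists (T [::]), [::].
  by exists M => _ [s us <-]; exact: uM.
have TA s : uniq s -> T s <= A by move=> us; apply: sup_upper_bound => //; exists s.
have approx (s : seq Z) (e : R) : 0 < e ->
    exists s' : seq Z, uniq s -> [/\ uniq s', {subset s <= s'} & A - e < T s'].
  move=> e0; have [_ [r ur <-] Ar] := sup_adherent e0 hsup.
  exists (undup (s ++ r)) => us; split; first exact: undup_uniq.
    by move=> k ks; rewrite mem_undup mem_cat ks.
  apply: (lt_le_trans Ar); rewrite /T (@big_subset_split r (undup (s ++ r)))//.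
  - by rewrite lerDl sum_sqr_ge0.
  - exact: undup_uniq.
  - by move=> k kr; rewrite mem_undup mem_cat kr orbT.
have e4 n : 0 < (4^-1 : R) ^+ n by rewrite exprn_gt0.
have [next nextP] := choice (fun p : seq Z * nat => approx p.1 _ (e4 p.2)).
(* Each set contains the previous one and misses less than 4^-n of the supremum, so the block
   between [t n] and [t n.+1] carries at most 4^-n. *)
pose t := fix t n := if n is m.+1 then next (t m, m.+1) else next ([::], 0%N).
have ut n : uniq (t n).
  by elim: n => [|n IH] /=; [have [] := nextP ([::], 0%N) isT
                           |have [] := nextP (t n, n.+1) IH].
have sub n : {subset t n <= t n.+1} by have [] := nextP (t n, n.+1) (ut n).
have tA n : A - 4^-1 ^+ n < T (t n).
  case: n => [|n]; first by have [] := nextP ([::], 0%N) isT.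
  by have [] := nextP (t n, n.+1) (ut n).
pose r n := [seq k <- t n.+1 | k \notin t n].
have ur n : uniq (r n) by rewrite filter_uniq.
have Tr n : T (r n) <= 4^-1 ^+ n.
  have := TA _ (ut n.+1); rewrite {1}/T (big_subset_split _ (ut n) (ut n.+1) (@sub n)).
  by have := tA n; rewrite /T /r; lra.
pose D m x := (sqmod (trigsum (r m) u x))%:E.
have sqL s := (L2funP (trigsum s u)).1 (L2fun_trigsum s u).
have half2 m : (4^-1 : R) ^+ m = 1 * 2^-1 ^+ m * 2^-1 ^+ m.
  by rewrite mul1r -exprMn; congr (_ ^+ m); lra.
have [||||||S [iS S0 hS]] := @ae_weighted_bound R d 2^-1 1 D.
- by [].
- by lra.
- by [].
- by move=> m; apply/measurable_EFinP; apply: measurable_sqmod; exact: (sqL _).1.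
- by move=> m x; rewrite lee_fin sqmod_ge0.
- move=> m; rewrite -EFin_Rintegral; last exact: (sqL _).2.
  by rewrite lee_fin nsq_trigsum// -half2; exact: Tr.
pose q : R := Num.sqrt 2^-1.
have q2 : q ^+ 2 = 2^-1 by rewrite sqr_sqrtr.
have q0 : 0 < q by rewrite sqrtr_gt0.
have q1 : q < 1 by rewrite -[ltRHS]sqrtr1 ltr_sqrt//; lra.
have [||F [mF FS]] := @geometric_series_limit R d (fun m => trigsum (r m) u) q S q0 q1 _ S0.
- by move=> m; exact: (sqL _).1.
- by apply: filterS hS => x h m; have := h m; rewrite lee_fin q2.
pose K := (1 - q) ^- 2 * \int[mu]_x S x.
pose g n x := F x - \sum_(m < n) trigsum (r m) u x.
have mg n : cmeasurable (g n).
  have m1 : cmeasurable (fun x => \sum_(m < n) trigsum (r m) u x).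
    by apply: cmeasurable_sum => m; exact: (sqL _).1.
  have := cmeasurableD mF (cmeasurableM (@cmeasurable_cst R d (-1)) m1).
  by under eq_fun do rewrite mulN1r.
have iKS n : intR (fun x => 2^-1 ^+ n * ((1 - q) ^- 2 * S x)) by do 2 apply: intR_Z.
have Kpos : 0 <= (1 - q) ^- 2 by rewrite invr_ge0 sqr_ge0.
have gL n : L2fun (g n).
  apply/L2funP; split => //.
  apply: (intR_ae _ (iKS n)); first exact: measurable_sqmod.
    by move=> x; rewrite mulr_ge0 ?exprn_ge0 ?mulr_ge0.
  apply: filterS FS => x /(_ n); rewrite q2; apply: le_trans.
  by rewrite ger0_norm ?sqmod_ge0.
have gK n : nsq (fourier (g n)) <= 2^-1 ^+ n * K.
  rewrite nsqE// /K -RintegralZl// -RintegralZl//; last exact: intR_Z.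
  rewrite -lee_fin !EFin_Rintegral//; last by have /L2funP[] := gL n.
  apply: ae_ge0_le_integral => //.
  - by move=> x _; rewrite lee_fin sqmod_ge0.
  - by apply/measurable_EFinP; apply: measurable_sqmod; exact: mg.
  - by move=> x _; rewrite lee_fin mulr_ge0 ?exprn_ge0 ?mulr_ge0.
  - by apply/measurable_EFinP; exact: intR_measurable (iKS n).
  - by apply: filterS FS => x /(_ n) + _; rewrite q2 lee_fin.
pose f x := F x + trigsum (t 0%N) u x.
have tsum n x : trigsum (t 0%N) u x + \sum_(m < n) trigsum (r m) u x = trigsum (t n) u x.
  elim: n => [|n IH]; first by rewrite big_ord0 addr0.
  by rewrite big_ord_recr /= addrA IH /trigsum -big_subset_splitC.
have fg n : f = fun x => g n x + trigsum (t n) u x.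
  by apply/funext => x; rewrite /f /g -(tsum n); ring.
have fL : L2fun f by rewrite (fg 0%N); apply: L2funD => //; exact: L2fun_trigsum.
have ff n k : fourier f k = fourier (g n) k + (if k \in t n then u k else 0).
  rewrite (fg n) fourierD//; last exact: L2fun_trigsum.
  by rewrite fourier_trigsum sum_character.
have fu : fourier f = u.
  apply/funext => k; apply/eqP; rewrite -subr_eq0; apply/eqP/sqmod_eq0/eqP.
  rewrite eq_le sqmod_ge0 andbT.
  apply: (@le0_geometric _ 2^-1 (2 * K + 2)) => [||n]; [by []|lra|].
  (* If k is still missing from [t n], adding it cannot exceed the supremum, so [sqmod (u k)] is at
     most 4^-n. *)
  pose b : R[i] := (if k \in t n then u k else 0) - u k.
  have bb : sqmod b <= 2^-1 ^+ n.
    rewrite /b; case: ifPn => kt; first by rewrite subrr sqmod0 exprn_ge0.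
    rewrite sub0r sqmodN.
    have : T (k :: t n) <= A by apply: TA; rewrite /= kt ut.
    have := tA n; rewrite /T big_cons.
    have : (4^-1 : R) ^+ n <= 2^-1 ^+ n by apply: lerXn2r; rewrite ?nnegrE//; lra.
    lra.
  rewrite (ff n) -addrA; apply: (le_trans (sqmodD_le _ _)).
  have := sqmod_le_nsq k (inL2_fourier (gL n)); have := gK n.
  by move: bb; rewrite /b; lra.
have iu : inL2 u by rewrite -fu; exact: inL2_fourier.
split => //; rewrite -subr_le0.
apply: (@le0_geometric _ 2^-1 K) => [||n]; [by []|lra|].
rewrite (bessel_pythagoras (ut n) inL2_character (@dotL2_characters (t n)) iu).
have -> : (fun k => u k - \sum_(j <- t n) dotL2 (character R j) u * character R j k) =
    fourier (g n).
  apply/funext => k; under eq_bigr do rewrite dotL2_character//.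
  rewrite sum_character//; apply/eqP; rewrite subr_eq -(ff n) fu.
  by [].
under eq_bigr do rewrite dotL2_character//.
by have := gK n; have := uM _ (ut n); lra.
Qed.

End HilbertSpace.

(** * Maximal estimates on a frequency band *)

Section FrequencyBoxes.
Variable d : nat.
Local Notation Z := (d.-tuple int).
Implicit Types (k l m : d.-tuple int) (L : nat).

Definition box L : seq Z :=
  [seq [tuple (tnth a i : nat)%:Z - L%:Z | i < d] | a : d.-tuple 'I_(L.*2.+1)].

Lemma box_uniq L : uniq (box L).
Proof.
rewrite map_inj_uniq ?enum_uniq// => a b ab.
apply: eq_from_tnth => i; have := congr1 (fun k => tnth k i) ab.
by rewrite !tnth_mktuple => /addIr[] /ord_inj.
Qed.

Lemma size_box L : size (box L) = (L.*2.+1 ^ d)%N.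
Proof. by rewrite size_map -cardE card_tuple card_ord. Qed.

Lemma mem_box L k : (k \in box L) = [forall i, `|tnth k i| <= L%:Z].
Proof.
apply/mapP/forallP => [[a _ ->] i|h].
  rewrite tnth_mktuple; have := ltn_ord (tnth a i).
  by move: (nat_of_ord _) => x; lia.
have lt i : (absz (tnth k i + L%:Z)%R < L.*2.+1)%N by have := h i; lia.
exists [tuple Ordinal (lt i) | i < d]; first by rewrite mem_enum.
apply: eq_from_tnth => i; rewrite !tnth_mktuple /=; have := h i; lia.
Qed.

Definition sqz k : int := \sum_(i < d) tnth k i ^+ 2.

Lemma sqnorm_sqz (R : realType) k : sqnorm R k = (sqz k)%:~R.
Proof.
rewrite /sqnorm /sqz rmorph_sum; apply: eq_bigr => i _.
by rewrite rmorphXn.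
Qed.

Lemma sqz_ge0 k : 0 <= sqz k.
Proof. by apply: sumr_ge0 => i _; exact: sqr_ge0. Qed.

Lemma sqz_box L k : k \in box L -> sqz k <= (d * L ^ 2)%:Z.
Proof.
rewrite mem_box => /forallP h.
apply: (@le_trans _ _ (\sum_(i < d) (L ^ 2)%:Z)); last first.
  by rewrite sumr_const card_ord -mulr_natr; lia.
by apply: ler_sum => i _; have := h i; nia.
Qed.

Definition subt k l : Z := [tuple tnth k i - tnth l i | i < d].

End FrequencyBoxes.

(** With k = l + m the first condition reads m . (2 l + m) = n, a hyperplane for l because m is
    nonzero. A coordinate of l along which m does not vanish is determined by the others, so
    forgetting it is injective. *)
Lemma count_fibre d' (L : nat) (n : int) (m : d'.+1.-tuple int) :
  (count (fun p : d'.+1.-tuple int * d'.+1.-tuple int =>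
      [&& (sqz p.1 - sqz p.2 == n)%R, subt p.1 p.2 == m & p.1 != p.2])
    [seq (k, l) | k <- box d'.+1 L, l <- box d'.+1 L] <= L.*2.+1 ^ d')%N.
Proof.
set P := fun p : _ * _ => _.
rewrite -size_filter; set F := seq.filter P _.
have [->//|] := eqVneq F [::].
rewrite -size_eq0 -lt0n -has_predT => /hasP[p0 + _].
rewrite mem_filter => /andP[/and3P[_ /eqP m0 p0n] _].
have [i0 mi0] : exists i, tnth m i != 0.
  apply/existsP; rewrite -negb_forall; apply: contra p0n => /forallP h.
  apply/eqP; apply: eq_from_tnth => i; apply/eqP; rewrite -subr_eq0.
  by have := h i; rewrite -m0 tnth_mktuple.
have uF : uniq F.
  by rewrite filter_uniq// allpairs_uniq ?box_uniq// => -[a b] [a' b'].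
pose phi (p : d'.+1.-tuple int * d'.+1.-tuple int) : d'.-tuple int :=
  [tuple tnth p.2 (lift i0 j) | j < d'].
have kE p i : p \in F -> tnth p.1 i = tnth p.2 i + tnth m i.
  rewrite mem_filter => /andP[/and3P[_ /eqP <- _] _].
  by rewrite tnth_mktuple addrC subrK.
have inj : {in F &, injective phi}.
  move=> p q pF qF pq.
  have e j : tnth p.2 (lift i0 j) = tnth q.2 (lift i0 j).
    by have := congr1 (fun k => tnth k j) pq; rewrite !tnth_mktuple.
  have nE r : r \in F -> n = \sum_i tnth m i * (2 * tnth r.2 i + tnth m i).
    move=> rF; move: (rF); rewrite mem_filter => /andP[/and3P[/eqP <- _ _] _].
    rewrite /sqz -sumrB; apply: eq_bigr => i _; rewrite kE//; ring.
  have := nE p pF; rewrite (nE q qF) (bigD1 i0)//= [RHS](bigD1 i0)//=.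
  rewrite (eq_bigr (fun i => tnth m i * (2 * tnth p.2 i + tnth m i))); last first.
    by move=> i; rewrite eq_sym => /unlift_some[j -> _]; rewrite e.
  move=> /addIr /(mulfI mi0) /addIr /mulfI e0.
  have e2 : p.2 = q.2.
    apply: eq_from_tnth => i; have [j ->|->] := unliftP i0 i; first exact: e.
    by rewrite e0.
  rewrite (surjective_pairing p) (surjective_pairing q) -e2; congr (_, _).
  by apply: eq_from_tnth => i; rewrite !kE// e2.
rewrite -(size_map phi) -(size_box d' L); apply: uniq_leq_size.
  by rewrite map_inj_in_uniq.
move=> _ /mapP[p pF ->]; rewrite mem_box; apply/forallP => j.
move: pF; rewrite mem_filter => /andP[_ /allpairsP[[k l] /= [_ lB ->]]].
by rewrite tnth_mktuple; move: lB; rewrite mem_box => /forallP.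
Qed.

(** * Exponential sums in time and space *)

Section SpaceTimeSums.
Variables (R : realType) (d : nat).
Local Notation mu := (torus R d).
Local Notation X := (d.-tuple R).
Local Notation Z := (d.-tuple int).
Local Notation intR f := (mu.-integrable [set: X] (EFin \o f)).

(* Cauchy-Schwarz in the time frequency bounds the sum uniformly in t, and
   Parseval in x evaluates the resulting majorant. *)
Lemma spacetime_sum_bound (I : eqType) (s : seq I) (nu : I -> int) (m : I -> Z)
    (a : I -> R[i]) (T K : nat) :
  {in s, forall i, `|nu i| <= T%:Z} ->
  (forall n l, (count (fun i => (nu i == n) && (m i == l)) s <= K)%N) ->
  exists D : X -> R, [/\ intR D, forall x, 0 <= D x,
    forall t x, sqmod (\sum_(i <- s) a i * cexp (t * (nu i)%:~R + dotp (m i) x)) <= D x &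
    \int[mu]_x D x <= T.*2.+1%:R * K%:R * \sum_(i <- s) sqmod (a i)].
Proof.
move=> nuT cK.
pose r : seq int := [seq n%:Z - T%:Z | n <- iota 0 T.*2.+1].
have ur : uniq r by rewrite map_inj_uniq ?iota_uniq// => x y /addIr[].
have mr i : i \in s -> nu i \in r.
  move=> /nuT h; apply/mapP; exists (absz (nu i + T%:Z)%R); last by lia.
  by rewrite mem_iota; lia.
pose ms := undup [seq m i | i <- s].
pose c n l := \sum_(i <- s | (nu i == n) && (m i == l)) a i.
have mms i : i \in s -> m i \in ms by move=> is_; rewrite mem_undup map_f.
(* A sum is split into the fibres of [ph]; this is applied to the time frequency [nu], then to the
   space frequency [m]. *)
have regroup (V : zmodType) (J : eqType) (q : seq J) (ph : I -> J) (P : pred I) (G : I -> V) :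
    uniq q -> {in s, forall i, ph i \in q} ->
    \sum_(i <- s | P i) G i = \sum_(j <- q) \sum_(i <- s | P i && (ph i == j)) G i.
  move=> uq hq; under [RHS]eq_bigr do rewrite big_mkcondr /=.
  rewrite exchange_big /= big_seq_cond [RHS]big_seq_cond; apply: eq_bigr => i /andP[is_ _].
  rewrite (bigD1_seq (ph i))//=; last exact: hq.
  rewrite eqxx big1 ?addr0// => j; rewrite eq_sym => /negbTE; by move=> ->.
have bE t x : \sum_(i <- s) a i * cexp (t * (nu i)%:~R + dotp (m i) x) =
    \sum_(n <- r) cexp (t * n%:~R) * trigsum ms (c n) x.
  rewrite (regroup _ _ r nu)//; apply: eq_bigr => n _.
  rewrite /trigsum mulr_sumr (regroup _ _ ms m)//; last exact: undup_uniq.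
  apply: eq_bigr => l _; rewrite /c mulr_suml mulr_sumr.
  by apply: eq_bigr => i /andP[/eqP <- /eqP <-]; rewrite cexpD mulrCA.
exists (fun x => T.*2.+1%:R * \sum_(n <- r) sqmod (trigsum ms (c n) x)).
have iT u : intR (fun x => sqmod (trigsum ms u x)).
  by have /L2funP[] := L2fun_trigsum ms u.
split.
- by apply: intR_Z; apply: intR_sum.
- by move=> x; rewrite mulr_ge0// sum_sqr_ge0.
- move=> t x; rewrite bE; apply: (le_trans (sqmod_sum_mul _ _ _ _)).
  under eq_bigr do rewrite sqmod_cexp.
  by rewrite big_const_seq count_predT iter_addr_0 size_map size_iota.
- rewrite RintegralZl//; last exact: intR_sum.
  rewrite -mulrA ler_pM2l ?ltr0n// Rintegral_sum//.
  under eq_bigr do rewrite nsq_trigsum ?undup_uniq//.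
  rewrite [in leRHS](regroup _ _ r nu)// mulr_sumr; apply: ler_sum => n _.
  rewrite [in leRHS](regroup _ _ ms m)//; last exact: undup_uniq.
  rewrite mulr_sumr; apply: ler_sum => l _.
  (* At most K indices share a time frequency and a space frequency, so collecting their
     coefficients costs a factor K. *)
  apply: (le_trans (sqmod_sum_le _ _ _)); apply: ler_wpM2r; first exact: sum_sqr_ge0.
  by rewrite big_const_seq iter_addr_0 ler_nat; exact: cK.
Qed.

End SpaceTimeSums.

Section DensityBounds.
Variables (R : realType).
Local Open Scope complex_scope.

Section Orthonormality.
Variables (d : nat) (f : nat -> dist R d).
Hypothesis onf : orthonormal_seq f.
Local Notation Z := (d.-tuple int).

Lemma nsq_orthonormal_nat (n : nat) (c : nat -> R[i]) :
  nsq (fun k => \sum_(0 <= j < n) c j * f j k) = \sum_(0 <= j < n) sqmod (c j).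
Proof.
apply: nsq_orthonormal_sum; first exact: iota_uniq.
  exact: onf.1.
by move=> i j _ _; exact: onf.2.
Qed.

Lemma orthonormal_column (B : seq Z) (j : nat) : uniq B ->
  \sum_(k <- B) sqmod (f j k) <= 1.
Proof.
move=> uB; apply: (le_trans (bessel_characters uB (onf.1 j))).
by rewrite /nsq onf.2 eqxx.
Qed.

Lemma orthonormal_contraction (B : seq Z) (n : nat) (c : nat -> R[i]) : uniq B ->
  \sum_(k <- B) sqmod (\sum_(0 <= j < n) c j * f j k) <= \sum_(0 <= j < n) sqmod (c j).
Proof.
move=> uB; rewrite -nsq_orthonormal_nat; apply: bessel_characters => //.
by apply: inL2_sum => j _; apply: inL2Z; exact: onf.1.
Qed.

(** For fixed k the sum over l is [orthonormal_contraction] with coefficients w_j conj(f_j(k)), up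
    to conjugation; the sum over k is then at most 1 for each j by Bessel's inequality. *)
Lemma orthonormal_hilbert_schmidt (B : seq Z) (n : nat) (w : nat -> R) : uniq B ->
  \sum_(k <- B) \sum_(l <- B)
    sqmod (\sum_(0 <= j < n) (w j)%:C * f j k * conjc (f j l)) <=
  \sum_(0 <= j < n) w j ^+ 2.
Proof.
move=> uB.
apply: (@le_trans _ _ (\sum_(k <- B) \sum_(0 <= j < n) w j ^+ 2 * sqmod (f j k))).
  apply: ler_sum => k _.
  have := orthonormal_contraction n (fun j => (w j)%:C * conjc (f j k)) uB.
  under [X in _ <= X]eq_bigr do rewrite sqmodZ sqmodJ.
  congr (_ <= _); apply: eq_bigr => l _; rewrite -sqmodJ conjc_sum; congr sqmod.
  by apply: eq_bigr => j _; rewrite !conjc_mul conjcK conjc_real.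
rewrite exchange_big /=; apply: ler_sum => j _; rewrite -mulr_sumr.
by rewrite ler_piMr ?sqr_ge0// orthonormal_column.
Qed.

End Orthonormality.

Definition wavepacket (d L : nat) (mult : d.-tuple int -> R) (u : dist R d)
    (t : R) (x : d.-tuple R) : R[i] :=
  \sum_(k <- box d L) (mult k)%:C * u k * cexp (t * sqnorm R k + dotp k x).

Lemma big_pairs_diag (V : nmodType) (I : eqType) (s : seq I) (F : I * I -> V) : uniq s ->
  \sum_(p <- [seq (k, l) | k <- s, l <- s] | p.1 == p.2) F p = \sum_(k <- s) F (k, k).
Proof.
move=> us; rewrite big_mkcond big_allpairs_dep /= big_seq [RHS]big_seq.
apply: eq_bigr => k ks; rewrite (bigD1_seq k)//= eqxx big1 ?addr0// => l lk.
by rewrite eq_sym (negbTE lk).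
Qed.

Lemma sum_sqmod_expand (I : Type) (B : seq I) (n : nat) (w : nat -> R) (A : nat -> I -> R[i]) :
  (\sum_(0 <= j < n) w j * sqmod (\sum_(k <- B) A j k))%:C =
  \sum_(0 <= j < n) \sum_(k <- B) \sum_(l <- B) (w j)%:C * A j k * conjc (A j l).
Proof.
rewrite rmorph_sum; apply: eq_bigr => j _; rewrite rmorphM /= -mulcJ conjc_sum.
rewrite mulr_suml mulr_sumr; apply: eq_bigr => k _.
by rewrite mulrA mulr_sumr.
Qed.

(** Write d for the dimension. Pairs with k = l do not oscillate, and there are too many of them for
    [count_fibre]; by Cauchy-Schwarz they contribute a constant of order L^d. For the other pairs
    the time frequency is at most d L^2 and a fibre has at most (2 L + 1)^(d - 1) elements, which
    gives L^(d + 1). *)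
Lemma density_bound_multid (d' L n : nat) (w : nat -> R) (f : nat -> dist R d'.+1)
    (mult : d'.+1.-tuple int -> R) (sg : R) :
  orthonormal_seq f -> {in box d'.+1 L, forall k, mult k ^+ 2 <= sg} ->
  exists D : d'.+1.-tuple R -> R,
  [/\ (torus R d'.+1).-integrable setT (EFin \o D), forall x, 0 <= D x,
    forall t x, (\sum_(0 <= j < n) w j * sqmod (wavepacket L mult (f j) t x)) ^+ 2 <= D x &
    \int[torus R d'.+1]_x D x <=
      4 * d'.+1%:R * L.*2.+1%:R ^+ d'.+2 * (sg ^+ 2 * \sum_(0 <= j < n) w j ^+ 2)].
Proof.
move=> onf msg; set B := box d'.+1 L; have uB : uniq B by exact: box_uniq.
pose S := [seq (k, l) | k <- B, l <- B].
pose a (p : d'.+1.-tuple int * d'.+1.-tuple int) : R[i] := (mult p.1 * mult p.2)%:C *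
  \sum_(0 <= j < n) (w j)%:C * f j p.1 * conjc (f j p.2).
pose E := \sum_(p <- S) sqmod (a p).
have EW : E <= sg ^+ 2 * \sum_(0 <= j < n) w j ^+ 2.
  apply: (@le_trans _ _ (sg ^+ 2 * \sum_(k <- B) \sum_(l <- B)
    sqmod (\sum_(0 <= j < n) (w j)%:C * f j k * conjc (f j l)))); last first.
    by apply: ler_wpM2l; rewrite ?sqr_ge0// orthonormal_hilbert_schmidt.
  rewrite /E /S big_allpairs_dep /= mulr_sumr big_seq [leRHS]big_seq.
  apply: ler_sum => k kB; rewrite mulr_sumr big_seq [leRHS]big_seq.
  apply: ler_sum => l lB; rewrite /a sqmodZ /=; apply: ler_wpM2r; first exact: sqmod_ge0.
  by rewrite exprMn expr2; apply: ler_pM; rewrite ?sqr_ge0//; exact: msg.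
have E0 : 0 <= E by exact: sum_sqr_ge0.
have diag : sqmod (\sum_(p <- S | p.1 == p.2) a p) <= L.*2.+1%:R ^+ d'.+1 * E.
  apply: (le_trans (sqmod_sum_le _ _ _)).
  rewrite big_pairs_diag// big_const_seq count_predT size_box iter_addr_0 natrX.
  apply: ler_wpM2l; first by rewrite exprn_ge0.
  rewrite /E [leRHS](bigID (fun p => p.1 == p.2)) /= lerDl; exact: sum_sqr_ge0.
have [|n0 l0|D [iD D0 hD ID]] := @spacetime_sum_bound R d'.+1 _
  [seq p <- S | p.1 != p.2] (fun p => sqz p.1 - sqz p.2) (fun p => subt p.1 p.2) a
  (d'.+1 * L ^ 2) (L.*2.+1 ^ d').
- move=> p; rewrite mem_filter => /andP[_ /allpairsP[[k l] /= [kB lB ->]]] /=.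
  have := sqz_box kB; have := sqz_box lB; have := sqz_ge0 k; have := sqz_ge0 l.
  by rewrite ler_norml; lia.
- rewrite count_filter; apply: leq_trans (count_fibre L n0 l0); apply: sub_count => p /=.
  by rewrite -andbA.
exists (fun x => 2 * (L.*2.+1%:R ^+ d'.+1 * E) + 2 * D x); split.
- by apply: intR_D; [exact: intR_cst|exact: intR_Z].
- by move=> x; rewrite addr_ge0// !mulr_ge0// exprn_ge0.
- move=> t x; rewrite -sqmod_real.
  have -> : (\sum_(0 <= j < n) w j * sqmod (wavepacket L mult (f j) t x))%:C =
      \sum_(p <- S) a p * cexp (t * (sqz p.1 - sqz p.2)%:~R + dotp (subt p.1 p.2) x).
    rewrite /S big_allpairs_dep /= /wavepacket sum_sqmod_expand.
    rewrite exchange_big /=; apply: eq_bigr => k _.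
    rewrite exchange_big /=; apply: eq_bigr => l _.
    rewrite /a /= [(mult k * mult l)%:C * _]mulr_sumr mulr_suml; apply: eq_bigr => j _.
    rewrite !conjc_mul conjc_real -cexpN /subt dotpB rmorphB /= -!sqnorm_sqz.
    have -> : t * (sqnorm R k - sqnorm R l) + (dotp k x - dotp l x) =
      t * sqnorm R k + dotp k x - (t * sqnorm R l + dotp l x) by ring.
    by rewrite [X in _ = _ * X]cexpD rmorphM /=; ring.
  rewrite (bigID (fun p => p.1 == p.2)) /=.
  apply: (le_trans (sqmodD_le _ _)); apply: lerD; apply: ler_wpM2l => //; last first.
    by rewrite -big_filter; exact: hD.
  rewrite (eq_bigr a)// => -[k l] /= /eqP <-.
  by rewrite subrr mulr0 add0r /subt dotpB subrr cexp0 mulr1.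
- rewrite RintegralD//; [|exact: intR_cst|exact: intR_Z].
  rewrite Rintegral_cst// [X in fine X](@probability_setT _ _ _ (torus R d'.+1)) mulr1 RintegralZl//.
  have hE : \sum_(p <- [seq p <- S | p.1 != p.2]) sqmod (a p) <= E.
    rewrite big_filter /E [leRHS](bigID (fun p => p.1 == p.2)) /= lerDr; exact: sum_sqr_ge0.
  have h2 : \int[torus R d'.+1]_x D x <= d'.+1%:R * L.*2.+1%:R ^+ d'.+2 * E.
    apply: (le_trans ID); rewrite natrX.
    have hL : (d'.+1 * L ^ 2).*2.+1%:R <= d'.+1%:R * L.*2.+1%:R ^+ 2 :> R.
      by rewrite -natrX -natrM ler_nat; nia.
    have e2 : L.*2.+1%:R ^+ d'.+2 = L.*2.+1%:R ^+ 2 * L.*2.+1%:R ^+ d' :> R by rewrite -exprD.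
    rewrite e2 -mulrA [leRHS](_ : _ = (d'.+1%:R * L.*2.+1%:R ^+ 2) * (L.*2.+1%:R ^+ d' * E)); last first.
      by ring.
    apply: ler_pM => //.
      by rewrite mulr_ge0 ?exprn_ge0 ?sum_sqr_ge0.
    by apply: ler_wpM2l; rewrite ?exprn_ge0.
  have h1 : L.*2.+1%:R ^+ d'.+1 * E <= d'.+1%:R * L.*2.+1%:R ^+ d'.+2 * E.
    apply: ler_wpM2r => //; rewrite [X in _ <= _ * X]exprSr mulrCA ler_peMr ?exprn_ge0//.
    by rewrite -natrM ler1n muln_gt0.
  have h3 : d'.+1%:R * L.*2.+1%:R ^+ d'.+2 * E <=
      d'.+1%:R * L.*2.+1%:R ^+ d'.+2 * (sg ^+ 2 * \sum_(0 <= j < n) w j ^+ 2).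
    by apply: ler_wpM2l => //; rewrite mulr_ge0 ?exprn_ge0.
  rewrite (_ : 4 * d'.+1%:R * _ * _ = 4 * (d'.+1%:R * L.*2.+1%:R ^+ d'.+2 *
    (sg ^+ 2 * \sum_(0 <= j < n) w j ^+ 2))); last by ring.
  lra.
Qed.

End DensityBounds.

(** * The divisor bound *)

Section DivisorBound.
Local Open Scope nat_scope.

Lemma size_divisors_partn (p n : nat) : prime p -> 0 < n ->
  size (divisors n) <= (logn p n).+1 * size (divisors n`_(p^')).
Proof.
move=> pp n0.
rewrite -(size_iota 0 (logn p n).+1) -(size_allpairs (fun i y => p ^ i * y)).
apply: uniq_leq_size; first exact: divisors_uniq.
move=> x; rewrite -dvdn_divisors// => xn.
have x0 : 0 < x by exact: dvdn_gt0 xn.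
apply/allpairsP; exists (logn p x, x`_(p^')); split.
- by rewrite mem_iota /= ltnS dvdn_leq_log.
- by rewrite -dvdn_divisors ?part_gt0// partn_dvd.
- by rewrite -p_part partnC.
Qed.

(** Controls the contribution of a small prime with exponent e. With m the integer part of e / q, e
    + 1 is at most q (m + 1), hence at most q 2^m; then take q-th powers. *)
Lemma succn_expn_le (q e : nat) : 0 < q -> e.+1 ^ q <= q ^ q * 2 ^ e.
Proof.
move=> q0; apply: (@leq_trans ((q * 2 ^ (e %/ q)) ^ q)).
  rewrite leq_exp2r//; apply: (@leq_trans (q * (e %/ q).+1)).
    by rewrite mulnC; exact: ltn_ceil.
  by rewrite leq_mul2l ltn_expl// orbT.
rewrite expnMn -expnM leq_mul2l leq_exp2l// leq_divM orbT.
by [].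
Qed.

(* A prime power p^e with p >= 2^q contributes at most (e + 1)^q <= p^e. *)
Lemma size_divisors_bound (q : nat) : 0 < q ->
  exists C : nat, forall n, 0 < n -> size (divisors n) ^ q <= C * n.
Proof.
move=> q0; pose small := fun p => p < 2 ^ q.
(* Only primes below 2^q cost a factor q^q, and n has at most 2^q of them, so the constant does not
   depend on n. The induction removes the whole power of the smallest prime factor. *)
suff h n : 0 < n -> size (divisors n) ^ q <= (q ^ q) ^ count small (primes n) * n.
  exists ((q ^ q) ^ (2 ^ q)) => n n0; apply: (leq_trans (h n n0)).
  rewrite leq_mul2r; apply/orP; right; apply: leq_pexp2l.
    by rewrite expn_gt0 q0.
  rewrite -size_filter -(size_iota 0 (2 ^ q)); apply: uniq_leq_size.
    by rewrite filter_uniq// primes_uniq.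
  by move=> p; rewrite mem_filter mem_iota => /andP[].
elim: n {-2}n (leqnn n) => [|N IH] n nN n0; first by lia.
have [n1|n1] := leqP n 1.
  have -> : n = 1 by lia.
  by rewrite exp1n.
pose p := pdiv n; have pp : prime p by exact: pdiv_prime.
pose m := n`_(p^'); have m0 : 0 < m by exact: part_gt0.
have nE : p ^ logn p n * m = n by rewrite -p_part partnC.
have e0 : 0 < logn p n by rewrite logn_gt0 mem_primes pp n0 pdiv_dvd.
have mn : m < n.
  by rewrite -[X in _ < X]nE ltn_Pmull// -(exp1n (logn p n)) ltn_exp2r// prime_gt1.
have cE : count small (primes n) = small p + count small (primes m).
  have pn : p \in primes n by rewrite mem_primes pp n0 pdiv_dvd.
  rewrite (permP (perm_to_rem pn)) /= rem_filter ?primes_uniq// primes_part.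
  by congr (_ + count _ _); apply: eq_filter => y; rewrite !inE.
apply: (@leq_trans (((logn p n).+1 * size (divisors m)) ^ q)).
  by rewrite leq_exp2r// size_divisors_partn.
rewrite expnMn -[X in _ <= _ * X]nE mulnCA mulnA cE.
have IHm : size (divisors m) ^ q <= (q ^ q) ^ count small (primes m) * m.
  by apply: IH => //; lia.
rewrite expnD.
have key : (logn p n).+1 ^ q <= (q ^ q) ^ small p * p ^ logn p n.
  rewrite /small; have [sp|sp] := ltnP p (2 ^ q).
    apply: leq_trans (succn_expn_le _ q0) _.
    by rewrite expn1 leq_mul2l leq_exp2r// prime_gt1// orbT.
  rewrite expn0 mul1n; apply: (@leq_trans ((2 ^ q) ^ logn p n)).
    by rewrite -expnM mulnC expnM leq_exp2r// ltn_expl.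
  by rewrite leq_exp2r.
apply: leq_trans (leq_mul key IHm) _.
by rewrite mulnACA mulnCA mulnA [p ^ _ * _]mulnC.
Qed.

End DivisorBound.

Definition addt (d : nat) (k l : d.-tuple int) : d.-tuple int :=
  [tuple tnth k i + tnth l i | i < d].

(** * Sixth powers in dimension one *)

Section DimensionOne.
Local Notation Z := (1.-tuple int).

(** The factor 2 accounts for signs, and 4 L^2 bounds a product of two differences of frequencies
    from the box. *)
Definition divisor_max (L : nat) : nat :=
  (2 * \max_(P < (4 * L ^ 2).+1) size (divisors P))%N.

(* For a triple (k1, k2, k3), the constraints fix (k3 - k1) (k3 - k2), which is
   nonzero, so k3 - k1 is a divisor of a fixed integer, up to sign. *)
Lemma count_triples (L : nat) (n : int) (m : Z) :
  (count (fun p : Z * Z * Z => [&& p.1.1 != p.2, p.1.2 != p.2,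
      (sqz p.1.1 + sqz p.1.2 - sqz p.2 == n)%R &
      subt (addt p.1.1 p.1.2) p.2 == m])
    [seq (p, k) | p <- [seq (k, l) | k <- box 1 L, l <- box 1 L], k <- box 1 L]
   <= divisor_max L)%N.
Proof.
set P := fun p : _ * _ => _.
rewrite -size_filter; set F := seq.filter P _.
have tnth1 (k l : Z) : tnth k ord0 = tnth l ord0 -> k = l.
  by move=> kl; apply: eq_from_tnth => i; rewrite ord1.
have sq1 (k : Z) : sqz k = tnth k ord0 ^+ 2 by rewrite /sqz big_ord1.
pose c (p : Z * Z * Z) : int := tnth p.2 ord0 - tnth p.1.1 ord0.
pose e (p : Z * Z * Z) : int := tnth p.2 ord0 - tnth p.1.2 ord0.
(* For m = k1 + k2 - k3 and n = k1^2 + k2^2 - k3^2 one has m^2 - n = 2 (k3 - k1)(k3 - k2) and k3 = m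
   + (k3 - k1) + (k3 - k2). Hence c determines e, and both together determine the triple. *)
have spec p : p \in F -> [/\ c p != 0, e p != 0,
    2 * (c p * e p) = tnth m ord0 ^+ 2 - n,
    tnth p.2 ord0 = tnth m ord0 + c p + e p & (absz (c p * e p)%R <= 4 * L ^ 2)%N].
  rewrite mem_filter => /andP[/and4P[h1 h2 /eqP <- /eqP <-]].
  move=> /allpairsP[[q k3] /= [/allpairsP[[k1 k2] /= [b1 b2 ->]] b3 pE]].
  move: h1 h2; rewrite pE /c /e /= !sq1 !tnth_mktuple => h1 h2; split.
  - by apply: contra h1; rewrite subr_eq0 => /eqP h; apply/eqP/tnth1.
  - by apply: contra h2; rewrite subr_eq0 => /eqP h; apply/eqP/tnth1.
  - ring.
  - ring.
  - move: b1 b2 b3; rewrite !mem_box => /forallP/(_ ord0) + /forallP/(_ ord0) + /forallP/(_ ord0).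
    move: (tnth k1 _) (tnth k2 _) (tnth k3 _) => x y z hx hy hz.
    rewrite abszM; have : (absz (z - x)%R <= 2 * L)%N by lia.
    have : (absz (z - y)%R <= 2 * L)%N by lia.
    by move: (absz _) (absz _) => a b; nia.
have uF : uniq F.
  rewrite filter_uniq// allpairs_uniq ?box_uniq//; last by move=> -[a b] [a' b'].
  by rewrite allpairs_uniq ?box_uniq// => -[a b] [a' b'].
have [->//|] := eqVneq F [::].
rewrite -size_eq0 -lt0n -has_predT => /hasP[p0 p0F _].
have [c0 e0 ce0 _ b0] := spec p0 p0F.
pose Q := absz (c p0 * e p0)%R.
have Q0 : (0 < Q)%N by rewrite absz_gt0 mulf_neq0.
have ceE p : p \in F -> c p * e p = c p0 * e p0.
  move=> /spec[_ _ ce _ _]; apply: (@mulfI _ 2) => //.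
  by rewrite ce ce0.
have inj : {in F &, injective c}.
  move=> p q pF qF cpq; have [cp ep _ p2 _] := spec p pF; have [cq eq _ q2 _] := spec q qF.
  have epq : e p = e q.
    by apply: (mulfI cp); rewrite ceE// cpq ceE.
  have e2 : p.2 = q.2 by apply: tnth1; rewrite p2 q2 cpq epq.
  rewrite (surjective_pairing p) (surjective_pairing q) e2; congr (_, _).
  rewrite (surjective_pairing p.1) (surjective_pairing q.1); congr (_, _); apply: tnth1.
    by move: cpq; rewrite /c e2 => /addrI/oppr_inj.
  by move: epq; rewrite /e e2 => /addrI/oppr_inj.
rewrite -(size_map c); apply: (@leq_trans (size
  ([seq x%:Z | x <- divisors Q] ++ [seq - x%:Z | x <- divisors Q]))).
  apply: uniq_leq_size; first by rewrite map_inj_in_uniq.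
  move=> _ /mapP[p pF ->].
  have cQ : absz (c p) \in divisors Q by rewrite -dvdn_divisors// /Q -(ceE p)// abszM dvdn_mulr.
  rewrite mem_cat; apply/orP; have [cp|cp] := leP 0 (c p).
    by left; apply/mapP; exists (absz (c p)) => //; lia.
  by right; apply/mapP; exists (absz (c p)) => //; lia.
rewrite size_cat !size_map addnn -mul2n leq_mul2l /=.
by apply: (@leq_bigmax _ (fun i : 'I_(4 * L ^ 2).+1 => size (divisors i)) (Ordinal (_ : Q < _)%N)).
Qed.

Variable R : realType.
Local Notation X := (1.-tuple R).
Local Notation intR f := ((torus R 1).-integrable [set: X] (EFin \o f)).

Lemma big_or_eq (V : zmodType) (I : eqType) (B : seq I) (G : I -> V) (a b : I) :
  uniq B -> a \in B -> b \in B ->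
  \sum_(k <- B | (a == k) || (b == k)) G k = G a + G b - (if a == b then G a else 0).
Proof.
move=> uB aB bB; have [ab|ab] := eqVneq a b.
  rewrite -ab addrK big_mkcond (bigD1_seq a)//= eqxx big1 ?addr0// => k ka.
  by rewrite orbb eq_sym (negbTE ka).
rewrite subr0 big_mkcond (bigD1_seq a)//= eqxx /=; congr (_ + _).
rewrite big_mkcond (bigD1_seq b)//= [b == a]eq_sym ab /= eqxx orbT big1 ?addr0// => k kb.
case: ifP => // ka; rewrite [b == k]eq_sym (negbTE kb) orbF [a == k]eq_sym.
by rewrite (negbTE ka).
Qed.

(** In the triples with k3 = k1 or k3 = k2 two phases cancel and a single frequency is left. Each of
    the two cases gives the total mass times the sum of v; the overlap k1 = k2 = k3 is counted twice
    and subtracted once. *)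
Lemma cubic_expand (I : eqType) (B : seq I) (v : I -> R[i]) : uniq B ->
  (\sum_(k <- B) v k) * (\sum_(k <- B) v k) * conjc (\sum_(k <- B) v k) =
  \sum_(p <- [seq (p, k) | p <- [seq (k, l) | k <- B, l <- B], k <- B]
      | (p.1.1 != p.2) && (p.1.2 != p.2)) v p.1.1 * v p.1.2 * conjc (v p.2) +
  \sum_(k <- B) (2 * \sum_(l <- B) sqmod (v l) - sqmod (v k))%:C%C * v k.
Proof.
move=> uB; set S := [seq _ | _ <- _, _ <- _].
transitivity (\sum_(p <- S) v p.1.1 * v p.1.2 * conjc (v p.2)).
  rewrite /S !big_allpairs_dep /= conjc_sum mulr_suml mulr_suml.
  apply: eq_bigr => k _; rewrite [v k * _]mulr_sumr mulr_suml; apply: eq_bigr => l _.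
  by rewrite mulr_sumr.
rewrite (bigID (fun p : I * I * I => (p.1.1 != p.2) && (p.1.2 != p.2))) /=; congr (_ + _).
rewrite big_mkcond /S !big_allpairs_dep /=.
transitivity (\sum_(k <- B) \sum_(l <- B) (v k * v l * conjc (v k) + v k * v l * conjc (v l)
   - (if k == l then v k * v l * conjc (v k) else 0))).
  rewrite big_seq [RHS]big_seq; apply: eq_bigr => k kB.
  rewrite big_seq [RHS]big_seq; apply: eq_bigr => l lB.
  rewrite -(@big_or_eq _ _ B (fun q => v k * v l * conjc (v q)))//.
  by rewrite [RHS]big_mkcond; apply: eq_bigr => q _; rewrite negb_and !negbK.
rewrite [LHS](eq_bigr _ (fun k _ => sumrB _ _ _ _)) sumrB.
under [X in X - _]eq_bigr do rewrite big_split.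
rewrite big_split /=.

set U := \sum_(l <- B) sqmod _.
have e1 : \sum_(k <- B) \sum_(l <- B) v k * v l * conjc (v k) = U%:C%C * \sum_(k <- B) v k.
  rewrite rmorph_sum mulr_suml; apply: eq_bigr => k _; rewrite /= mulr_sumr.
  by apply: eq_bigr => l _; rewrite -mulcJ mulrAC.
have e2 : \sum_(k <- B) \sum_(l <- B) v k * v l * conjc (v l) = U%:C%C * \sum_(k <- B) v k.
  rewrite exchange_big /= rmorph_sum mulr_suml; apply: eq_bigr => k _; rewrite /= mulr_sumr.
  by apply: eq_bigr => l _; rewrite -mulcJ -mulrA mulrC.
rewrite e1 e2 [in RHS](eq_bigr (fun k => 2 * U%:C%C * v k - (sqmod (v k))%:C%C * v k)); last first.
  by move=> k _; rewrite rmorphB rmorphM rmorph_nat mulrBl.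
rewrite sumrB -mulr_sumr -[in RHS]mulrA mulr_natl mulr2n; congr (_ - _).
rewrite big_seq [RHS]big_seq; apply: eq_bigr => k kB.
rewrite (bigD1_seq k)//= eqxx big1 ?addr0; first by rewrite -mulcJ mulrAC.
by move=> l lk; rewrite eq_sym (negbTE lk).
Qed.

(** Since |g|^6 is the squared modulus of g^2 conj(g), [spacetime_sum_bound] applies to both parts
    of [cubic_expand]. The first has multiplicity [divisor_max L] by [count_triples]. The second is
    again a free wave, with multiplicity 1 and coefficients at most 2 U |u_k|, where U is the total
    mass; hence the 4 U^3. *)
Lemma cubic_maximal_bound (L : nat) (u : Z -> R[i]) :
  exists D : X -> R, [/\ intR D, forall x, 0 <= D x,
    forall t x, sqmod (\sum_(k <- box 1 L) u k * cexp (t * sqnorm R k + dotp k x)) ^+ 3 <= D x &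
    \int[torus R 1]_x D x <=
      (2 * (4 * L ^ 2).+1 * divisor_max L + 8 * (2 * L ^ 2).+1)%N%:R *
      (\sum_(k <- box 1 L) sqmod (u k)) ^+ 3].
Proof.
set B := box 1 L; have uB : uniq B by exact: box_uniq.
set U := \sum_(k <- B) sqmod (u k); have U0 : 0 <= U by exact: sum_sqr_ge0.
set S := [seq (p, k) | p <- [seq (k, l) | k <- B, l <- B], k <- B].
pose NT (p : Z * Z * Z) := (p.1.1 != p.2) && (p.1.2 != p.2).
have [||D1 [i1 p1 h1 I1]] := @spacetime_sum_bound R 1 _ (seq.filter NT S)
  (fun p => sqz p.1.1 + sqz p.1.2 - sqz p.2)
  (fun p => subt (addt p.1.1 p.1.2) p.2)
  (fun p => u p.1.1 * u p.1.2 * conjc (u p.2)) (2 * L ^ 2) (divisor_max L).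
- move=> p; rewrite mem_filter => /andP[_ /allpairsP[[q k3] /= [/allpairsP[[k1 k2] /= [b1 b2 ->]] b3 ->]]] /=.
  have := sqz_box b1; have := sqz_box b2; have := sqz_box b3.
  have := sqz_ge0 k1; have := sqz_ge0 k2; have := sqz_ge0 k3.
  by rewrite mul1n ler_norml; lia.
- move=> n m; rewrite count_filter; apply: leq_trans (count_triples L n m).
  by apply: sub_count => p /= /andP[/andP[-> ->] /andP[-> ->]].
have [||D2 [i2 p2 h2 I2]] := @spacetime_sum_bound R 1 _ B (fun k => sqz k) id
  (fun k => (2 * U - sqmod (u k))%:C%C * u k) (L ^ 2) 1.
- move=> k /[dup] kB /sqz_box; have := sqz_ge0 k.
  by rewrite mul1n ler_norml; lia.
- move=> n m; apply: (@leq_trans (count_mem m B)); last by rewrite count_uniq_mem// leq_b1.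
  by apply: sub_count => k /andP[].
exists (fun x => 2 * D1 x + 2 * D2 x); split.
- by apply: intR_D; exact: intR_Z.
- by move=> x; rewrite addr_ge0// mulr_ge0.
- move=> t x; pose v k := u k * cexp (t * sqnorm R k + dotp k x).
  have sv k : sqmod (v k) = sqmod (u k) by rewrite sqmodM sqmod_cexp mulr1.
  rewrite -/v !exprS expr0 mulr1.
  have -> : sqmod (\sum_(k <- B) v k) * (sqmod (\sum_(k <- B) v k) * sqmod (\sum_(k <- B) v k)) =
    sqmod ((\sum_(k <- B) v k) * (\sum_(k <- B) v k) * conjc (\sum_(k <- B) v k)).
    by rewrite !sqmodM sqmodJ mulrA.
  rewrite cubic_expand//; apply: (le_trans (sqmodD_le _ _)); apply: lerD; apply: ler_wpM2l => //.
    apply: le_trans (h1 t x); rewrite le_eqVlt; apply/orP; left; apply/eqP; congr sqmod.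
    rewrite -/S big_filter; apply: eq_bigr => -[[k1 k2] k3] _ /=.
    have -> : t * (sqz k1 + sqz k2 - sqz k3)%:~R +
        dotp (subt (addt k1 k2) k3) x =
      (t * sqnorm R k1 + dotp k1 x) + (t * sqnorm R k2 + dotp k2 x)
        - (t * sqnorm R k3 + dotp k3 x).
      by rewrite dotpB dotpD !sqnorm_sqz rmorphB rmorphD /=; ring.
    rewrite /v; move: (t * sqnorm R k1 + dotp k1 x) (t * sqnorm R k2 + dotp k2 x).
    move: (t * sqnorm R k3 + dotp k3 x) => A3 A1 A2.
    by rewrite !cexpD cexpN conjc_mul; ring.
  apply: le_trans (h2 t x); rewrite le_eqVlt; apply/orP; left; apply/eqP; congr sqmod.
  by apply: eq_bigr => k _; under eq_bigr do rewrite sv; rewrite sv mulrA sqnorm_sqz.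
- rewrite RintegralD ?RintegralZl//; last 2 first.
  + exact: intR_Z.
  + exact: intR_Z.
  have s1 : \sum_(p <- seq.filter NT S) sqmod (u p.1.1 * u p.1.2 * conjc (u p.2)) <= U ^+ 3.
    apply: (@le_trans _ _ (\sum_(p <- S) sqmod (u p.1.1 * u p.1.2 * conjc (u p.2)))).
      rewrite big_filter [leRHS](bigID NT) /= lerDl; exact: sum_sqr_ge0.
    rewrite /S !big_allpairs_dep /= le_eqVlt; apply/orP; left; apply/eqP.
    rewrite !exprS expr0 mulr1 mulrA {1 2}/U mulr_suml mulr_suml.
    apply: eq_bigr => k _; rewrite [sqmod (u k) * _]mulr_sumr mulr_suml.
    apply: eq_bigr => l _; rewrite /U mulr_sumr; apply: eq_bigr => q _; by rewrite !sqmodM sqmodJ.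
  have s2 : \sum_(k <- B) sqmod ((2 * U - sqmod (u k))%:C%C * u k) <= 4 * U ^+ 3.
    have -> : 4 * U ^+ 3 = \sum_(k <- B) 4 * U ^+ 2 * sqmod (u k).
      by rewrite -mulr_sumr -/U; ring.
    rewrite big_seq [leRHS]big_seq; apply: ler_sum => k kB; rewrite sqmodZ.
    apply: ler_wpM2r; first exact: sqmod_ge0.
    have : sqmod (u k) <= U by rewrite /U (bigD1_seq k)//= lerDl sum_sqr_ge0.
    by have := sqmod_ge0 (u k); move: (sqmod _) => y y0 yU; nra.
  have g1 : (2 * (4 * L ^ 2).+1 * divisor_max L)%N%:R * U ^+ 3 >= 2 * \int[torus R 1]_x D1 x.
    have -> : (2 * (4 * L ^ 2).+1 * divisor_max L)%N%:R * U ^+ 3 =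
        2 * ((2 * L ^ 2).*2.+1%:R * (divisor_max L)%:R * U ^+ 3).
      by rewrite -muln2 (_ : (2 * L ^ 2 * 2 = 4 * L ^ 2)%N) ?natrM; [ring|lia].
    rewrite ler_pM2l//; apply: (le_trans I1); apply: ler_wpM2l => //.
  have g2 : (8 * (2 * L ^ 2).+1)%N%:R * U ^+ 3 >= 2 * \int[torus R 1]_x D2 x.
    have -> : (8 * (2 * L ^ 2).+1)%N%:R * U ^+ 3 =
        2 * ((L ^ 2).*2.+1%:R * 1%:R * (4 * U ^+ 3)).
      by rewrite -muln2 mulnC !natrM; ring.
    rewrite ler_pM2l//; apply: (le_trans I2); apply: ler_wpM2l => //.
  by rewrite natrD [leRHS]mulrDl; exact: lerD.
Qed.

End DimensionOne.

Section DensityBoundDimensionOne.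
Variable R : realType.

(** The dual of [orthonormal_contraction]: the inner sums are conjugates of the scalar products of
    the f_j with the vector of coefficients conj(c_k), so this is Bessel's inequality. With
    exponentials as c it bounds the unweighted density at every point. *)
Lemma orthonormal_row (d : nat) (f : nat -> dist R d) (B : seq (d.-tuple int)) (n : nat)
    (c : d.-tuple int -> R[i]) : orthonormal_seq f -> uniq B ->
  \sum_(0 <= j < n) sqmod (\sum_(k <- B) c k * f j k) <= \sum_(k <- B) sqmod (c k).
Proof.
move=> onf uB; pose v l : R[i] := \sum_(k <- B) conjc (c k) * character R k l.
have iv : inL2 v.
  by apply: inL2_sum => k _; apply: inL2Z; exact: inL2_character.
have := nsq_orthonormal_sum uB (@inL2_character R d) (@dotL2_characters R d B)
  (fun k => conjc (c k)).
rewrite -/v; under [X in _ = X -> _]eq_bigr do rewrite sqmodJ.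
move=> <-; have := @bessel_le R d _ (index_iota 0 n) f (iota_uniq _ _) onf.1
  (fun i j _ _ => onf.2 i j) v iv.
congr (_ <= _); apply: eq_bigr => j _; rewrite /v dotL2_sumr; last 2 first.
- exact: onf.1.
- by move=> k; apply: inL2Z; exact: inL2_character.
rewrite -sqmodJ conjc_sum; congr sqmod; apply: eq_bigr => k _.
rewrite dotL2Z; [|exact: onf.1|exact: inL2_character].
by rewrite dotL2_characterr ?conjc_mul ?conjcK//; exact: onf.1.
Qed.

(* The parameters come from w_j <= tau + w_j^2 / tau and X^2 <= X^3 / b + b^2. *)
Lemma density_bound_dim1 (L n : nat) (w : nat -> R) (f : nat -> dist R 1)
    (mult : 1.-tuple int -> R) (sg tau b : R) :
  orthonormal_seq f -> (forall j, 0 <= w j) -> 0 < sg -> 0 < tau -> 0 < b ->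
  {in box 1 L, forall k, mult k ^+ 2 <= sg} ->
  exists D : 1.-tuple R -> R,
  [/\ (torus R 1).-integrable setT (EFin \o D), forall x, 0 <= D x,
    forall t x, (\sum_(0 <= j < n) w j * sqmod (wavepacket L mult (f j) t x)) ^+ 2 <= D x &
    \int[torus R 1]_x D x <= sg ^+ 2 * (2 * tau ^+ 2 * L.*2.+1%:R ^+ 2 +
      2 * tau ^- 2 * (\sum_(0 <= j < n) w j ^+ 2) ^+ 2 *
      ((2 * (4 * L ^ 2).+1 * divisor_max L + 8 * (2 * L ^ 2).+1)%N%:R / b + b ^+ 2))].
Proof.
move=> onf w0 sg0 tau0 b0 msg; set B := box 1 L; have uB : uniq B by exact: box_uniq.
set Q := (_ + _)%N%:R; set W := \sum_(0 <= j < n) w j ^+ 2.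
have W0 : 0 <= W by apply: sumr_ge0 => j _; exact: sqr_ge0.
pose u j k := (mult k)%:C%C * f j k.
have Uj j : \sum_(k <- B) sqmod (u j k) <= sg.
  apply: (@le_trans _ _ (\sum_(k <- B) sg * sqmod (f j k))); last first.
    by rewrite -mulr_sumr ler_piMr ?(ltW sg0)// orthonormal_column.
  rewrite big_seq [leRHS]big_seq; apply: ler_sum => k kB; rewrite sqmodZ.
  by apply: ler_wpM2r; [exact: sqmod_ge0|exact: msg].
have [D DP] := choice (fun j => cubic_maximal_bound L (u j)).
have iD j : (torus R 1).-integrable setT (EFin \o D j) by have [] := DP j.
have D0 j x : 0 <= D j x by have [] := DP j.
have hD j t x : sqmod (wavepacket L mult (f j) t x) ^+ 3 <= D j x.
  by have [_ _ h _] := DP j; exact: h.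
have Q0 : 0 <= Q by [].
have ID j : \int[torus R 1]_x D j x <= Q * sg ^+ 3.
  have [_ _ _] := DP j; move/le_trans; apply; apply: ler_wpM2l => //.
  by apply: lerXn2r; rewrite ?nnegrE ?sum_sqr_ge0 ?(ltW sg0).
(* The threshold for [Y] carries the factor [sg] of a squared wave packet, so that the final bound
   is homogeneous of degree 2 in [sg]. *)
pose be := sg * b; have be0 : 0 < be by exact: mulr_gt0.
pose c1 := 2 * (tau * (sg * L.*2.+1%:R)) ^+ 2.
exists (fun x => c1 + 2 * tau ^- 2 * W * \sum_(0 <= j < n) w j ^+ 2 * (D j x / be + be ^+ 2)).
have iDj j : (torus R 1).-integrable setT (EFin \o (fun x => w j ^+ 2 * (D j x / be + be ^+ 2))).
  apply: intR_Z; apply: intR_D; last exact: intR_cst.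
  by under [X in EFin \o X]funext do rewrite mulrC; apply: intR_Z.
have c10 : 0 <= c1 by rewrite mulr_ge0 ?sqr_ge0.
have t20 : 0 <= 2 * tau ^- 2 * W by rewrite !mulr_ge0// invr_ge0 sqr_ge0.
split.
- by apply: intR_D; [exact: intR_cst|apply: intR_Z; exact: intR_sum].
- move=> x; rewrite addr_ge0// mulr_ge0// sumr_ge0// => j _.
  by rewrite mulr_ge0 ?sqr_ge0// addr_ge0 ?sqr_ge0// divr_ge0// ltW.
- move=> t x; pose Y j := sqmod (wavepacket L mult (f j) t x).
  have Y0 j : 0 <= Y j by exact: sqmod_ge0.
  have sY : \sum_(0 <= j < n) Y j <= sg * L.*2.+1%:R.
    have := @orthonormal_row 1 f B n
      (fun k => (mult k)%:C%C * cexp (t * sqnorm R k + dotp k x)) onf uB.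
    rewrite (eq_bigr Y) => [h|j _]; last first.
      by congr sqmod; apply: eq_bigr => k _; rewrite mulrAC.
    apply: (le_trans h); apply: (@le_trans _ _ (\sum_(k <- B) sg)).
      rewrite big_seq [leRHS]big_seq; apply: ler_sum => k kB.
      by rewrite sqmodZ sqmod_cexp mulr1; exact: msg.
    by rewrite big_const_seq count_predT size_box expn1 iter_addr_0 mulr_natr.
  have s1 : \sum_(0 <= j < n) w j * Y j <=
      tau * (sg * L.*2.+1%:R) + tau^-1 * \sum_(0 <= j < n) w j ^+ 2 * Y j.
    apply: (@le_trans _ _ (\sum_(0 <= j < n) (tau * Y j + tau^-1 * (w j ^+ 2 * Y j)))).
      apply: ler_sum => j _; rewrite mulrA -mulrDl; apply: ler_wpM2r => //.
      have [h|h] := leP (w j) tau.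
        by rewrite (le_trans h)// lerDl mulr_ge0 ?sqr_ge0// invr_ge0 ltW.
      apply: (@le_trans _ _ (tau^-1 * w j ^+ 2)); last by rewrite lerDr ltW.
      by rewrite ler_pdivlMl// expr2; apply: ler_wpM2r => //; exact: ltW.
    rewrite big_split /= -!mulr_sumr; apply: lerD => //.
    by apply: ler_wpM2l => //; exact: ltW.
  (* Cauchy-Schwarz with the weights w_j^2 leaves only squares of single [Y j], for which the cubic
     majorants [D j] are available. *)
  have s2 : (\sum_(0 <= j < n) w j ^+ 2 * Y j) ^+ 2 <=
      W * \sum_(0 <= j < n) w j ^+ 2 * (D j x / be + be ^+ 2).
    under eq_bigr do rewrite expr2 -mulrA.
    apply: (le_trans (sqr_sum_mul _ _ _ _)); apply: ler_wpM2l => //.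
    apply: ler_sum => j _; rewrite exprMn; apply: ler_wpM2l; first exact: sqr_ge0.
    have := hD j t x; rewrite -/(Y j) => hj.
    have [h|h] := leP (Y j) be.
      rewrite -[leLHS]add0r; apply: lerD; first by rewrite divr_ge0// ltW.
      by apply: lerXn2r; rewrite ?nnegrE// ltW.
    apply: (@le_trans _ _ (D j x / be)); last by rewrite lerDl sqr_ge0.
    rewrite ler_pdivlMr//; apply: le_trans hj; rewrite [leRHS]exprSr.
    by apply: ler_wpM2l; [exact: sqr_ge0|exact: ltW].
  rewrite -/(Y _); set V := \sum_(0 <= j < n) w j * Y j in s1 *.
  have V0 : 0 <= V by apply: sumr_ge0 => j _; rewrite mulr_ge0.
  set P := tau * _ in s1; set G := \sum_(0 <= j < n) w j ^+ 2 * Y j in s1 s2 *.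
  apply: (@le_trans _ _ (2 * P ^+ 2 + 2 * (tau^-1 * G) ^+ 2)).
    have : V ^+ 2 <= (P + tau^-1 * G) ^+ 2 by apply: lerXn2r; rewrite ?nnegrE// (le_trans V0).
    have := sqr_ge0 (P - tau^-1 * G); move: (tau^-1 * G) => g; lra.
  rewrite /c1 -/P lerD2l exprMn exprVn -!mulrA ler_pM2l//.
  by apply: ler_wpM2l; rewrite ?invr_ge0 ?sqr_ge0.
- rewrite RintegralD//; [|exact: intR_cst|by apply: intR_Z; exact: intR_sum].
  rewrite Rintegral_cst// [X in fine X](@probability_setT _ _ _ (torus R 1)) mulr1.
  rewrite RintegralZl//; last exact: intR_sum.
  rewrite Rintegral_sum//.
  have -> : sg ^+ 2 * (2 * tau ^+ 2 * L.*2.+1%:R ^+ 2 + 2 * tau ^- 2 * W ^+ 2 * (Q / b + b ^+ 2)) =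
      c1 + 2 * tau ^- 2 * W * (W * (sg ^+ 2 * (Q / b + b ^+ 2))).
    by rewrite /c1; ring.
  rewrite lerD2l; apply: ler_wpM2l => //; rewrite /W mulr_suml.
  apply: ler_sum => j _; rewrite RintegralZl//; last first.
    apply: intR_D; last exact: intR_cst.
    by under [X in EFin \o X]funext do rewrite mulrC; apply: intR_Z.
  apply: ler_wpM2l; first exact: sqr_ge0.
  rewrite RintegralD//; last 2 first.
  + by under [X in EFin \o X]funext do rewrite mulrC; apply: intR_Z.
  + exact: intR_cst.
  rewrite Rintegral_cst// [X in fine X](@probability_setT _ _ _ (torus R 1)) mulr1.
  rewrite RintegralZr//.
  have -> : sg ^+ 2 * (Q / b + b ^+ 2) = Q * sg ^+ 3 / be + be ^+ 2.
    by rewrite /be; field; rewrite !gt_eqF.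
  by rewrite lerD2r ler_pM2r ?invr_gt0.
Qed.

End DensityBoundDimensionOne.

(** * Summation over dyadic bands *)

Section LittlewoodPaley.
Variables (R : realType) (d : nat) (eta1 : R -> R) (s : R).
Hypothesis eta01 : forall z, 0 <= eta1 z <= 1.
Hypothesis eta_one : forall z, `|z| <= 1 -> eta1 z = 1.
Hypothesis eta_zero : forall z, 2 <= `|z| -> eta1 z = 0.
Implicit Types (k : d.-tuple int) (N : nat).

Definition lowpass N k : R := \prod_(i < d) eta1 ((tnth k i)%:~R / 2 ^+ N).

(** The cutoff is the one that defines pointwise values, so the bands up to N add up exactly to the
    smoothed partial sum at scale 2^N. *)
Definition bandpass N k : R :=
  lowpass N k - (if N is M.+1 then lowpass M k else 0).

Definition band_multiplier N k : R := bandpass N k * (1 + sqnorm R k) `^ (- s / 2).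

(** The factor 2^(2 s) is needed because band N starts at frequency 2^(N - 1). *)
Definition band_weight N : R := 2 `^ (2 * s) * (2 `^ (- (2 * s))) ^+ N.

Lemma band_weight_gt0 N : 0 < band_weight N.
Proof. by rewrite mulr_gt0 ?exprn_gt0 ?powR_gt0. Qed.

Lemma lowpass_itv N k : 0 <= lowpass N k <= 1.
Proof.
apply/andP; split; first by apply: prodr_ge0 => i _; have /andP[] := eta01 ((tnth k i)%:~R / 2 ^+ N).
by apply: prodr_ile1 => i _; exact: eta01.
Qed.

Lemma sum_bandpass N k : \sum_(m < N.+1) bandpass m k = lowpass N k.
Proof.
elim: N => [|N IH]; first by rewrite big_ord1 /bandpass subr0.
by rewrite big_ord_recr /= IH /bandpass addrC subrK.
Qed.

Lemma bandpass_sq_le1 N k : bandpass N k ^+ 2 <= 1.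
Proof.
rewrite /bandpass; have := lowpass_itv N k; case: N => [|N]; last have := lowpass_itv N k.
  by move: (lowpass _ _) => x /andP[? ?]; nra.
by move: (lowpass _ _) (lowpass _ _) => y x /andP[? ?] /andP[? ?]; nra.
Qed.

Lemma norm_quotient N (z : int) : `|z%:~R / 2 ^+ N : R| = (absz z)%:R / 2 ^+ N.
Proof.
by rewrite normrM [X in _ * X]ger0_norm ?invr_ge0 ?exprn_ge0// natr_absz intr_norm.
Qed.

Lemma lowpass_eq0 N k : k \notin box d (2 ^ N.+1) -> lowpass N k = 0.
Proof.
rewrite mem_box negb_forall => /existsP[i hi].
rewrite /lowpass (bigD1 i)//= eta_zero ?mul0r// norm_quotient.
rewrite ler_pdivlMr ?exprn_gt0// -exprS -natrX ler_nat.
by move: hi; rewrite -ltNge; lia.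
Qed.

Lemma lowpass_eq1 N k : k \in box d (2 ^ N) -> lowpass N k = 1.
Proof.
rewrite mem_box => /forallP h; rewrite /lowpass big1// => i _; rewrite eta_one//.
rewrite norm_quotient ler_pdivrMr ?exprn_gt0// mul1r -natrX ler_nat.
by have := h i; lia.
Qed.

Lemma box_le (L M : nat) k : (L <= M)%N -> k \in box d L -> k \in box d M.
Proof.
move=> LM; rewrite !mem_box => /forallP h; apply/forallP => i.
by have := h i; lia.
Qed.

Lemma box_exhaust k : exists K, k \in box d (2 ^ K).
Proof.
exists (\sum_(i < d) absz (tnth k i))%N; rewrite mem_box; apply/forallP => i.
have : (absz (tnth k i) <= \sum_(i < d) absz (tnth k i))%N by rewrite (bigD1 i)//= leq_addr.
move: (\sum_(i < d) _)%N => a ha; have := ltn_expl a (isT : (1 < 2)%N).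
by move: (2 ^ a)%N => b; lia.
Qed.

Lemma bandpass_eq0 N k : k \notin box d (2 ^ N.+1) -> bandpass N k = 0.
Proof.
move=> hk; rewrite /bandpass lowpass_eq0// sub0r; case: N hk => [|N] hk; rewrite ?oppr0//.
rewrite lowpass_eq0 ?oppr0//; apply: contra hk; apply: box_le.
by rewrite leq_exp2l.
Qed.

Lemma sqnorm_ge0 k : 0 <= sqnorm R k.
Proof. by apply: sumr_ge0 => i _; exact: sqr_ge0. Qed.

Hypothesis s0 : 0 <= s.

Lemma band_multiplier_bound N k : band_multiplier N k ^+ 2 <= band_weight N.
Proof.
have n1 : 1 <= 1 + sqnorm R k by rewrite lerDl sqnorm_ge0.
have n0 : 0 < 1 + sqnorm R k by apply: lt_le_trans n1.
have e : ((1 + sqnorm R k) `^ (- s / 2)) ^+ 2 = (1 + sqnorm R k) `^ (- s).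
  by rewrite -powR_mulrn ?powR_ge0// -powRrM; congr (_ `^ _); field.
rewrite /band_multiplier /band_weight exprMn e.
case: N => [|N].
  rewrite expr0 mulr1; apply: (@le_trans _ _ 1).
    rewrite mulr_ile1 ?sqr_ge0 ?powR_ge0 ?bandpass_sq_le1//.
    rewrite powRN invf_le1 ?powR_gt0//.
    by rewrite -[leLHS](powRr0 (1 + sqnorm R k)) ler_powR.
  by rewrite -[leLHS](powRr0 2) ler_powR ?ler1n// mulr_ge0.
(* On this box both cutoffs equal 1 and the band vanishes; off it some coordinate exceeds 2^N in
   absolute value. *)
have [kN|kN] := boolP (k \in box d (2 ^ N)).
  rewrite /bandpass !lowpass_eq1//; last by apply: box_le kN; rewrite leq_exp2l.
  by rewrite subrr expr0n mul0r mulr_ge0 ?powR_ge0 ?exprn_ge0 ?powR_ge0.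
have big : 2 `^ (2 * N%:R) <= 1 + sqnorm R k.
  move: kN; rewrite mem_box negb_forall => /existsP[i hi].
  rewrite mulrC powRrM powR_mulrn ?powR_ge0// powR_mulrn// -exprM.
  have hi2 : (2 ^ N <= absz (tnth k i))%N by move: hi; rewrite -ltNge; lia.
  apply: (@le_trans _ _ (sqnorm R k)); last by rewrite lerDr.
  rewrite /sqnorm (bigD1 i)//= -[leLHS]addr0; apply: lerD; last first.
    by apply: sumr_ge0 => j _; exact: sqr_ge0.
  rewrite -[leRHS]ger0_norm ?sqr_ge0// normrX -intr_norm -natr_absz exprM.
  by apply: lerXn2r; rewrite ?nnegrE ?exprn_ge0// -natrX ler_nat.
have -> : 2 `^ (2 * s) * 2 `^ (- (2 * s)) ^+ N.+1 = (2 `^ (2 * N%:R)) `^ (- s) :> R.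
  rewrite -powRrM exprS mulrA -powRD ?subrr ?powRr0 ?mul1r; last by apply/implyP.
  by rewrite -powR_mulrn ?powR_ge0// -powRrM; congr (_ `^ _); ring.
apply: (@le_trans _ _ ((1 + sqnorm R k) `^ (- s))).
  by rewrite ler_piMl ?powR_ge0// bandpass_sq_le1.
rewrite !powRN lef_pV2 ?posrE ?powR_gt0//.
by apply: ge0_ler_powR; rewrite ?nnegrE ?powR_ge0// ltW.
Qed.

End LittlewoodPaley.

(** * Geometric decay in the band index *)

Section KeyEstimate.
Variables (R : realType).

Lemma band_weight_sqr (s : R) (N : nat) :
  band_weight s N ^+ 2 = 2 `^ (4 * s) * (2 `^ (- (4 * s))) ^+ N.
Proof.
have e (x : R) : (2 `^ x) ^+ 2 = 2 `^ (x * 2) by rewrite -powR_mulrn ?powR_ge0// -powRrM.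
rewrite /band_weight exprMn -exprM mulnC exprM !e.
by have -> : 2 * s * 2 = 4 * s; [ring|have -> : - (2 * s) * 2 = - (4 * s) by ring].
Qed.

Lemma powR2_lt1 (x : R) : x < 0 -> 2 `^ x < 1.
Proof.
move=> x0; rewrite -[x]opprK powRN invf_lt1 ?powR_gt0//.
have : 1 `^ (- x) < 2 `^ (- x) :> R.
  by apply: gt0_ltr_powR; rewrite ?nnegrE ?oppr_gt0// ltr1n.
by rewrite powR1.
Qed.

(** The majorant may depend on the band and on the number of functions, but not on t; the constant
    depends on none of these. The bands are summable when r < 1. *)
Definition band_bound (d : nat) (s : R) (eta1 : R -> R) (w : nat -> R)
    (f : nat -> dist R d) (r : R) :=
  exists2 C : R, 0 <= C & forall N n : nat, exists D : d.-tuple R -> R,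
  [/\ (torus R d).-integrable setT (EFin \o D), forall x, 0 <= D x,
    forall t x, (\sum_(0 <= j < n) w j *
      sqmod (wavepacket (2 ^ N.+1) (band_multiplier eta1 s N) (f j) t x)) ^+ 2 <= D x &
    \int[torus R d]_x D x <= C * r ^+ N].

Variables (eta1 : R -> R) (s : R).
Hypothesis eta01 : forall z, 0 <= eta1 z <= 1.
Hypothesis eta_one : forall z, `|z| <= 1 -> eta1 z = 1.
Hypothesis s0 : 0 <= s.

Lemma double_pow_le (N : nat) : (2 ^ N.+1).*2.+1%:R <= 5 * 2 ^+ N :> R.
Proof.
rewrite -natrX -natrM ler_nat expnS -muln2.
have : (0 < 2 ^ N)%N by rewrite expn_gt0.
by move: (2 ^ N)%N => a; lia.
Qed.

(** With d = d' + 2 the ratio is 2^(d + 1 - 4 s): the power L^(d + 1) of [density_bound_multid]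
    against the squared band weight. *)
Lemma band_bound_multid (d' : nat) (w : nat -> R) (f : nat -> dist R d'.+2) (W : R) :
  orthonormal_seq f -> (forall n, \sum_(0 <= j < n) w j ^+ 2 <= W) ->
  band_bound s eta1 w f (2 ^+ d'.+3 * 2 `^ (- (4 * s))).
Proof.
move=> onf wW; have W0 : 0 <= W by have := wW 0%N; rewrite big_nil.
exists (4 * d'.+2%:R * 5 ^+ d'.+3 * (2 `^ (4 * s) * W)).
  by do ?[done|apply: mulr_ge0|exact: exprn_ge0|exact: powR_ge0].
move=> N n.
have [|D [iD D0 hD ID]] := @density_bound_multid R d'.+1 (2 ^ N.+1) n w f
  (band_multiplier eta1 s N) (band_weight s N) onf.
  by move=> k _; exact: band_multiplier_bound.
exists D; split => //; apply: (le_trans ID); rewrite band_weight_sqr.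
have h1 : (2 ^ N.+1).*2.+1%:R ^+ d'.+3 <= 5 ^+ d'.+3 * (2 ^+ d'.+3) ^+ N :> R.
  rewrite -exprM mulnC exprM -exprMn.
  by apply: lerXn2r; rewrite ?nnegrE ?mulr_ge0 ?exprn_ge0// double_pow_le.
set q := 2 `^ (- (4 * s)); have q0 : 0 <= q by exact: powR_ge0.
set p := 2 `^ (4 * s); have p0 : 0 <= p by exact: powR_ge0.
rewrite exprMn.
have -> : 4 * d'.+2%:R * 5 ^+ d'.+3 * (p * W) * ((2 ^+ d'.+3) ^+ N * q ^+ N) =
  4 * d'.+2%:R * (5 ^+ d'.+3 * (2 ^+ d'.+3) ^+ N) * (p * q ^+ N * W) by ring.
apply: ler_pM.
- by do ?[done|apply: mulr_ge0|exact: exprn_ge0].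
- by do ?[done|apply: mulr_ge0|exact: exprn_ge0]; apply: sumr_ge0 => j _; exact: sqr_ge0.
- by apply: ler_wpM2l.
- by apply: ler_wpM2l; rewrite ?mulr_ge0 ?exprn_ge0.
Qed.

Lemma divisor_max_bound (q : nat) : (0 < q)%N -> exists C : nat, forall L : nat,
  (0 < L)%N -> (divisor_max L ^ q <= C * L ^ 2)%N.
Proof.
move=> q0; have [C CP] := size_divisors_bound q0.
exists (2 ^ q * (C * 4))%N => L L0; rewrite /divisor_max expnMn -mulnA leq_mul2l.
apply/orP; right; apply: (@big_ind _ (fun x => x ^ q <= C * 4 * L ^ 2)%N).
- by rewrite exp0n.
- by move=> x y hx hy; rewrite /maxn; case: ifP.
(* The maximum includes P = 0, whereas the divisor bound is for positive integers. *)
- move=> [[|P] hP] _ /=.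
    have := CP 1%N isT; rewrite muln1 !exp1n => C1.
    by rewrite muln_gt0 muln_gt0 C1 expn_gt0 L0.
  by apply: leq_trans (CP P.+1 isT) _; rewrite -mulnA leq_mul2l; apply/orP; right; rewrite -ltnS.
Qed.

Lemma band_bound_dim1 (q : nat) (w : nat -> R) (f : nat -> dist R 1) (W : R) :
  (0 < q)%N -> orthonormal_seq f -> (forall j, 0 <= w j) ->
  (forall n, \sum_(0 <= j < n) w j ^+ 2 <= W) ->
  band_bound s eta1 w f (2 `^ (5 / 3 + 2 / q%:R - 4 * s)).
Proof.
move=> q0 onf w0 wW; have W0 : 0 <= W by have := wW 0%N; rewrite big_nil.
have [C0 C0P] := divisor_max_bound q0.
(* With y = z^N one has 2^N = y^6. The parameters tau = y^-1 and b = y^4, that is L^(-1/6) and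
   L^(2/3) up to constants, balance all terms: tau^2 L^2, tau^-2 L^2 / b and tau^-2 b^2 are of order
   y^10, hence the exponent 5/3. *)
pose z : R := 2 `^ (6^-1); have z0 : 0 < z by exact: powR_gt0.
have z6 : z ^+ 6 = 2 by rewrite -powR_mulrn ?powR_ge0// -powRrM mulVf// powRr1.
(* The loss from the divisor bound per band: the q-th power of [divisor_max] is at most a constant
   times L^2, and rho^q = 4. *)
pose rho : R := 2 `^ (2 / q%:R); have rho0 : 0 < rho by exact: powR_gt0.
have rho1 : 1 <= rho by rewrite -[leLHS](powRr0 2) ler_powR ?ler1n// divr_ge0.
have rhoq : rho ^+ q = 4.
  rewrite -powR_mulrn ?powR_ge0// -powRrM divfK ?pnatr_eq0 -?lt0n//.
  by rewrite powR_mulrn// -natrX.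
pose A : R := (C0 * 4).+1%:R; have A1 : 1 <= A by rewrite ler1n.
have Kb N : (divisor_max (2 ^ N.+1))%:R <= A * rho ^+ N.
  rewrite -(@ler_pXn2r _ q) ?nnegrE ?mulr_ge0 ?exprn_ge0 ?(ltW rho0)//.
  rewrite exprMn -exprM mulnC exprM rhoq -natrX.
  apply: (@le_trans _ _ (A * 4 ^+ N)).
    rewrite -!natrX -natrM ler_nat; apply: leq_trans (C0P _ _) _; first by rewrite expn_gt0.
    have -> : ((2 ^ N.+1) ^ 2 = 4 * 4 ^ N)%N by rewrite -expnM mulnC expnM expnS.
    by rewrite mulnA leq_mul2r leqnSn orbT.
  apply: ler_wpM2r; first by rewrite exprn_ge0.
  by rewrite -[leLHS]expr1; apply: ler_weXn2l.
pose C1 : R := 50 + 2 * W ^+ 2 * (34 * A + 72 + 1).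
exists (2 `^ (4 * s) * C1).
  rewrite mulr_ge0 ?powR_ge0// addr_ge0// !mulr_ge0 ?sqr_ge0//.
  have := A1; lra.
move=> N n; set L := (2 ^ N.+1)%N.
have zN : 0 < z ^+ N by rewrite exprn_gt0.
have [||||D [iD D0 hD ID]] := @density_bound_dim1 R L n w f (band_multiplier eta1 s N)
  (band_weight s N) (z ^- N) (z ^+ N ^+ 4) onf w0.
- exact: band_weight_gt0.
- by rewrite invr_gt0.
- by rewrite exprn_gt0.
- by move=> k _; exact: band_multiplier_bound.
exists D; split => //; apply: (le_trans ID); rewrite band_weight_sqr.
have -> : 2 `^ (5 / 3 + 2 / q%:R - 4 * s) = z ^+ 10 * rho * 2 `^ (- (4 * s)).
  rewrite -powR_mulrn ?powR_ge0// -powRrM /rho -!powRD; last 2 first.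
  - by apply/implyP.
  - by apply/implyP.
  by congr (_ `^ _); field; rewrite pnatr_eq0 -lt0n.
rewrite [(_ * _ * _) ^+ N]exprMn [(_ * _) ^+ N]exprMn.
set qq := 2 `^ (- (4 * s)); have qq0 : 0 <= qq by exact: powR_ge0.
set p := 2 `^ (4 * s); have p0 : 0 <= p by exact: powR_ge0.
have -> : p * C1 * ((z ^+ 10) ^+ N * rho ^+ N * qq ^+ N) =
  p * qq ^+ N * (C1 * ((z ^+ 10) ^+ N * rho ^+ N)) by ring.
apply: ler_wpM2l; first by rewrite mulr_ge0 ?exprn_ge0.
set y := z ^+ N in zN *.
have zE : (z ^+ 10) ^+ N = y ^+ 10 by rewrite /y -!exprM mulnC.
rewrite zE.
have yM : 2 ^+ N = y ^+ 6 by rewrite /y -exprM mulnC exprM z6.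
have LR : L%:R = 2 * y ^+ 6 :> R by rewrite /L natrX exprS yM.
have LE : L.*2.+1%:R <= 5 * y ^+ 6 :> R by rewrite -yM; exact: double_pow_le.
have rN1 : 1 <= rho ^+ N by exact: exprn_ege1.
have y1 : 1 <= y ^+ 6 by rewrite -yM exprn_ege1// ler1n.
have wn := wW n; have wn0 : 0 <= \sum_(0 <= j < n) w j ^+ 2.
  by apply: sumr_ge0 => j _; exact: sqr_ge0.
have h1 : 2 * y ^- 1 ^+ 2 * L.*2.+1%:R ^+ 2 <= 50 * y ^+ 10.
  apply: (@le_trans _ _ (2 * y ^- 1 ^+ 2 * (5 * y ^+ 6) ^+ 2)).
    apply: ler_wpM2l; first by rewrite mulr_ge0 ?sqr_ge0.
    apply: lerXn2r => //; rewrite nnegrE//.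
    by do ?[done|apply: mulr_ge0|apply: exprn_ge0|exact: ltW].
  by rewrite le_eqVlt; apply/orP; left; apply/eqP; field; rewrite gt_eqF.
set Q := (_ + _)%N%:R.
have hQ : Q <= (34 * A + 72) * (y ^+ 12 * rho ^+ N).
  have L2 : (4 * L ^ 2).+1%:R <= 17 * y ^+ 12 :> R.
    rewrite -natr1 natrM natrX LR; move: y1.
    rewrite (_ : y ^+ 12 = (y ^+ 6) ^+ 2); last by rewrite -exprM.
    by move: (y ^+ 6) => a a1; nra.
  have L3 : (2 * L ^ 2).+1%:R <= 9 * y ^+ 12 :> R.
    rewrite -natr1 natrM natrX LR; move: y1.
    rewrite (_ : y ^+ 12 = (y ^+ 6) ^+ 2); last by rewrite -exprM.
    by move: (y ^+ 6) => a a1; nra.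
  have yp : 0 <= y ^+ 12 by rewrite exprn_ge0// ltW.
  rewrite /Q; move: (Kb N); rewrite -/L; move: (divisor_max L) => K hK.
  rewrite natrD !natrM.
  apply: (@le_trans _ _ (2 * (17 * y ^+ 12) * (A * rho ^+ N) + 8 * (9 * y ^+ 12 * rho ^+ N))).
    apply: lerD.
      by apply: ler_pM => //; apply: ler_wpM2l.
    apply: ler_wpM2l => //; apply: (le_trans L3); rewrite ler_peMr// mulr_ge0//.
  by rewrite le_eqVlt; apply/orP; left; apply/eqP; ring.
have Q0 : 0 <= Q by [].
have h2 : Q / y ^+ 4 + (y ^+ 4) ^+ 2 <= (34 * A + 72 + 1) * (y ^+ 8 * rho ^+ N).
  rewrite [leRHS]mulrDl mul1r; apply: lerD.
    rewrite ler_pdivrMr ?exprn_gt0//; apply: (le_trans hQ).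
    by rewrite le_eqVlt; apply/orP; left; apply/eqP; ring.
  by rewrite -exprM ler_peMr ?exprn_ge0// ltW.
apply: (@le_trans _ _ (50 * y ^+ 10 + 2 * y ^+ 2 * W ^+ 2 * ((34 * A + 72 + 1) * (y ^+ 8 * rho ^+ N)))).
  apply: lerD; first by rewrite -[X in X <= _]mulrA mulrA; move: h1; rewrite expr1.
  apply: ler_pM.
  - by rewrite !mulr_ge0 ?sqr_ge0// invr_ge0 sqr_ge0.
  - by rewrite addr_ge0 ?sqr_ge0// divr_ge0// exprn_ge0// ltW.
  - rewrite exprVn invrK; apply: ler_wpM2l; first by rewrite mulr_ge0 ?sqr_ge0.
    by apply: lerXn2r; rewrite ?nnegrE.
  - exact: h2.
have -> : C1 * (y ^+ 10 * rho ^+ N) = 50 * y ^+ 10 * rho ^+ N +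
  2 * y ^+ 2 * W ^+ 2 * ((34 * A + 72 + 1) * (y ^+ 8 * rho ^+ N)) by rewrite /C1; ring.
rewrite lerD2r ler_peMr//.
by do ?[done|apply: mulr_ge0|apply: exprn_ge0|exact: ltW].
Qed.

Lemma key_estimate (d : nat) (w : nat -> R) (f : nat -> dist R d) (W : R) :
  (0 < d)%N -> d%:R / 4 + d%:R / (2 * (d%:R + 2)) < s ->
  orthonormal_seq f -> (forall j, 0 <= w j) ->
  (forall n, \sum_(0 <= j < n) w j ^+ 2 <= W) ->
  exists r : R, [/\ 0 < r, r < 1 & band_bound s eta1 w f r].
Proof.
case: d f => [//|[|d]] f _ hs onf w0 wW.
  have s512 : 5 / 3 < 4 * s.
    have e : 1 / 4 + 1 / (2 * (1 + 2)) = 5 / 12 :> R by field.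
    by move: hs; rewrite e; lra.
  (* The order q of the divisor bound is chosen so that its loss fits in the room left by s >
     5/12. *)
  have [q q0 hq] : exists2 q : nat, (0 < q)%N & 2 / q%:R < 4 * s - 5 / 3.
    exists (Num.truncn (2 / (4 * s - 5 / 3))).+1 => //.
    rewrite ltr_pdivrMr// mulrC -ltr_pdivrMr; last by lra.
    by apply: truncnS_gt; rewrite num_real.
  exists (2 `^ (5 / 3 + 2 / q%:R - 4 * s)); split.
  - exact: powR_gt0.
  - by apply: powR2_lt1; lra.
  - exact: band_bound_dim1 wW.
exists (2 ^+ d.+3 * 2 `^ (- (4 * s))); split.
- by rewrite mulr_gt0 ?exprn_gt0 ?powR_gt0.
- rewrite -powR_mulrn// -powRD; last by apply/implyP.
  apply: powR2_lt1.
  have -> : d.+3%:R = d.+2%:R + 1 :> R by rewrite natr1.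
  have : 2 <= d.+2%:R :> R by rewrite ler_nat.
  move: hs; move: (d.+2%:R) => a hs a2.
  (* This is where d >= 2 enters: the hypothesis on s becomes 4 s > d + 1. *)
  have e : 4^-1 <= a / (2 * (a + 2)) by rewrite ler_pdivlMr; lra.
  lra.
- exact: band_bound_multid wW.
Qed.

End KeyEstimate.

(** * A pointwise bound uniform in time and in the number of functions *)

Section MaximalMajorant.
Variable R : realType.
Local Open Scope ereal_scope.

Lemma limn_einf_ge (u : nat -> \bar R) (v : \bar R) (N : nat) :
  (forall n, (N <= n)%N -> v <= u n) -> v <= limn_einf u.
Proof.
move=> h; rewrite limn_einf_lim.
have -> : limn (einfs u) = ereal_sup (range (einfs u)).
  by apply/cvg_lim => //; exact: cvg_einfs_sup.
apply: (@le_trans _ _ (einfs u N)); last by apply: ereal_sup_ubound; exists N.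
by apply: le_ereal_inf_tmp => _ [m /= Nm <-]; exact: h.
Qed.

Lemma limn_einf_le (u : nat -> \bar R) (c : \bar R) :
  (forall n, u n <= c) -> limn_einf u <= c.
Proof.
move=> h; rewrite limn_einf_lim.
have -> : limn (einfs u) = ereal_sup (range (einfs u)).
  by apply/cvg_lim => //; exact: cvg_einfs_sup.
apply: ge_ereal_sup => _ [m _ <-]; apply: le_trans (h m).
by apply: ereal_inf_lbound; exists m => /=.
Qed.

(* The majorant in [band_bound] depends on the number n of terms.  The left-hand
   side increases with n, so the lower limit over n of the majorants works for
   all n, and Fatou bounds its integral. *)
Lemma maximal_majorant (d : nat) (s : R) (eta1 : R -> R) (w : nat -> R)
    (f : nat -> dist R d) (r : R) :
  (0 < r)%R -> (r < 1)%R -> (forall j, 0 <= w j)%R -> band_bound s eta1 w f r ->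
  exists (q : R) (S : d.-tuple R -> R),
  [/\ (0 < q < 1)%R, (torus R d).-integrable setT (EFin \o S) /\
       (torus R d).-integrable setT (EFin \o (fun x => S x ^+ 2)%R),
      forall x, (0 <= S x)%R &
   {ae torus R d, forall x, forall N n t, (\sum_(0 <= j < n) w j *
      sqmod (wavepacket (2 ^ N.+1) (band_multiplier eta1 s N) (f j) t x) <=
      (q ^+ 2) ^+ N * S x)%R}].
Proof.
move=> r0 r1 w0 [C C0 CP].
have [D0 D0P] := choice (fun p : nat * nat => CP p.1 p.2).
pose D N n := D0 (N, n).
have iD N n : (torus R d).-integrable setT (EFin \o D N n) by have [] := D0P (N, n).
have pD N n x : (0 <= D N n x)%R by have [_ h _ _] := D0P (N, n); exact: h.
have hD N n t x := let: And4 _ _ h _ := D0P (N, n) in h t x.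
have ID N n : (\int[torus R d]_x D N n x <= C * r ^+ N)%R by have [_ _ _ h] := D0P (N, n).
pose E N x := limn_einf (fun n => (D N n x)%:E).
have mD N n : measurable_fun setT (EFin \o D N n) by have /integrableP[] := iD N n.
have mE N : measurable_fun setT (E N).
  have -> : E N = (fun x => - limn_esup (fun n => - (D N n x)%:E)) by [].
  apply: measurableT_comp => //; apply: measurable_fun_limn_esup => n.
  have -> : (fun x => - (D N n x)%:E) = (fun x => (- D N n x)%:E) by [].
  by apply/measurable_EFinP/measurableT_comp => //; exact/measurable_EFinP.
have E0 N x : 0 <= E N x by apply: (@limn_einf_ge _ _ 0%N) => n _; rewrite lee_fin.
(* r^N = k^N k^N provides the two decaying factors that [ae_weighted_bound] asks for. *)
pose k := Num.sqrt r; have k0 : (0 < k)%R by rewrite sqrtr_gt0.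
have kk : (k * k = r)%R by rewrite -expr2 sqr_sqrtr// ltW.
have k1 : (k < 1)%R by rewrite -[ltRHS]sqrtr1 ltr_sqrt.
have [|S [iS S0 hS]] := @ae_weighted_bound R d k C E k0 k1 C0 mE E0.
  move=> N; apply: (le_trans (@fatou _ _ _ (torus R d) setT measurableT
    (fun n => EFin \o D N n) (mD N) _)).
    by move=> n x _; rewrite lee_fin.
  apply: limn_einf_le => n; rewrite -EFin_Rintegral// lee_fin.
  by rewrite -mulrA -exprMn kk.
(* What is controlled is V^2 <= k^N S, so V itself is at most (q^2)^N sqrt(S) with q^4 = k. The new
   majorant sqrt(S) is square integrable, which later puts the densities in L^2. *)
pose q := Num.sqrt (Num.sqrt k).
have q0 : (0 < q)%R by rewrite !sqrtr_gt0.
have q4 : (q ^+ 2 ^+ 2 = k)%R by rewrite !sqr_sqrtr// ?sqrtr_ge0// ltW.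
have q1 : (q < 1)%R.
  by rewrite -[ltRHS]sqrtr1 ltr_sqrt// -[ltRHS]sqrtr1 ltr_sqrt.
exists q, (fun x => Num.sqrt (S x)); split.
- by rewrite q0.
- split; last by under eq_fun do rewrite sqr_sqrtr//.
  apply: (@intR_le _ _ _ _ _ (fun x => 1 + S x)%R).
  + apply: (@measurableT_comp _ _ _ _ _ _ (@Num.sqrt R)); last exact: intR_measurable iS.
    by apply: continuous_measurable_fun; exact: sqrt_continuous.
  + by apply: intR_D => //; exact: intR_cst.
  + move=> x; rewrite ger0_norm ?sqrtr_ge0//.
    by have := S0 x; have := sqrtr_ge0 (S x); have := sqr_sqrtr (S0 x); nra.
- by move=> x; exact: sqrtr_ge0.
- apply: filterS hS => x h N n t.
  set V := (\sum_(0 <= j < n) _)%R.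
  have V0 : (0 <= V)%R by apply: sumr_ge0 => j _; rewrite mulr_ge0 ?sqmod_ge0.
  have : (V ^+ 2)%:E <= E N x.
    apply: (@limn_einf_ge _ _ n) => m nm; rewrite lee_fin.
    apply: le_trans (hD N m t x); apply: lerXn2r; rewrite ?nnegrE//.
      by apply: sumr_ge0 => j _; rewrite mulr_ge0 ?sqmod_ge0.
    rewrite (big_cat_nat (n := n)) //= lerDl.
    by apply: sumr_ge0 => j _; rewrite mulr_ge0 ?sqmod_ge0.
  move=> /le_trans/(_ (h N)); rewrite lee_fin => h2.
  rewrite -(@ler_pXn2r _ 2)// ?nnegrE ?mulr_ge0 ?exprn_ge0 ?sqrtr_ge0 ?(ltW q0)//.
  have qN : ((q ^+ 2) ^+ N ^+ 2 = k ^+ N)%R by rewrite exprAC q4.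
  by rewrite exprMn qN sqr_sqrtr.
Qed.

End MaximalMajorant.

(** * Summation over bands and functions at a fixed point *)

Section UniformSummation.
Variable R : realType.
Local Notation normc := (@ComplexField.Normc.normc R).

Lemma cvg_bounded_partial (u : nat -> R) (M : R) :
  (forall n, 0 <= u n) -> (forall n, \sum_(0 <= j < n) u j <= M) -> cvgn (series u).
Proof.
move=> u0 uM; apply: nondecreasing_is_cvgn.
  by apply: nondecreasing_series => n _ _; exact: u0.
by exists M => _ [n _ <-]; exact: uM.
Qed.

Lemma continuous_sumr (I : Type) (r : seq I) (f : I -> R -> R) :
  (forall i, continuous (f i)) -> continuous (fun t => \sum_(i <- r) f i t).
Proof.
move=> cf t; elim: r => [|i r IH].
  by under eq_fun do rewrite big_nil; exact: cvg_cst.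
by under eq_fun do rewrite big_cons; apply: cvgD; [exact: cf|exact: IH].
Qed.

Variables (P : nat -> nat -> R -> R[i]) (w lam eps : nat -> R) (q B : R).
Hypotheses (q0 : 0 < q) (q1 : q < 1) (w0 : forall j, 0 < w j).
Hypothesis lw : forall j, `|lam j| <= eps j * w j.
Hypothesis eps0 : eps @ \oo --> 0.
Hypothesis hP : forall N n t,
  \sum_(0 <= j < n) w j * sqmod (P N j t) <= (q ^+ 2) ^+ N * B.

Let B0 : 0 <= B.
Proof. by have := hP 0%N 0%N 0; rewrite big_nil expr0 mul1r. Qed.

Let q10 : 0 < 1 - q. Proof. by rewrite subr_gt0. Qed.

Lemma geometric_partial_le (m : nat) : \sum_(N < m) q ^+ N <= (1 - q)^-1.
Proof.
have e : (1 - q) * \sum_(N < m) q ^+ N = 1 - q ^+ m.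
  elim: m => [|m IH]; first by rewrite big_ord0 mulr0 expr0 subrr.
  by rewrite big_ord_recr /= mulrDr IH exprS; ring.
rewrite -[leRHS]mulr1 -(ler_pM2l q10) e mulrA divff ?gt_eqF// mul1r.
by rewrite gerBl exprn_ge0// ltW.
Qed.

(** Cauchy-Schwarz over the bands with weights q^N: the sum of the q^N is at most 1 / (1 - q), and
    the opposite weights q^-N use up half of the decay q^(2 N) in [hP]. *)
Lemma sum_pieces_le (M n : nat) (t : R) :
  \sum_(0 <= j < n) w j * sqmod (\sum_(N < M) P N j t) <= (1 - q) ^- 2 * B.
Proof.
have cs j : sqmod (\sum_(N < M) P N j t) <=
    (1 - q)^-1 * \sum_(N < M) (q ^+ N)^-1 * sqmod (P N j t).
  pose a N : R := Num.sqrt (q ^+ N).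
  have a0 N : 0 < a N by rewrite sqrtr_gt0 exprn_gt0.
  have a2 N : a N ^+ 2 = q ^+ N by rewrite sqr_sqrtr// exprn_ge0// ltW.
  have -> : \sum_(N < M) P N j t =
      \sum_(N < M) (a N)%:C%C * (((a N)^-1)%:C%C * P N j t).
    apply: eq_bigr => N _; rewrite mulrA -rmorphM mulfV ?gt_eqF//.
    by rewrite rmorph1 mul1r.
  apply: (le_trans (sqmod_sum_mul _ _ _ _)); apply: ler_pM.
  - exact: sum_sqr_ge0.
  - exact: sum_sqr_ge0.
  - by under eq_bigr do rewrite sqmod_real a2; exact: geometric_partial_le.
  - by apply: ler_sum => N _; rewrite sqmodZ exprVn a2.
apply: (@le_trans _ _ (\sum_(0 <= j < n) \sum_(N < M)
    (1 - q)^-1 * ((q ^+ N)^-1 * (w j * sqmod (P N j t))))).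
  apply: ler_sum => j _; rewrite -mulr_sumr.
  apply: le_trans (ler_wpM2l (ltW (w0 j)) (cs j)) _.
  rewrite mulrCA ler_pM2l ?invr_gt0// mulr_sumr.
  by apply: ler_sum => N _; rewrite mulrCA.
rewrite exchange_big /=; apply: (@le_trans _ _ (\sum_(N < M) (1 - q)^-1 * (q ^+ N * B))).
  apply: ler_sum => N _; rewrite -!mulr_sumr ler_pM2l ?invr_gt0//.
  rewrite ler_pdivrMl ?exprn_gt0// mulrA -exprD addnn -mul2n exprM.
  exact: hP.
rewrite -mulr_sumr -mulr_suml mulrA ler_wpM2r// expr2 invfM.
by rewrite ler_pM2l ?invr_gt0// geometric_partial_le.
Qed.

(** The constants C_j need not be bounded in j: with n fixed the error vanishes as M grows, and what
    remains is [sum_pieces_le], which is uniform in n and t. *)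
Lemma weighted_limit_le (z : nat -> R[i]) (t : R) (C : nat -> R) :
  (forall j M, sqmod (z j - \sum_(N < M) P N j t) <= (q ^+ 2) ^+ M * C j) ->
  forall n, \sum_(0 <= j < n) w j * sqmod (z j) <= 2 * ((1 - q) ^- 2 * B).
Proof.
move=> hz n; rewrite -subr_le0.
have qq : q ^+ 2 < 1 by rewrite expr_lt1// ltW.
apply: (@le0_geometric _ _ (q ^+ 2) (2 * \sum_(0 <= j < n) w j * C j)) => //.
  exact: sqr_ge0.
move=> M; rewrite lerBlDr.
have -> : (q ^+ 2) ^+ M * (2 * \sum_(0 <= j < n) w j * C j) + 2 * ((1 - q) ^- 2 * B) =
  2 * (\sum_(0 <= j < n) w j * ((q ^+ 2) ^+ M * C j)) + 2 * ((1 - q) ^- 2 * B).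
  congr (_ + _); rewrite mulrCA; congr (2 * _); rewrite mulr_sumr; apply: eq_bigr => j _.
  by rewrite mulrCA.
apply: (@le_trans _ _ (2 * (\sum_(0 <= j < n) w j * sqmod (z j - \sum_(N < M) P N j t)) +
   2 * (\sum_(0 <= j < n) w j * sqmod (\sum_(N < M) P N j t)))); last first.
  apply: lerD; rewrite ler_pM2l//; last exact: sum_pieces_le.
  by apply: ler_sum => j _; rewrite ler_pM2l.
rewrite -!mulrDr -big_split mulr_sumr /=; apply: ler_sum => j _.
rewrite -mulrDr mulrCA ler_pM2l// mulrDr.
by have := sqmodD_le (z j - \sum_(N < M) P N j t) (\sum_(N < M) P N j t); rewrite subrK.
Qed.

(** Used with m = 0 and e a bound for [eps], to dominate the whole density, and with m large and e
    small, to get tails that are uniform in t. *)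
Lemma weighted_series_tail (y : nat -> R) (A : R) (e : R) (m : nat) :
  (forall j, 0 <= y j) -> (forall n, \sum_(0 <= j < n) w j * y j <= A) ->
  0 <= e -> (forall j, (m <= j)%N -> eps j <= e) ->
  cvgn (series (fun j => lam j * y j)) /\
  `|limn (series (fun j => lam j * y j)) - \sum_(0 <= j < m) lam j * y j| <= e * A.
Proof.
move=> y0 yA e0 em.
have A0 : 0 <= A by have := yA 0%N; rewrite big_nil.
have tail a b : (m <= a)%N -> (a <= b)%N -> \sum_(a <= j < b) `|lam j * y j| <= e * A.
  move=> ma ab; apply: (@le_trans _ _ (\sum_(a <= j < b) e * (w j * y j))).
    rewrite big_nat [leRHS]big_nat; apply: ler_sum => j /andP[aj _].
    rewrite normrM [X in _ * X]ger0_norm// mulrA ler_wpM2r//.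
    apply: (le_trans (lw j)); rewrite ler_pM2r//; exact: em (leq_trans ma aj).
  rewrite -mulr_sumr ler_wpM2l//; apply: le_trans (yA b).
  rewrite [leRHS](big_cat_nat (n := a)) //= lerDr; apply: sumr_ge0 => j _.
  by rewrite mulr_ge0// ltW.
have cv : cvgn (series (fun j => lam j * y j)).
  apply: normed_cvg; apply: (@cvg_bounded_partial _
    (\sum_(0 <= j < m) `|lam j * y j| + e * A)) => n /=; first exact: normr_ge0.
  have [nm|mn] := leqP n m.
    apply: (@le_trans _ _ (\sum_(0 <= j < m) `|lam j * y j|)).
      by rewrite [leRHS](big_cat_nat (n := n)) //= lerDl sumr_ge0.
    by rewrite lerDl mulr_ge0.
  by rewrite (big_cat_nat (n := m)) //= ?(ltnW mn)// lerD2l tail// ltnW.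
split => //.
have cl : `|series (fun j => lam j * y j) n - \sum_(0 <= j < m) lam j * y j| @[n --> \oo] -->
    `|limn (series (fun j => lam j * y j)) - \sum_(0 <= j < m) lam j * y j|.
  by apply: cvg_norm; apply: cvgB => //; exact: cvg_cst.
apply: (@cvg_ler R _ _ _ m cl) => n mn.
have -> : series (fun j => lam j * y j) n - \sum_(0 <= j < m) lam j * y j =
    \sum_(m <= j < n) lam j * y j.
  by rewrite /series /= (big_cat_nat (n := m)) //= addrAC subrr add0r.
by apply: (le_trans (ler_norm_sum _ _ _)); exact: tail.
Qed.

Hypothesis cP : forall N j, continuous (fun t => complex.Re (P N j t)) /\
  continuous (fun t => complex.Im (P N j t)).

Lemma uniform_limit_continuous (u : nat -> R -> R) (l : R -> R) (C : R) :
  (forall M, continuous (u M)) -> (forall M t, `|l t - u M t| <= q ^+ M * C) ->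
  continuous l.
Proof.
move=> cu lu t; apply/cvgrPdist_lt => e e0.
have C0 : 0 <= C by have := lu 0%N 0; rewrite expr0 mul1r; apply: le_trans.
have [M hM] : exists M, q ^+ M * C < e / 3.
  have : q ^+ M * C @[M --> \oo] --> 0 * C.
    apply: cvgM; last exact: cvg_cst.
    by apply: cvg_expr; rewrite gtr0_norm.
  rewrite mul0r => /cvgrPdist_lt/(_ (e / 3)); rewrite divr_gt0// => /(_ isT)[M _ h].
  exists M; have := h M (leqnn M); rewrite /= sub0r normrN ger0_norm//.
  by rewrite mulr_ge0// exprn_ge0// ltW.
have /cvgrPdist_lt/(_ (e / 3)) := cu M t; rewrite divr_gt0// => /(_ isT).
apply: filterS => r hr.
have h1 := lu M t; have h2 := lu M r.
have -> : l t - l r = (l t - u M t) + (u M t - u M r) + (u M r - l r) by ring.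
apply: (le_lt_trans (ler_normD _ _)); rewrite distrC in h2.
have := ler_normD (l t - u M t) (u M t - u M r); lra.
Qed.

(** For each j the bands converge uniformly in t, at a rate involving B / w_j and hence not uniform
    in j. Uniformity of the sum over j comes from the weighted bound and the decay of [eps]. *)
Lemma uniform_summation : exists z : nat -> R -> R[i],
  (forall j t M, sqmod (z j t - \sum_(N < M) P N j t) <=
     (q ^+ 2) ^+ M * ((1 - q) ^- 2 * (B / w j))) /\
  exists2 rho : R -> R, forall t, series (fun j => lam j * sqmod (z j t)) @ \oo --> rho t &
    continuous rho.
Proof.
(* One term of the weighted sum; dividing by w_j is why the weights are taken strictly positive. *)
have single N j t : sqmod (P N j t) <= (q ^+ 2) ^+ N * (B / w j).
  rewrite mulrA ler_pdivlMr// mulrC; apply: le_trans (hP N j.+1 t).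
  rewrite big_nat_recr //= lerDr; apply: sumr_ge0 => i _.
  by rewrite mulr_ge0 ?sqmod_ge0// ltW.
pose b j := Num.sqrt (B / w j); have b0 j : 0 <= b j by exact: sqrtr_ge0.
have Bw j : 0 <= B / w j by rewrite divr_ge0// ltW.
have nP N j t : normc (P N j t) <= q ^+ N * b j.
  rewrite -(@ler_pXn2r _ 2) ?nnegrE ?normc_ge0 ?mulr_ge0 ?exprn_ge0 ?(ltW q0)//.
  by rewrite -sqmodE exprMn sqr_sqrtr// exprAC; exact: single.
have rP N j t : `|complex.Re (P N j t)| <= b j * q ^+ N /\ `|complex.Im (P N j t)| <= b j * q ^+ N.
  rewrite mulrC; split; apply: le_trans (nP N j t); rewrite normcE -sqrtr_sqr ler_sqrt ?sqmod_ge0//.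
    exact: Re_le_sqmod.
  exact: Im_le_sqmod.
have cvs (u : nat -> R) c : 0 <= c -> (forall m, `|u m| <= c * q ^+ m) -> cvgn (series u).
  move=> c0 ub; apply: normed_cvg; apply: (@series_le_cvg _ _ (geometric c q)).
  - by move=> n /=.
  - by move=> n /=; rewrite mulr_ge0 ?exprn_ge0 ?(ltW q0).
  - by move=> n /=; exact: ub.
  - by apply: is_cvg_geometric_series; rewrite gtr0_norm.
pose zr j t := limn (series (fun N => complex.Re (P N j t))).
pose zi j t := limn (series (fun N => complex.Im (P N j t))).
have cr j t : cvgn (series (fun N => complex.Re (P N j t))).
  by apply: (cvs _ (b j)) => // m; have [] := rP m j t.
have ci j t : cvgn (series (fun N => complex.Im (P N j t))).
  by apply: (cvs _ (b j)) => // m; have [] := rP m j t.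
pose z j t := (zr j t +i* zi j t)%C.
pose S M j t := \sum_(N < M) P N j t.
have SE M j t : S M j t = (series (fun N => complex.Re (P N j t)) M +i*
    series (fun N => complex.Im (P N j t)) M)%C.
  by apply: complexP; rewrite ?Re_sum ?Im_sum /series /= big_mkord.
have step M k j t : normc (S (k + M)%N j t - S M j t) <= q ^+ M * b j * (1 - q ^+ k) / (1 - q).
  elim: k => [|k IH]; first by rewrite subrr normcE sqmod0 sqrtr0 expr0 subrr mulr0 mul0r.
  rewrite addSn /S big_ord_recr /= -/(S _ j t) addrAC.
  apply: (le_trans (le_normcD _ _)).
  have := nP (k + M)%N j t; rewrite exprD.
  have -> : q ^+ M * b j * (1 - q ^+ k.+1) / (1 - q) =
    q ^+ M * b j * (1 - q ^+ k) / (1 - q) + q ^+ k * q ^+ M * b j.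
    by rewrite exprS; field; rewrite subr_eq0 gt_eqF.
  by move=> h1; apply: lerD.
have tail M m j t : (M <= m)%N -> sqmod (S m j t - S M j t) <= (q ^+ 2) ^+ M * ((1 - q) ^- 2 * (B / w j)).
  move=> Mm; rewrite -(subnK Mm) sqmodE.
  apply: (@le_trans _ _ ((q ^+ M * b j / (1 - q)) ^+ 2)).
    rewrite ler_pXn2r ?nnegrE ?normc_ge0 ?mulr_ge0 ?invr_ge0 ?exprn_ge0 ?(ltW q0) ?(ltW q10)//.
    apply: (le_trans (step _ _ _ _)); rewrite ler_pM2r ?invr_gt0// ler_piMr ?mulr_ge0 ?exprn_ge0 ?(ltW q0)//.
    by rewrite gerBl exprn_ge0// ltW.
  rewrite -(sqr_sqrtr (Bw j)) -/(b j) exprAC le_eqVlt; apply/orP; left; apply/eqP.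
  by field; rewrite subr_eq0 gt_eqF.
have zS j t M : sqmod (z j t - S M j t) <= (q ^+ 2) ^+ M * ((1 - q) ^- 2 * (B / w j)).
  have lim : sqmod (S m j t - S M j t) @[m --> \oo] --> sqmod (z j t - S M j t).
    under eq_fun do rewrite SE.
    rewrite /sqmod !ReD !ImD; apply: cvgD.
      under eq_fun do rewrite ReD.
      by rewrite !expr2; apply: cvgM; (apply: cvgD; [exact: cr|exact: cvg_cst]).
    under eq_fun do rewrite ImD.
    by rewrite !expr2; apply: cvgM; (apply: cvgD; [exact: ci|exact: cvg_cst]).
  by apply: cvg_ler lim _ => m; exact: tail.
exists z; split => //.
have czr j : continuous (zr j) /\ continuous (zi j).
  have bound t M : normc (z j t - S M j t) <= q ^+ M * (b j / (1 - q)).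
    rewrite -(@ler_pXn2r _ 2) ?nnegrE ?normc_ge0 ?mulr_ge0 ?exprn_ge0 ?invr_ge0 ?(ltW q0) ?(ltW q10)//.
    rewrite -sqmodE; apply: le_trans (zS j t M) _.
    rewrite -(sqr_sqrtr (Bw j)) -/(b j) exprAC le_eqVlt; apply/orP; left; apply/eqP.
    by field; rewrite subr_eq0 gt_eqF.
  split.
    apply: (@uniform_limit_continuous (fun M t => complex.Re (S M j t)) _ (b j / (1 - q))).
      move=> M; rewrite /S; under eq_fun do rewrite Re_sum.
      by apply: (@continuous_sumr _ _ (fun (N : 'I_M) t => complex.Re (P N j t))) => N; exact: (cP N j).1.
    move=> M t; apply: le_trans (bound t M); rewrite normcE -sqrtr_sqr ler_sqrt ?sqmod_ge0//.
    by have := Re_le_sqmod (z j t - S M j t); rewrite ReD ReN.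
  apply: (@uniform_limit_continuous (fun M t => complex.Im (S M j t)) _ (b j / (1 - q))).
    move=> M; rewrite /S; under eq_fun do rewrite Im_sum.
    by apply: (@continuous_sumr _ _ (fun (N : 'I_M) t => complex.Im (P N j t))) => N; exact: (cP N j).2.
  move=> M t; apply: le_trans (bound t M); rewrite normcE -sqrtr_sqr ler_sqrt ?sqmod_ge0//.
  by have := Im_le_sqmod (z j t - S M j t); rewrite ImD ImN.
have cz j : continuous (fun t => sqmod (z j t)).
  move=> t; rewrite /sqmod /=; apply: cvgD; rewrite expr2; under eq_fun do rewrite expr2.
    by apply: cvgM; exact: (czr j).1.
  by apply: cvgM; exact: (czr j).2.
pose A := 2 * ((1 - q) ^- 2 * B).
have A0 : 0 <= A by rewrite !mulr_ge0// invr_ge0 sqr_ge0.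
have wz t n : \sum_(0 <= j < n) w j * sqmod (z j t) <= A.
  exact: (@weighted_limit_le (z ^~ t) t (fun j => (1 - q) ^- 2 * (B / w j)) (fun j M => zS j t M)).
pose rho t := limn (series (fun j => lam j * sqmod (z j t))).
have small e : 0 < e -> exists m, forall j, (m <= j)%N -> eps j <= e.
  move=> e0; have /cvgrPdist_lt/(_ e e0)[m _ h] := eps0.
  exists m => j mj; have := h j mj; rewrite /= sub0r normrN => /ltW; apply: le_trans.
  exact: ler_norm.
have y0 t j : 0 <= sqmod (z j t) by exact: sqmod_ge0.
exists rho.
  move=> t; have [m hm] := small 1 ltr01.
  by have [] := weighted_series_tail (y0 t) (wz t) ler01 hm.
move=> t; apply/cvgrPdist_lt => e e0.
(* The tails at both times are then below e / 3, and the finite head is continuous. A + 1 keeps the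
   denominator positive when A = 0. *)
pose e' := e / (3 * (A + 1)); have e'0 : 0 < e' by rewrite divr_gt0// mulr_gt0// ltr_wpDl.
have [m hm] := small e' e'0.
have eA : e' * A < e / 3.
  rewrite /e' mulrAC ltr_pdivrMr; last by rewrite mulr_gt0// ltr_wpDl.
  have -> : e / 3 * (3 * (A + 1)) = e * (A + 1) by field.
  by rewrite ltr_pM2l// ltrDl.
have cs : continuous (fun t => \sum_(0 <= j < m) lam j * sqmod (z j t)).
  apply: (@continuous_sumr _ _ (fun j t => lam j * sqmod (z j t))) => j r.
  by apply: cvgM; [exact: cvg_cst|exact: cz].
have /cvgrPdist_lt/(_ (e / 3)) := cs t; rewrite divr_gt0// => /(_ isT).
apply: filterS => r hr.
have [_ h1] := weighted_series_tail (y0 t) (wz t) (ltW e'0) hm.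
have [_ h2] := weighted_series_tail (y0 r) (wz r) (ltW e'0) hm.
move: h1 h2 hr; rewrite -/(rho t) -/(rho r).
move: (\sum_(0 <= j < m) _) (\sum_(0 <= j < m) _) => c a h1 h2 hr.
have -> : rho t - rho r = (rho t - a) + (a - c) + (c - rho r) by ring.
apply: (le_lt_trans (ler_normD _ _)); rewrite distrC in h2.
have := ler_normD (rho t - a) (a - c); lra.
Qed.

End UniformSummation.

(** * Pointwise values and representatives as limits of band sums *)

Section PointwiseValues.
Variables (R : realType) (d : nat) (eta1 : R -> R) (s : R).
Hypothesis eta_zero : forall z, 2 <= `|z| -> eta1 z = 0.
Implicit Types (u : dist R d) (x : d.-tuple R) (t : R).

Definition band_piece u N t x : R[i] :=
  wavepacket (2 ^ N.+1) (band_multiplier eta1 s N) u t x.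

Lemma band_piece_trigsum u N t x :
  band_piece u N t x = trigsum (box d (2 ^ N.+1))
    (fun k => (band_multiplier eta1 s N k)%:C%C * u k * cexp (t * sqnorm R k)) x.
Proof. by apply: eq_bigr => k _; rewrite cexpD mulrA. Qed.

Lemma sum_band_pieces u m t x :
  \sum_(N < m.+1) band_piece u N t x = trigsum (box d (2 ^ m.+1))
    (fun k => (lowpass eta1 m k)%:C%C * schrod t (bessel (- s) u) k) x.
Proof.
transitivity (\sum_(N < m.+1) \sum_(k <- box d (2 ^ m.+1))
    (band_multiplier eta1 s N k)%:C%C * u k * cexp (t * sqnorm R k + dotp k x)).
  apply: eq_bigr => N _; rewrite /band_piece /wavepacket.
  rewrite [RHS](@big_subset_splitC R d (box d (2 ^ N.+1))) ?box_uniq//; last first.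
    move=> k; apply: box_le;
    rewrite leq_pexp2l// ltn_ord.
  rewrite [X in _ + X](_ : _ = 0) ?addr0// big_seq big1// => k; rewrite mem_filter => /andP[kN _].
  by rewrite /band_multiplier bandpass_eq0// mul0r !mul0r.
rewrite exchange_big; apply: eq_bigr => k _ /=.
rewrite -!mulr_suml -rmorph_sum /band_multiplier -mulr_suml sum_bandpass.
rewrite /schrod /bessel cexpD rmorphM /=.
move: (lowpass _ _ _)%:C%C (_ `^ _)%:C%C (u k) (cexp _) (cexp _) => a b c e f.
by ring.
Qed.

(** The index shifts by one: the cutoff at scale 2^m comprises the m + 1 bands from 0 to m. *)
Lemma fsbig_cutoff u m t x :
  \sum_(k \in [set: d.-tuple int])
      (\prod_(i < d) eta1 ((tnth k i)%:~R / 2 ^+ m))%:C%C *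
      cexp (dotp k x) * schrod t (bessel (- s) u) k =
  \sum_(N < m.+1) band_piece u N t x.
Proof.
rewrite sum_band_pieces.
transitivity (\sum_(k \in [set` box d (2 ^ m.+1)])
   (lowpass eta1 m k)%:C%C * schrod t (bessel (- s) u) k * cexp (dotp k x)).
  under eq_fsbigr do rewrite mulrAC.
  apply/esym/fsbig_widen => //= k [_ /= kN].
  by rewrite -/(lowpass eta1 m k) lowpass_eq0 ?mul0r//; apply/negP.
by rewrite -fsbig_seq ?box_uniq.
Qed.

Lemma pointwise_value_band u t x (z : R[i]) (q B : R) : 0 < q -> q < 1 ->
  (forall M, sqmod (z - \sum_(N < M) band_piece u N t x) <= (q ^+ 2) ^+ M * B) ->
  pointwise_value eta1 (schrod t (bessel (- s) u)) x z.
Proof.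
move=> q0 q1 hz; rewrite /pointwise_value.
under eq_fun do rewrite fsbig_cutoff.
apply/cvgrPdist_lt => e e0.
(* In the order on complex numbers a positive element is real. *)
have [er epos] : e = (complex.Re e)%:C%C /\ 0 < complex.Re e.
  by move: e0; case: (e) => a b; rewrite ltcE /= => /andP[/eqP -> ->].
have B0 : 0 <= B by have := hz 0%N; rewrite expr0 mul1r; apply: le_trans; exact: sqmod_ge0.
have qq : q ^+ 2 < 1 by rewrite expr_lt1// ltW.
have lim0 : (q ^+ 2) ^+ m.+1 * B @[m --> \oo] --> 0.
  rewrite -[X in _ --> X](mul0r B); apply: cvgM; last exact: cvg_cst.
  have : (q ^+ 2) ^+ m @[m --> \oo] --> 0 by apply: cvg_expr; rewrite ger0_norm ?sqr_ge0.
  by rewrite -(cvg_shiftS (fun m => (q ^+ 2) ^+ m)).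
have /cvgrPdist_lt/(_ (complex.Re e ^+ 2)) := lim0.
rewrite exprn_gt0// => /(_ isT); apply: filterS => m.
rewrite sub0r normrN => /(le_lt_trans (ler_norm _))/(le_lt_trans (hz m.+1)) h.
rewrite er normc_def ltcR -/(sqmod _) -(@ltr_pXn2r _ 2) ?nnegrE ?sqrtr_ge0 ?(ltW epos)//.
by rewrite sqr_sqrtr// sqmod_ge0.
Qed.

End PointwiseValues.

Section LimitRepresentative.
Variables (R : realType) (d : nat) (eta1 : R -> R) (s q : R) (S : d.-tuple R -> R).
Hypothesis eta_one : forall z, `|z| <= 1 -> eta1 z = 1.
Hypothesis eta_zero : forall z, 2 <= `|z| -> eta1 z = 0.
Hypotheses (q0 : 0 < q) (q1 : q < 1).
Local Notation mu := (torus R d).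
Local Notation intR f := (mu.-integrable setT (EFin \o f)).
Hypothesis S0 : forall x, 0 <= S x.
Hypothesis iS : intR S.

(** [L2repr] is an arbitrary choice, so its values are known only through its Fourier coefficients.
    The almost everywhere limit of the band sums has the same coefficients and therefore agrees with
    it almost everywhere. *)
Lemma L2repr_band_limit (u : dist R d) (t w : R) : 0 < w ->
  {ae mu, forall x, forall N, sqmod (band_piece eta1 s u N t x) <= (q ^+ 2) ^+ N * (S x / w)} ->
  let v := schrod t (bessel (- s) u) in
  inL2 v /\ {ae mu, forall x, forall M,
    sqmod (L2repr v x - \sum_(N < M) band_piece eta1 s u N t x) <=
    (q ^+ 2) ^+ M * ((1 - q)^-2 * (S x / w))}.
Proof.
move=> w0 hS v.
have Sw0 x : 0 <= S x / w by rewrite divr_ge0// ltW.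
have iSw : intR (fun x => (1 - q)^-2 * (S x / w)).
  apply: intR_Z; rewrite (_ : (fun x => S x / w) = fun x => w^-1 * S x); last first.
    by apply/funext => x; rewrite mulrC.
  exact: intR_Z.
have L2p N : L2fun (band_piece eta1 s u N t).
  by under [X in L2fun X]funext do rewrite band_piece_trigsum; exact: L2fun_trigsum.
have mp N : cmeasurable (band_piece eta1 s u N t) by have /L2funP[] := L2p N.
have [G [mG hG]] := geometric_series_limit q0 q1 mp Sw0 hS.
have iG M : intR (fun x => sqmod (G x - \sum_(N < M) band_piece eta1 s u N t x)) /\
    \int[mu]_x sqmod (G x - \sum_(N < M) band_piece eta1 s u N t x) <=
    (q ^+ 2) ^+ M * \int[mu]_x ((1 - q)^-2 * (S x / w)).
  have mD : measurable_fun setT (fun x => sqmod (G x - \sum_(N < M) band_piece eta1 s u N t x)).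
    apply: measurable_sqmod; apply: cmeasurableD => //.
    under [X in cmeasurable X]funext do rewrite -mulN1r.
    by apply: cmeasurableM; [exact: cmeasurable_cst|exact: cmeasurable_sum].
  have K0 x : 0 <= (q ^+ 2) ^+ M * ((1 - q)^-2 * (S x / w)).
    apply: mulr_ge0; first by apply: exprn_ge0; exact: sqr_ge0.
    by apply: mulr_ge0 => //; rewrite invr_ge0; exact: sqr_ge0.
  have iD : intR (fun x => sqmod (G x - \sum_(N < M) band_piece eta1 s u N t x)).
    apply: (@intR_ae _ _ _ _ _ (fun x => (q ^+ 2) ^+ M * ((1 - q)^-2 * (S x / w)))) => //.
    - exact: intR_Z.
    - by apply: filterS hG => x h; rewrite ger0_norm ?sqmod_ge0.
  split => //; have iSq := intR_Z ((q ^+ 2) ^+ M) iSw.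
  rewrite -RintegralZl// -lee_fin !EFin_Rintegral//.
  apply: ae_ge0_le_integral => //.
  - by move=> x _; rewrite lee_fin sqmod_ge0.
  - exact/measurable_EFinP.
  - by move=> x _; rewrite lee_fin; exact: K0.
  - by have /integrableP[] := iSq.
  - by apply: filterS hG => x h _; rewrite lee_fin.
have L2G : L2fun G.
  apply/L2funP; split => //; have [iG0 _] := iG 0%N.
  by apply: eq_integrable iG0 => // x _ /=; rewrite big_ord0 subr0.
have L2D M : L2fun (fun x => G x - \sum_(N < M) band_piece eta1 s u N t x).
  under [X in L2fun X]funext do rewrite -mulN1r.
  by apply: L2funD => //; apply: L2funZ; exact: L2fun_sum.
have fG : fourier G = v.
  apply/funext => k; apply/eqP; rewrite -subr_eq0; apply/eqP/sqmod_eq0/eqP.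
  rewrite eq_le sqmod_ge0 andbT.
  (* Once the bands reach the frequency k, the smoothed partial sum has exactly the coefficient
     [v k], so the k-th coefficient of the remainder is the difference to be shown zero. *)
  have [K hK] := box_exhaust k.
  apply: (@le0_geometric _ _ (q ^+ 2)
     ((q ^+ 2) ^+ K.+1 * \int[mu]_x ((1 - q)^-2 * (S x / w)))).
  - exact: sqr_ge0.
  - by rewrite expr_lt1// ltW.
  move=> n; rewrite mulrA -exprD; apply: le_trans (iG (n + K.+1)%N).2.
  rewrite -nsqE//; apply: le_trans (sqmod_le_nsq k (inL2_fourier (L2D _))).
  have -> : fourier G k - v k =
     fourier (fun x => G x - \sum_(N < n + K.+1) band_piece eta1 s u N t x) k.
    rewrite (_ : (fun x => _ - _) = fun x => G x +
        (-1) * \sum_(N < n + K.+1) band_piece eta1 s u N t x); last first.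
      by apply/funext => x; rewrite mulN1r.
    rewrite fourierD ?fourierZ//; [|exact: L2fun_sum|by apply: L2funZ; exact: L2fun_sum].
    rewrite mulN1r addnS; congr (_ - _).
    rewrite (_ : (fun x => _) = trigsum (box d (2 ^ (n + K).+1)) (fun k =>
        (lowpass eta1 (n + K) k)%:C%C * v k)); last first.
      by apply/funext => x; rewrite -sum_band_pieces.
    rewrite fourier_trigsum sum_character ?box_uniq//.
    have kb : k \in box d (2 ^ (n + K)) by apply: box_le hK; rewrite leq_pexp2l// leq_addl.
    rewrite (_ : k \in box d _) ?lowpass_eq1 ?mul1r//.
    by apply: box_le kb; rewrite leq_pexp2l.
  by [].
split; first by rewrite -fG; exact: inL2_fourier.
have := L2repr_ae L2G; rewrite fG; apply: filterS2 hG => x h -> M; exact: h.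
Qed.

End LimitRepresentative.

Section SquareIntegrableDensity.
Variables (R : realType) (d : nat) (eta1 : R -> R) (s q : R) (S : d.-tuple R -> R).
Hypothesis eta_one : forall z, `|z| <= 1 -> eta1 z = 1.
Hypothesis eta_zero : forall z, 2 <= `|z| -> eta1 z = 0.
Hypotheses (q0 : 0 < q) (q1 : q < 1).
Local Notation mu := (torus R d).
Local Notation intR f := (mu.-integrable setT (EFin \o f)).
Hypothesis S0 : forall x, 0 <= S x.
Hypotheses (iS : intR S) (iS2 : intR (fun x => S x ^+ 2)).
Variables (w lam eps : nat -> R) (f : nat -> dist R d) (E : R).
Hypothesis w0 : forall j, 0 < w j.
Hypothesis lw : forall j, `|lam j| <= eps j * w j.
Hypothesis epsE : forall j, eps j <= E.
Hypothesis hS : {ae mu, forall x, forall N n t,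
  \sum_(0 <= j < n) w j * sqmod (band_piece eta1 s (f j) N t x) <= (q ^+ 2) ^+ N * S x}.

Lemma Lnorm2_cvg0 (h : nat -> d.-tuple R -> R) :
  (forall n, intR (fun x => h n x ^+ 2)) ->
  \int[mu]_x (h n x ^+ 2) @[n --> \oo] --> 0 ->
  (Lnorm mu 2%:E (fun x => (h n x)%:E) @[n --> \oo] --> 0)%E.
Proof.
move=> ih h0.
have e n : Lnorm mu 2%:E (fun x => (h n x)%:E) = (Num.sqrt (\int[mu]_x (h n x ^+ 2)))%:E.
  rewrite unlock /Lnorm.
  under eq_integral => x _.
    rewrite /= powR_mulrn// -normrX ger0_norm ?sqr_ge0//.
    over.
  by rewrite -EFin_Rintegral// poweR_EFin powR12_sqrt//; apply: Rintegral_ge0 => x _; exact: sqr_ge0.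
under eq_fun do rewrite e; apply: cvg_EFin; first by near=> n.
rewrite -[X in _ --> X]sqrtr0; apply: (@cvg_comp _ _ _ _ (@Num.sqrt R)); first exact: h0.
exact: sqrt_continuous.
Unshelve. all: by end_near. Qed.

(** Dominated convergence: the partial sums and their limit are bounded almost everywhere by a
    constant times S, and S^2 is integrable. *)
Lemma density_well_defined_evolution (t : R) :
  density_well_defined lam (fun j => schrod t (bessel (- s) (f j))).
Proof.
have single j : {ae mu, forall x, forall N,
    sqmod (band_piece eta1 s (f j) N t x) <= (q ^+ 2) ^+ N * (S x / w j)}.
  apply: filterS hS => x h N; rewrite mulrA ler_pdivlMr// mulrC; apply: le_trans (h N j.+1 t).
  rewrite big_nat_recr //= lerDr; apply: sumr_ge0 => i _.
  by rewrite mulr_ge0 ?sqmod_ge0// ltW.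
have lim j := L2repr_band_limit eta_one eta_zero q0 q1 S0 iS (w0 j) (single j).
pose g j x := sqmod (L2repr (schrod t (bessel (- s) (f j))) x).
have mg j : measurable_fun setT (g j).
  by apply: measurable_sqmod; have [/L2reprP[/L2funP[]]] := lim j.
pose A x := 2 * ((1 - q)^-2 * S x).
have A0 x : 0 <= A x by rewrite mulr_ge0// mulr_ge0// invr_ge0 sqr_ge0.
have E0 : 0 <= E by apply: le_trans (epsE 0); rewrite -(@pmulr_lge0 _ (w 0%N))//; exact: le_trans (lw _).
have g0 x j : 0 <= g j x by exact: sqmod_ge0.
have wg : {ae mu, forall x, forall n, \sum_(0 <= j < n) w j * g j x <= A x}.
  have /ae_forall_nat limx : forall j, _ := fun j => (lim j).2.
  apply: filterS2 hS limx => x hx lx n.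
  exact: (@weighted_limit_le _ (fun N j t => band_piece eta1 s (f j) N t x) w q (S x)
     q0 q1 w0 hx (fun j => L2repr (schrod t (bessel (- s) (f j))) x) t
     (fun j => (1 - q)^-2 * (S x / w j)) lx).
pose p n x := density_partial lam (fun j => schrod t (bessel (- s) (f j))) n x.
have pE n x : p n x = \sum_(0 <= j < n) lam j * g j x by rewrite /p /density_partial big_mkord.
have mp n : measurable_fun setT (p n).
  rewrite (_ : p n = fun x => \sum_(0 <= j < n) lam j * g j x); last exact/funext.
  by apply: measurable_sum => j; apply: measurable_funM.
(* The upper limit exists at every point and is measurable; almost everywhere it is the limit. *)
pose rho x := fine (limn_esup (fun n => (p n x)%:E)).
have mrho : measurable_fun setT rho.
  apply: measurableT_comp => //; apply: measurable_fun_limn_esup => n.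
  exact/measurable_EFinP.
have tail : {ae mu, forall x, (p ^~ x @ \oo --> rho x) /\ (`|rho x| <= E * A x) /\
    (forall n, `|p n x| <= E * A x)}.
  apply: filterS wg => x wx.
  have [cv] := @weighted_series_tail _ w lam eps w0 lw (g ^~ x) (A x) E 0%N (g0 x) wx E0 (fun j _ => epsE j).
  rewrite big_geq// subr0 => le.
  have pl : p ^~ x @ \oo --> limn (series (fun j => lam j * g j x)).
    rewrite (_ : p ^~ x = series (fun j => lam j * g j x)) //.
    by apply/funext => n; rewrite pE.
  have rl : rho x = limn (series (fun j => lam j * g j x)).
    rewrite /rho is_cvg_limn_esupE; last first.
      by apply/cvg_ex; eexists; apply: cvg_EFin pl; exact: nearW.
    by rewrite (cvg_lim _ (cvg_EFin _ pl))//; exact: nearW.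
  rewrite rl; split => //; split => // n; rewrite pE.
  apply: (le_trans (ler_norm_sum _ _ _)).
  apply: (@le_trans _ _ (\sum_(0 <= j < n) E * (w j * g j x))).
    apply: ler_sum => j _; rewrite normrM [X in _ * X]ger0_norm// mulrA ler_wpM2r//.
    by apply: le_trans (lw j) _; rewrite ler_pM2r.
  by rewrite -mulr_sumr ler_wpM2l.
have iEA (c : R) : intR (fun x => c * S x ^+ 2) by exact: intR_Z.
(* K S^2 is the square of 2 E A, which dominates the difference of a partial sum and the limit. *)
pose K := (2 * E * (2 * (1 - q)^-2)) ^+ 2.
have K0 x : 0 <= K * S x ^+ 2 by rewrite mulr_ge0 ?sqr_ge0.
have dom (r : R) x : `|r| <= 2 * (E * A x) -> `|r ^+ 2| <= K * S x ^+ 2.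
  move=> h; rewrite normrX; apply: (@le_trans _ _ ((2 * (E * A x)) ^+ 2)).
    by apply: lerXn2r => //; rewrite nnegrE ?normr_ge0// mulr_ge0// mulr_ge0.
  by rewrite /K /A -exprMn; have -> : 2 * (E * (2 * ((1 - q) ^- 2 * S x))) = 2 * E * (2 / (1 - q) ^+ 2) * S x by ring.
have EA0 x : 0 <= E * A x by rewrite mulr_ge0.
have irho : intR (fun x => rho x ^+ 2).
  apply: (@intR_ae _ _ _ _ _ (fun x => K * S x ^+ 2)) => //.
    exact: measurable_funX.
  apply: filterS tail => x [_ [h _]]; apply: dom; apply: (le_trans h).
  by rewrite ler_peMl// ler1n.
have ip n : intR (fun x => p n x ^+ 2).
  apply: (@intR_ae _ _ _ _ _ (fun x => K * S x ^+ 2)) => //.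
    exact: measurable_funX.
  apply: filterS tail => x [_ [_ h]]; apply: dom; apply: (le_trans (h n)).
  by rewrite ler_peMl// ler1n.
split; first by move=> n; apply/Lfun2P; split; [exact: mp|exact: ip].
exists rho; first by apply/Lfun2P.
have id n : intR (fun x => (p n x - rho x) ^+ 2).
  apply: (@intR_ae _ _ _ _ _ (fun x => K * S x ^+ 2)) => //.
    by apply: measurable_funX; exact: measurable_funB.
  apply: filterS tail => x [_ [h1 h]]; apply: dom; apply: (le_trans (ler_normB _ _)).
  by have := h n; lra.
apply: (@Lnorm2_cvg0 (fun n x => p n x - rho x)) => //.
have [|||||_ h0] := @Rintegral_dominated _ _ _ mu (fun n x => (p n x - rho x) ^+ 2) (fun=> 0)
  (fun x => K * S x ^+ 2).
- by move=> n; apply: measurable_funX; exact: measurable_funB.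
- exact: measurable_cst.
- exact: iEA.
- apply: filterS tail => x [h _].
  have : (p n x - rho x) ^+ 2 @[n --> \oo] --> (rho x - rho x) ^+ 2.
    by rewrite expr2; under eq_fun do rewrite expr2; apply: cvgM; (apply: cvgB; [exact: h|exact: cvg_cst]).
  by rewrite subrr expr0n.
- apply: filterS tail => x [_ [h1 h]] n; apply: dom; apply: (le_trans (ler_normB _ _)).
  by have := h n; lra.
by move: h0; rewrite Rintegral_cst// mul0r.
Qed.

End SquareIntegrableDensity.

(** |lam| is factored as |lam|^(1 - alpha/2) times |lam|^(alpha/2). The second factor is square
    summable, and the first tends to 0 because alpha < 2. Adding 2^-j makes the weights positive
    without spoiling square summability. *)
Lemma summable_weights (R : realType) (lam : nat -> R) (alpha : R) :
  1 <= alpha -> alpha < 2 -> (\sum_(0 <= j <oo) (`|lam j| `^ alpha)%:E < +oo)%E ->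
  exists w eps : nat -> R, exists E W : R,
  [/\ forall j, 0 < w j, forall j, `|lam j| <= eps j * w j, forall j, eps j <= E,
      eps @ \oo --> 0 & forall n, \sum_(0 <= j < n) w j ^+ 2 <= W].
Proof.
move=> a1 a2; set T := (\sum_(0 <= j <oo) _)%E => Tfin.
pose y j := `|lam j| `^ alpha; have y0 j : 0 <= y j by exact: powR_ge0.
have T0 : (0 <= T)%E by apply: nneseries_ge0 => j _ _; rewrite lee_fin.
have yT n : \sum_(0 <= j < n) y j <= fine T.
  rewrite -lee_fin fineK ?ge0_fin_numE// -sumEFin.
  by apply: nneseries_lim_ge => j _ _; rewrite lee_fin.
have cy : y @ \oo --> 0 by apply: cvg_series_cvg_0; exact: cvg_bounded_partial yT.
pose b := 1 - alpha / 2; have b0 : 0 < b by rewrite /b; lra.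
have lb j : `|lam j| `^ b = y j `^ (b / alpha).
  by rewrite /y -powRrM; congr (_ `^ _); field; lra.
have ba0 : 0 < b / alpha by rewrite divr_gt0//; lra.
pose v j := `|lam j| `^ (alpha / 2); have v0 j : 0 <= v j by exact: powR_ge0.
have v2 j : v j ^+ 2 = y j.
  by rewrite -powR_mulrn// -powRrM /y; congr (_ `^ _); lra.
pose w j := v j + 2^-1 ^+ j.
have h0 j : 0 < 2^-1 ^+ j :> R by rewrite exprn_gt0// invr_gt0.
exists w, (fun j => `|lam j| `^ b), ((fine T) `^ (b / alpha)), (2 * fine T + 2 * 2); split.
- by move=> j; apply: ltr_wpDl.
- move=> j; apply: (@le_trans _ _ (`|lam j| `^ b * v j)); last first.
    by rewrite ler_wpM2l ?powR_ge0// /w lerDl ltW.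
  rewrite /v -powRD; last by apply/implyP; rewrite /b => /eqP; lra.
  by rewrite (_ : b + _ = 1) ?powRr1// /b; lra.
- move=> j; rewrite /= lb; apply: ge0_ler_powR; rewrite ?nnegrE ?(ltW ba0)//.
    exact: fine_ge0.
  apply: le_trans (yT j.+1); rewrite big_nat_recr//= lerDr.
  by apply: sumr_ge0.
- apply/cvgrPdist_lt => e e0; have p0 : 0 < e `^ (b / alpha)^-1 by exact: powR_gt0.
  have /cvgrPdist_lt/(_ _ p0) := cy; apply: filterS => j; rewrite !sub0r !normrN.
  rewrite [X in X < _]ger0_norm ?powR_ge0// [X in _ -> X < _]ger0_norm ?powR_ge0// lb => yl.
  have -> : e = (e `^ (b / alpha)^-1) `^ (b / alpha).
    by rewrite -powRrM mulVf ?gt_eqF// powRr1// ltW.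
  by apply: gt0_ltr_powR; rewrite ?nnegrE ?powR_ge0.
- move=> n; have geo : \sum_(0 <= j < n) 2^-1 ^+ j <= 2 :> R.
    have := @geometric_partial_le R 2^-1; rewrite big_mkord.
    have -> : (1 - 2^-1)^-1 = 2 :> R by field.
    by apply; rewrite ?invr_gt0// invf_lt1// ltr1n.
  apply: (@le_trans _ _ (2 * \sum_(0 <= j < n) y j + 2 * \sum_(0 <= j < n) 2^-1 ^+ j)).
    rewrite 2!mulr_sumr -big_split /=; apply: ler_sum => j _; rewrite /w -v2.
    have : 2^-1 ^+ j <= 1 :> R by rewrite exprn_ile1// ?invr_ge0// invf_le1// ler1n.
    by move: (v j) (v0 j) (2^-1 ^+ j) (h0 j) => p p0 r r0 r1; have := sqr_ge0 (p - r); nra.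
  by apply: lerD; rewrite ler_pM2l.
Qed.

Section EvolutionDensity.
Variables (R : realType) (d : nat) (eta1 : R -> R) (s alpha : R).
Hypothesis d0 : (0 < d)%N.
Hypothesis hs : d%:R / 4 + d%:R / (2 * (d%:R + 2)) < s.
Hypotheses (alpha1 : 1 <= alpha) (alpha2 : alpha < 2).
Hypothesis ceta : cutoff eta1.

Lemma band_piece_continuous (u : dist R d) N x :
  continuous (fun t => complex.Re (band_piece eta1 s u N t x)) /\
  continuous (fun t => complex.Im (band_piece eta1 s u N t x)).
Proof.
have cc (a b : R) : continuous (fun t : R => cos (2 * pi * (t * a + b))) /\
    continuous (fun t : R => sin (2 * pi * (t * a + b))).
  have cl : continuous (fun t : R => 2 * pi * (t * a + b)).
    move=> t; apply: cvgM; first exact: cvg_cst.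
    apply: cvgD; last exact: cvg_cst.
    by apply: cvgM; [exact: cvg_id|exact: cvg_cst].
  by split=> t; apply: (@cvg_comp _ _ _ (fun t : R => 2 * pi * (t * a + b)));
    [exact: cl|exact: continuous_cos|exact: cl|exact: continuous_sin].
rewrite /band_piece /wavepacket; split.
  under eq_fun do rewrite Re_sum; apply: continuous_sumr => k t.
  under eq_fun do rewrite ReM; apply: cvgB; apply: cvgM; try exact: cvg_cst.
    exact: (cc _ _).1.
  exact: (cc _ _).2.
under eq_fun do rewrite Im_sum; apply: continuous_sumr => k t.
under eq_fun do rewrite ImM; apply: cvgD; apply: cvgM; try exact: cvg_cst.
  exact: (cc _ _).2.
exact: (cc _ _).1.
Qed.

Lemma evolution_density (lam : nat -> R) (f : nat -> dist R d) :
  (\sum_(0 <= j <oo) (`|lam j| `^ alpha)%:E < +oo)%E -> orthonormal_seq f ->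
  (forall t, density_well_defined lam (fun j => schrod t (bessel (- s) (f j)))) /\
  {ae torus R d, forall x, exists2 rho : R -> R,
     forall t, density_at eta1 lam (fun j => schrod t (bessel (- s) (f j))) x (rho t) &
     continuous rho}.
Proof.
move=> slam onf.
have [_ eta01 _ eta_one eta_zero] := ceta.
have s0 : 0 <= s.
  apply: ltW; apply: le_lt_trans hs.
  by apply: addr_ge0; apply: divr_ge0 => //; rewrite mulr_ge0// addr_ge0.
have [w [eps [E [W [w0 lw epsE eps0 wW]]]]] := summable_weights alpha1 alpha2 slam.
have w0' j := ltW (w0 j).
have [r [r0 r1 br]] := key_estimate eta01 eta_one s0 d0 hs onf w0' wW.
have [q [S [/andP[q0 q1] [iS iS2] S0 hS]]] := maximal_majorant r0 r1 w0' br.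
have dwd := density_well_defined_evolution eta_one eta_zero q0 q1 S0 iS iS2 w0 lw epsE hS.
split; first by move=> t; exact: dwd.
apply: filterS hS => x hx.
have [z [hz [rho hrho crho]]] := @uniform_summation R (fun N j t => band_piece eta1 s (f j) N t x)
  w lam eps q (S x) q0 q1 w0 lw eps0 hx (fun N j => band_piece_continuous (f j) N x).
exists rho => // t; exists (z ^~ t); last exact: hrho.
by move=> j; apply: (pointwise_value_band eta_zero q0 q1 (hz j t)).
Qed.

End EvolutionDensity.

(** * Spectral decomposition *)

Section FourierMultipliers.
Variables (R : realType) (d : nat).
Implicit Types (u v : dist R d) (s t : R).

Lemma contractive_multiplier (m : d.-tuple int -> R[i]) u :
  (forall k, sqmod (m k) <= 1) -> inL2 u ->
  inL2 (fun k => m k * u k) /\ nsq (fun k => m k * u k) <= nsq u.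
Proof.
move=> m1 iu; apply: riesz_fischer => r ur; apply: le_trans (bessel_characters ur iu).
by apply: ler_sum => k _; rewrite sqmodM ler_piMl ?sqmod_ge0.
Qed.

Lemma schrodK t : cancel (@schrod R d t) (schrod (- t)).
Proof.
move=> u; apply/funext => k; rewrite /schrod mulrA -cexpD mulNr addNr.
by rewrite cexp0 mul1r.
Qed.

Lemma schrod0 u : schrod 0 u = u.
Proof. by apply/funext => k; rewrite /schrod mul0r cexp0 mul1r. Qed.

Lemma inL2_schrod t u : inL2 u -> inL2 (schrod t u).
Proof. by move=> iu; apply: (contractive_multiplier _ iu).1 => k; rewrite sqmod_cexp. Qed.

(** The multipliers for t and -t are both contractions and inverse to each other. *)
Lemma nsq_schrod t u : inL2 u -> nsq (schrod t u) = nsq u.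
Proof.
have le r (v : dist R d) : inL2 v -> nsq (schrod r v) <= nsq v.
  by move=> iv; apply: (contractive_multiplier _ iv).2 => k; rewrite sqmod_cexp.
move=> iu; apply/eqP; rewrite eq_le le//= -{1}[u](schrodK t); apply: le.
exact: inL2_schrod.
Qed.

Lemma normL2_schrod t u : inL2 u -> normL2 (schrod t u) = normL2 u.
Proof. by move=> iu; rewrite /normL2 -/(nsq (schrod t u)) nsq_schrod. Qed.

(** Polarisation: real parts come from the norm of a sum, imaginary parts from real parts after
    multiplying v by -i. *)
Lemma dotL2_schrod t u v : inL2 u -> inL2 v ->
  dotL2 (schrod t u) (schrod t v) = dotL2 u v.
Proof.
have re (a b : dist R d) : inL2 a -> inL2 b ->
    complex.Re (dotL2 (schrod t a) (schrod t b)) = complex.Re (dotL2 a b).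
  move=> ia ib; have := nsq_schrod t (inL2D ia ib).
  rewrite (_ : schrod t (fun k => a k + b k) = fun k => schrod t a k + schrod t b k); last first.
    by apply/funext => k; rewrite /schrod mulrDr.
  by rewrite !nsqD ?nsq_schrod//; [lra|exact: inL2_schrod..].
move=> iu iv; apply: complexP; first exact: re.
have im (a b : dist R d) : inL2 a -> inL2 b ->
    complex.Im (dotL2 a b) = complex.Re (dotL2 a (fun k => (- 'i)%C * b k)).
  by move=> ia ib; rewrite dotL2Z// ReM; case: (dotL2 a b) => p q /=; ring.
rewrite !im//; try exact: inL2_schrod.
rewrite -(re u); [|by []|exact: inL2Z].
congr (complex.Re (dotL2 _ _)); apply/funext => k; rewrite /schrod mulrCA.
by [].
Qed.

Lemma dotL2_schrodl t u v : inL2 u -> inL2 v ->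
  dotL2 (schrod t u) v = dotL2 u (schrod (- t) v).
Proof.
move=> iu iv; rewrite -{1}[v](schrodK (- t)) opprK dotL2_schrod//.
exact: inL2_schrod.
Qed.

Lemma bessel_schrod s t u : bessel s (schrod t u) = schrod t (bessel s u).
Proof. by apply/funext => k; rewrite /bessel /schrod mulrCA. Qed.

Lemma sqnorm1_gt0 (k : d.-tuple int) : 0 < 1 + sqnorm R k.
Proof. by rewrite ltr_pwDl// sqnorm_ge0. Qed.

Lemma besselK s : cancel (@bessel R d s) (bessel (- s)).
Proof.
move=> u; apply/funext => k; rewrite /bessel mulrA -rmorphM /= mulNr powRN mulVf ?mul1r//.
by rewrite gt_eqF// powR_gt0// sqnorm1_gt0.
Qed.

Lemma bessel0 u : bessel 0 u = u.
Proof. by apply/funext => k; rewrite /bessel mul0r powRr0 mul1r. Qed.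

Lemma inH0 u : inH 0 u = inL2 u.
Proof. by rewrite /inH bessel0. Qed.

Lemma inL2_bessel s u : 0 <= s -> inL2 u -> inL2 (bessel (- s) u).
Proof.
move=> s0 iu; have [|//] := @contractive_multiplier
  (fun k => ((1 + sqnorm R k) `^ (- s / 2))%:C%C) u _ iu => k.
rewrite sqmod_real expr_le1 ?powR_ge0//.
rewrite mulNr powRN invf_le1 ?powR_gt0 ?sqnorm1_gt0//.
have := @ler_powR R (1 + sqnorm R k) _ 0 (s / 2) _.
by rewrite powRr0; apply; rewrite ?lerDl ?sqnorm_ge0// divr_ge0.
Qed.

Lemma orthonormal_schrod t (f : nat -> dist R d) : orthonormal_seq f ->
  orthonormal_seq (fun j => schrod t (f j)).
Proof.
move=> [iF oF]; split=> [j|i j]; first exact: inL2_schrod.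
by rewrite dotL2_schrod.
Qed.

Lemma decomposition_evolution (alpha s t : R) (gamma0 : operator R d)
    (lam : nat -> R) (f : nat -> dist R d) :
  decomposition alpha s gamma0 lam f ->
  decomposition alpha s (evolution gamma0 t) lam (fun j => schrod t (f j)).
Proof.
move=> [slam onf dec]; split; [exact: slam|exact: orthonormal_schrod|].
move=> u iu; have iu' : inL2 (schrod (- t) (bessel (- s) u)) by exact: inL2_schrod.
have [|c1 c2 c3] := dec (schrod (- t) u); first by rewrite /inH bessel_schrod.
pose p n : dist R d := fun k => \sum_(j < n) (lam j)%:C%C *
  dotL2 (f j) (bessel (- s) (schrod (- t) u)) * bessel (- s) (f j) k.
rewrite (_ : (fun n k => _) = fun n => schrod t (p n)); last first.
  apply/funext => n; apply/funext => k; rewrite [RHS]/schrod /p mulr_sumr.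
  apply: eq_bigr => j _; rewrite bessel_schrod bessel_schrod dotL2_schrodl//; last exact: onf.1.
  by rewrite [X in _ * X]/schrod mulrCA.
split.
- by move=> n; rewrite /inH bessel_schrod; apply: inL2_schrod; exact: c1.
- by rewrite /inH /evolution bessel_schrod; exact: inL2_schrod.
apply: cvg_trans c3; apply: near_eq_cvg; apply: nearW => n.
rewrite /normH /evolution.
rewrite -/(p n) (_ : (fun k => schrod t (p n) k - _) =
   schrod t (fun k => p n k - gamma0 (schrod (- t) u) k)); last first.
  by apply/funext => k; rewrite /schrod mulrBr.
have ib : inL2 (bessel s (fun k => p n k - gamma0 (schrod (- t) u) k)).
  rewrite (_ : bessel s _ = fun k => bessel s (p n) k - bessel s (gamma0 (schrod (- t) u)) k).
    by apply: inL2B; [exact: c1|exact: c2].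
  by apply/funext => k; rewrite /bessel mulrBr.
by rewrite [in RHS]bessel_schrod normL2_schrod.
Qed.

End FourierMultipliers.

(** * Expansion in an orthonormal basis *)

Section OrthonormalExpansion.
Variables (R : realType) (d : nat).
Implicit Types (u v : dist R d) (L : operator R d).

Lemma cvg0_ler0 (c : R) (x : nat -> R) (N : nat) :
  x @ \oo --> 0 -> (forall n, (N <= n)%N -> c <= x n) -> c <= 0.
Proof.
move=> x0 cx; rewrite -[c]subr0.
apply: (@cvg_ler R (fun n => c - x n) _ _ N).
  by apply: cvgB => //; exact: cvg_cst.
by move=> n /cx; rewrite subr_le0.
Qed.

Lemma cvg_sumr (I : Type) (r : seq I) (x : I -> nat -> R) (l : I -> R) :
  (forall i, x i @ \oo --> l i) ->
  \sum_(i <- r) x i n @[n --> \oo] --> \sum_(i <- r) l i.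
Proof.
move=> cx; elim: r => [|i r IH].
  by under eq_fun do rewrite big_nil; rewrite big_nil; exact: cvg_cst.
by under eq_fun do rewrite big_cons; rewrite big_cons; apply: cvgD; [exact: cx|exact: IH].
Qed.

Lemma nsq_character (k : d.-tuple int) : nsq (character R k) = 1.
Proof.
by rewrite /nsq (@dotL2_characters _ _ [:: k]) ?mem_head// eqxx.
Qed.

(** Bessel's inequality shows that the limit is at most [nsq u]. The converse is the norm bound in
    [riesz_fischer], applied with the limit itself as M. *)
Lemma parseval_box u : inL2 u ->
  \sum_(k <- box d (2 ^ K)) sqmod (u k) @[K --> \oo] --> nsq u.
Proof.
move=> iu; pose b K := \sum_(k <- box d (2 ^ K)) sqmod (u k).
have split_le (r r' : seq (d.-tuple int)) : uniq r -> uniq r' -> {subset r <= r'} ->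
    \sum_(k <- r) sqmod (u k) <= \sum_(k <- r') sqmod (u k).
  move=> ur ur' rr; rewrite [leRHS](big_subset_split _ ur ur' rr) lerDl.
  by apply: sumr_ge0 => k _; exact: sqmod_ge0.
have nd : nondecreasing_seq b.
  move=> m n mn; apply: split_le; rewrite ?box_uniq// => k; apply: box_le.
  by rewrite leq_pexp2l.
have ub K : b K <= nsq u by apply: bessel_characters => //; exact: box_uniq.
have cb : cvgn b by apply: nondecreasing_is_cvgn => //; exists (nsq u) => _ [K _ <-].
suff -> : nsq u = limn b by [].
apply/eqP; rewrite eq_le; apply/andP; split; last by apply: (cvg_ler cb (N := 0%N)).
have [|_ //] := @riesz_fischer R d u (limn b); move=> r ur.
have [K rK] : exists K, {subset r <= box d (2 ^ K)}.
  elim: r {ur} => [|k r [K IH]]; first by exists 0%N.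
  have [K' kK] := box_exhaust k; exists (maxn K K') => l.
  rewrite inE => /predU1P[->|/IH lK].
    by apply: box_le kK; rewrite leq_pexp2l// leq_maxr.
  by apply: box_le lK; rewrite leq_pexp2l// leq_maxl.
by apply: le_trans (split_le _ _ ur (box_uniq _ _) rK) _; exact: nondecreasing_cvgn_le.
Qed.

Variable e : nat -> dist R d.
Hypothesis be : orthonormal_basis e.

Let ie j : inL2 (e j). Proof. exact: be.1.1. Qed.
Let oe (s : seq nat) i j : i \in s -> j \in s -> dotL2 (e i) (e j) = (i == j)%:R.
Proof. by move=> _ _; exact: be.1.2. Qed.

Lemma sum_sqmod_basis_le k n : \sum_(0 <= j < n) sqmod (e j k) <= 1.
Proof.
rewrite -(nsq_character k); apply: le_trans (bessel_le (iota_uniq 0 n) ie (@oe _) (inL2_character R k)).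
rewrite /index_iota subn0; apply: ler_sum => j _.
by rewrite dotL2_characterr// sqmodJ.
Qed.

(** Each coordinate of the series converges absolutely, since |a_j e_j(k)| <= |a_j|^2 + |e_j(k)|^2
    and both are summable in j. The coordinatewise limit T is in L^2 and differs from the partial
    sums by the tail [tau]; it has the same scalar products with the basis as u, so u = T. *)
Lemma expansion_cvg u : inL2 u ->
  nsq (fun k => u k - \sum_(0 <= j < n) dotL2 (e j) u * e j k) @[n --> \oo] --> 0.
Proof.
move=> iu; pose a j := dotL2 (e j) u.
pose S n : dist R d := fun k => \sum_(0 <= j < n) a j * e j k.
have ub n : \sum_(0 <= j < n) sqmod (a j) <= nsq u.
  exact: (bessel_le (iota_uniq 0 (n - 0)) ie (@oe _) iu).
have ca : cvgn (series (fun j => sqmod (a j))).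
  by apply: cvg_bounded_partial ub => j; exact: sqmod_ge0.
pose tau n := limn (series (fun j => sqmod (a j))) - series (fun j => sqmod (a j)) n.
have tau0 : tau @ \oo --> 0.
  rewrite -[X in _ --> X](subrr (limn (series (fun j => sqmod (a j))))).
  by apply: cvgB => //; exact: cvg_cst.
have cvs k (g : R[i] -> R) : (forall z, g z ^+ 2 <= sqmod z) ->
    cvgn (series (fun j => g (a j * e j k))).
  move=> gz; apply: normed_cvg; apply: (@cvg_bounded_partial _ _ (nsq u + 1)) => n /=.
    exact: normr_ge0.
  apply: le_trans (lerD (ub n) (sum_sqmod_basis_le k n)); rewrite -big_split /=.
  apply: ler_sum => j _; have z0 := addr_ge0 (sqmod_ge0 (a j)) (sqmod_ge0 (e j k)).
  rewrite -(@ler_pXn2r _ 2) ?nnegrE//.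
  rewrite real_normK ?num_real//; apply: le_trans (gz _) _; rewrite sqmodM.
  by have := sqmod_ge0 (a j); have := sqmod_ge0 (e j k); nra.
have cr k : cvgn (series (fun j => complex.Re (a j * e j k))).
  exact: (cvs k (@complex.Re R) (@Re_le_sqmod R)).
have ci k : cvgn (series (fun j => complex.Im (a j * e j k))).
  exact: (cvs k (@complex.Im R) (@Im_le_sqmod R)).
pose T : dist R d := fun k => (limn (series (fun j => complex.Re (a j * e j k))) +i*
  limn (series (fun j => complex.Im (a j * e j k))))%C.
have SE n k : S n k = (series (fun j => complex.Re (a j * e j k)) n +i*
    series (fun j => complex.Im (a j * e j k)) n)%C.
  by apply: complexP; rewrite /S ?Re_sum ?Im_sum.
have iS n : inL2 (S n) by apply: inL2_sum => j _; exact: inL2Z.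
have TS N : inL2 (fun k => T k - S N k) /\ nsq (fun k => T k - S N k) <= tau N.
  apply: riesz_fischer => r ur.
  have lim : \sum_(k <- r) sqmod (S m k - S N k) @[m --> \oo] -->
      \sum_(k <- r) sqmod (T k - S N k).
    apply: (cvg_sumr (x := fun k m => sqmod (S m k - S N k))) => k.
    under eq_fun do rewrite SE.
    rewrite /sqmod !ReD !ImD; apply: cvgD.
      under eq_fun do rewrite ReD.
      by rewrite !expr2; apply: cvgM; (apply: cvgD; [exact: cr|exact: cvg_cst]).
    under eq_fun do rewrite ImD.
    by rewrite !expr2; apply: cvgM; (apply: cvgD; [exact: ci|exact: cvg_cst]).
  apply: (cvg_ler lim (N := N)) => m Nm.
  have diff : (fun k => S m k - S N k) = fun k => \sum_(j <- index_iota N m) a j * e j k.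
    by apply/funext => k; rewrite /S (big_cat_nat (n := N)) //= addrAC subrr add0r.
  have iD : inL2 (fun k => S m k - S N k) by exact: inL2B.
  apply: le_trans (bessel_characters ur iD) _.
  rewrite diff (nsq_orthonormal_sum (iota_uniq _ _) ie (@oe _)).
  rewrite /tau lerBrDl -big_cat_nat//.
  by apply: nondecreasing_cvgn_le => //; apply: nondecreasing_series => j _ _; exact: sqmod_ge0.
have iT : inL2 T.
  have := inL2D (TS 0%N).1 (iS 0%N); congr inL2.
  by apply/funext => k; rewrite subrK.
have aT i : dotL2 (e i) T = a i.
  apply/eqP; rewrite -subr_eq0; apply/eqP/sqmod_eq0/eqP; rewrite eq_le sqmod_ge0 andbT.
  apply: (cvg0_ler0 tau0 (N := i.+1)) => N iN; apply: le_trans (TS N).2.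
  have -> : dotL2 (e i) T - a i = dotL2 (e i) (fun k => T k - S N k).
    rewrite dotL2B//; congr (_ - _); symmetry.
    apply: (dotL2_orthonormal_sum (iota_uniq 0 (N - 0)) ie (@oe _)).
    by rewrite mem_iota subn0.
  apply: le_trans (cauchy_schwarz (ie i) (TS N).1) _.
  by rewrite /nsq be.1.2 eqxx mul1r.
have uT : u = T.
  have z : (fun k => u k - T k) = (fun=> 0).
    by apply: be.2 => [|i]; [exact: inL2B|rewrite dotL2B// aT subrr].
  by apply/funext => k; apply/eqP; rewrite -subr_eq0; apply/eqP; have := congr1 (@^~ k) z.
apply: (@squeeze_cvgr _ _ _ _ (fun=> 0) tau) => //; last exact: cvg_cst.
apply: nearW => n; have [h1 h2] := TS n.
by rewrite {1 3}uT nsq_ge0.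
Qed.

End OrthonormalExpansion.

Section BoundedOperators.
Variables (R : realType) (d : nat).
Implicit Types (u v : dist R d) (L Q : operator R d).

Lemma linear_op_inL2 L u : linear_op 0 0 L -> inL2 u -> inL2 (L u).
Proof. by move=> [h _]; have := h u; rewrite !inH0. Qed.

Lemma linear_op_comb L (a : R[i]) u v : linear_op 0 0 L -> inL2 u -> inL2 v ->
  L (fun k => a * u k + v k) = fun k => a * L u k + L v k.
Proof. by move=> [_ h] iu iv; apply: h; rewrite inH0. Qed.

Lemma linear_op0 L : linear_op 0 0 L -> L (fun=> 0) = fun=> 0.
Proof.
move=> lL; have i0 := @inL2_0 R d; have := linear_op_comb 1 lL i0 i0.
rewrite (_ : (fun k => _) = fun=> 0); last by apply/funext => k; rewrite mulr0 addr0.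
move=> e; apply/funext => k; have /eqP := congr1 (@^~ k) e.
by rewrite /= mul1r -subr_eq subrr eq_sym => /eqP.
Qed.

Lemma linear_opZ L (a : R[i]) u : linear_op 0 0 L -> inL2 u ->
  L (fun k => a * u k) = fun k => a * L u k.
Proof.
move=> lL iu; have := linear_op_comb a lL iu (@inL2_0 R d); rewrite linear_op0//.
rewrite (_ : (fun k => a * u k + 0) = fun k => a * u k); last first.
  by apply/funext => k; rewrite addr0.
by move=> ->; apply/funext => k; rewrite addr0.
Qed.

Lemma linear_opB L u v : linear_op 0 0 L -> inL2 u -> inL2 v ->
  L (fun k => u k - v k) = fun k => L u k - L v k.
Proof.
move=> lL iu iv; have := linear_op_comb (-1) lL iv iu.
rewrite (_ : (fun k => -1 * v k + u k) = fun k => u k - v k); last first.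
  by apply/funext => k; rewrite mulN1r addrC.
by move=> ->; apply/funext => k; rewrite mulN1r addrC.
Qed.

Lemma linear_op_sum L (I : Type) (r : seq I) (a : I -> R[i]) (e : I -> dist R d) :
  linear_op 0 0 L -> (forall i, inL2 (e i)) ->
  L (fun k => \sum_(i <- r) a i * e i k) = fun k => \sum_(i <- r) a i * L (e i) k.
Proof.
move=> lL ie; elim: r => [|i r IH].
  rewrite (_ : (fun k => _) = fun=> 0); last by apply/funext => k; rewrite big_nil.
  by rewrite linear_op0//; apply/funext => k; rewrite big_nil.
rewrite (_ : (fun k => _) = fun k => a i * e i k + \sum_(j <- r) a j * e j k); last first.
  by apply/funext => k; rewrite big_cons.
rewrite linear_op_comb//; last by apply: inL2_sum => j _; exact: inL2Z.
by rewrite IH; apply/funext => k; rewrite big_cons.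
Qed.

Lemma bounded_op_nsq L : bounded_op L ->
  exists2 M : R, 0 <= M & forall u, inL2 u -> nsq (L u) <= M * nsq u.
Proof.
move=> [lL [M hM]]; exists (M ^+ 2); first exact: sqr_ge0.
move=> u iu; have iL := linear_op_inL2 lL iu; rewrite -!normL2_sqr// -exprMn.
have h := hM u iu; have h0 := normL2_ge0 (L u); have h1 := le_trans h0 h.
by apply: lerXn2r.
Qed.

Variable e : nat -> dist R d.
Hypothesis be : orthonormal_basis e.

Let ie j : inL2 (e j). Proof. exact: be.1.1. Qed.

Lemma bounded_expansion L u : bounded_op L -> inL2 u ->
  nsq (fun k => L u k - \sum_(0 <= j < n) dotL2 (e j) u * L (e j) k) @[n --> \oo] --> 0.
Proof.
move=> bL iu; have [M M0 hM] := bounded_op_nsq bL; have [lL _] := bL.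
have lim : M * nsq (fun k => u k - \sum_(0 <= j < n) dotL2 (e j) u * e j k) @[n --> \oo] --> 0.
  rewrite -[X in _ --> X](mulr0 M); apply: cvgM; first exact: cvg_cst.
  exact: expansion_cvg.
apply: (@squeeze_cvgr _ _ _ _ (fun=> 0)) lim; last exact: cvg_cst.
apply: nearW => n.
have iS : inL2 (fun k => \sum_(0 <= j < n) dotL2 (e j) u * e j k).
  by apply: inL2_sum => j _; exact: inL2Z.
have -> : (fun k => L u k - \sum_(0 <= j < n) dotL2 (e j) u * L (e j) k) =
    L (fun k => u k - \sum_(0 <= j < n) dotL2 (e j) u * e j k).
  by rewrite linear_opB// linear_op_sum.
by rewrite nsq_ge0 ?hM//; [exact: inL2B|apply: linear_op_inL2 => //; exact: inL2B].
Qed.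

(** The trace is taken over characters, the eigenvalues belong to another basis. A diagonal entry of
    Q dominates the finite sums of nu_n |e_n(k)|^2, and for fixed n the sum of |e_n(k)|^2 over
    growing boxes tends to 1 by Parseval. *)
Lemma trace_bound Q (nu : nat -> R) : bounded_op Q -> (forall n, 0 <= nu n) ->
  (forall n, Q (e n) = fun k => (nu n)%:C%C * e n k) ->
  forall N, ((\sum_(0 <= n < N) nu n)%:E <= trace Q)%E.
Proof.
move=> bQ nu0 Qe N; have [lQ _] := bQ.
have diag k M : \sum_(0 <= n < M) nu n * sqmod (e n k) <=
    complex.Re (dotL2 (character R k) (Q (character R k))).
  have ik := inL2_character R k; have iQ := linear_op_inL2 lQ ik.
  (* If the gap c were positive, the k-th coefficient of every remainder after M terms would have
     real part at most -c, although the remainders tend to 0 in norm. *)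
  rewrite dotL2_character// -subr_le0 leNgt; apply/negP => c0.
  set c := (X in 0 < X) in c0.
  have := bounded_expansion bQ ik; move/(@cvg0_ler0 _ (c ^+ 2) _ M).
  rewrite leNgt exprn_gt0//= => h; suff: false by []; apply: h => n Mn.
  have iS : inL2 (fun l => Q (character R k) l -
      \sum_(0 <= j < n) dotL2 (e j) (character R k) * Q (e j) l).
    by apply: inL2B => //; apply: inL2_sum => j _; apply: inL2Z; exact: linear_op_inL2.
  apply: le_trans (sqmod_le_nsq k iS); apply: le_trans (Re_le_sqmod _).
  rewrite ReD ReN Re_sum.
  have -> : \sum_(0 <= j < n) complex.Re (dotL2 (e j) (character R k) * Q (e j) k) =
      \sum_(0 <= j < n) nu j * sqmod (e j k).
    apply: eq_bigr => j _; rewrite dotL2_characterr// Qe mulrCA mulJc -rmorphM.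
    by [].
  rewrite -[leRHS]sqrrN opprB; apply: lerXn2r; rewrite ?nnegrE; [exact: ltW| |].
    apply: le_trans (ltW c0) _; rewrite /c lerB//.
    rewrite [leRHS](big_cat_nat (n := M)) //= lerDl; apply: sumr_ge0 => j _.
    by rewrite mulr_ge0 ?sqmod_ge0.
  rewrite /c lerB// [leRHS](big_cat_nat (n := M)) //= lerDl; apply: sumr_ge0 => j _.
  by rewrite mulr_ge0 ?sqmod_ge0.
have fin (r : seq (d.-tuple int)) : uniq r ->
    ((\sum_(0 <= n < N) nu n * \sum_(k <- r) sqmod (e n k))%:E <= trace Q)%E.
  move=> ur; apply: esum_ge; exists [set` r]; first by split; [exact: finite_seq|].
  rewrite -fsbig_seq// sumEFin lee_fin.
  under eq_bigr do rewrite mulr_sumr.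
  by rewrite exchange_big /=; apply: ler_sum => k _; exact: diag.
have [t] : exists t, trace Q = t by exists (trace Q).
case: t fin => [t| |] + tQ; rewrite tQ ?leey// => fin; last by have := fin [::] isT.
have lim : \sum_(0 <= n < N) nu n * \sum_(k <- box d (2 ^ K)) sqmod (e n k) @[K --> \oo] -->
    \sum_(0 <= n < N) nu n * 1.
  apply: (cvg_sumr (x := fun n K => nu n * \sum_(k <- box d (2 ^ K)) sqmod (e n k))) => n.
  apply: cvgM; first exact: cvg_cst.
  have := parseval_box (ie n); rewrite {1}/nsq.
  by have [[_ ->] _] := be; rewrite eqxx.
rewrite lee_fin; under eq_bigr do rewrite -[nu _]mulr1.
apply: (cvg_ler lim (N := 0%N)) => K _; rewrite -lee_fin; apply: fin.
exact: box_uniq.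
Qed.

(** Q is known only in the eigenbasis of |A|, and is needed on eigenvectors of A. By symmetry x is
    orthogonal to every e_n with mu_n^2 different from c^2, so Q acts on each term of the expansion
    of x by the same factor. *)
Lemma power_eigenvector (A Q : operator R d) (mu : nat -> R) (alpha c : R) x :
  0 < alpha -> bounded_op Q -> bounded_op A -> (forall n, 0 <= mu n) ->
  (forall u v, inL2 u -> inL2 v -> dotL2 (A u) v = dotL2 u (A v)) ->
  (forall n, A (A (e n)) = fun k => (mu n ^+ 2)%:C%C * e n k) ->
  (forall n, Q (e n) = fun k => (mu n `^ alpha)%:C%C * e n k) ->
  inL2 x -> A x = (fun k => c%:C%C * x k) ->
  Q x = fun k => (`|c| `^ alpha)%:C%C * x k.
Proof.
move=> a0 bQ bA mu0 sA AA Qe ix Ax.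
have [lQ _] := bQ; have [lA _] := bA.
have AAx : A (A x) = fun k => (c ^+ 2)%:C%C * x k.
  rewrite Ax linear_opZ// Ax; apply/funext => k.
  by rewrite mulrA -rmorphM.
have ev n : dotL2 (e n) x = 0 \/ mu n = `|c|.
  have iAe := linear_op_inL2 lA (ie n).
  have h : (mu n ^+ 2)%:C%C * dotL2 (e n) x = (c ^+ 2)%:C%C * dotL2 (e n) x.
    rewrite -[RHS]dotL2Z// -AAx -!sA//; last exact: linear_op_inL2.
    by rewrite AA dotL2Zl// conjc_real.
  have [|xn] := eqVneq (dotL2 (e n) x) 0; [by left|right].
  have := mulIf xn h => /(congr1 (@complex.Re R)) /= cm.
  by apply/eqP; rewrite -(@eqrXn2 _ 2)// cm real_normK ?num_real.
have Qterm n k : dotL2 (e n) x * Q (e n) k = (`|c| `^ alpha)%:C%C * (dotL2 (e n) x * e n k).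
  by rewrite Qe; have [->|->] := ev n; rewrite ?mul0r ?mulr0// mulrCA.
have i2 : inL2 (fun k => (`|c| `^ alpha)%:C%C * x k) by exact: inL2Z.
have iQ := linear_op_inL2 lQ ix.
have le0 : nsq (fun k => Q x k - (`|c| `^ alpha)%:C%C * x k) <= 0.
  have l1 := bounded_expansion bQ ix.
  have l2 := expansion_cvg be ix.
  have lim : 2 * nsq (fun k => Q x k - \sum_(0 <= j < n) dotL2 (e j) x * Q (e j) k) +
      2 * (`|c| `^ alpha) ^+ 2 * nsq (fun k => x k - \sum_(0 <= j < n) dotL2 (e j) x * e j k)
      @[n --> \oo] --> 2 * 0 + 2 * (`|c| `^ alpha) ^+ 2 * 0.
    by apply: cvgD; apply: cvgM => //; exact: cvg_cst.
  rewrite !mulr0 addr0 in lim.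
  apply: (cvg0_ler0 lim (N := 0%N)) => n _ /=.
  have iS : inL2 (fun k => \sum_(0 <= j < n) dotL2 (e j) x * e j k).
    by apply: inL2_sum => j _; exact: inL2Z.
  have SQ : (fun k => \sum_(0 <= j < n) dotL2 (e j) x * Q (e j) k) =
      fun k => (`|c| `^ alpha)%:C%C * \sum_(0 <= j < n) dotL2 (e j) x * e j k.
    by apply/funext => k; rewrite mulr_sumr; apply: eq_bigr => j _.
  have iSQ : inL2 (fun k => \sum_(0 <= j < n) dotL2 (e j) x * Q (e j) k).
    by rewrite SQ; exact: inL2Z.
  have i3 : inL2 (fun k => (- (`|c| `^ alpha)%:C%C) *
      (x k - \sum_(0 <= j < n) dotL2 (e j) x * e j k)) by apply: inL2Z; exact: inL2B.
  have := nsqD_le (inL2B iQ iSQ) i3.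
  rewrite nsqZ; last exact: inL2B.
  rewrite sqmodN sqmod_real mulrA; apply: le_trans; rewrite le_eqVlt; apply/orP; left.
  apply/eqP; congr nsq; apply/funext => k; have := congr1 (@^~ k) SQ => /= ->.
  by ring.
apply/funext => k.
have z : (fun k => Q x k - (`|c| `^ alpha)%:C%C * x k) = fun=> 0.
  by apply: nsq_eq0; [exact: inL2B|apply/eqP; rewrite eq_le le0 nsq_ge0//; exact: inL2B].
by apply/eqP; rewrite -subr_eq0; apply/eqP; have := congr1 (@^~ k) z.
Qed.

End BoundedOperators.

(** * Orthonormal eigenvectors from a total family of eigenvectors *)

Section GramSchmidt.
Variables (R : realType) (d : nat).
Implicit Types (u v : dist R d).

Lemma dotL20l u : inL2 u -> dotL2 (fun=> 0) u = 0.
Proof. by move=> iu; rewrite (dotL2J iu (@inL2_0 R d)) dotL20// conjc0. Qed.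

(* Since 0^-1 = 0, a zero vector is normalized to itself: in the Gram-Schmidt
   process below, dependent vectors become zero and are discarded at the end. *)
Definition normalize u : dist R d := fun k => ((Num.sqrt (nsq u))^-1)%:C%C * u k.

Lemma inL2_normalize u : inL2 u -> inL2 (normalize u).
Proof. exact: inL2Z. Qed.

Lemma normalize_cases u : inL2 u ->
  normalize u = (fun=> 0) \/ nsq (normalize u) = 1.
Proof.
move=> iu; have [u0|un0] := eqVneq (nsq u) 0; [left|right].
  by apply/funext => k; rewrite /normalize u0 sqrtr0 invr0 mul0r.
by rewrite nsqZ// sqmod_real exprVn sqr_sqrtr ?nsq_ge0// mulVf.
Qed.

Lemma normalizeK u : inL2 u ->
  u = fun k => (Num.sqrt (nsq u))%:C%C * normalize u k.
Proof.
move=> iu; apply/funext => k; rewrite /normalize mulrA -rmorphM /=.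
have [u0|un0] := eqVneq (nsq u) 0.
  by rewrite u0 sqrtr0 mul0r mul0r (nsq_eq0 iu u0).
by rewrite mulfV ?mul1r// sqrtr_eq0 -ltNge lt_neqAle eq_sym un0 nsq_ge0.
Qed.

Variable v : nat -> dist R d.

Definition gs_residue (l : seq (dist R d)) n : dist R d :=
  fun k => v n k - \sum_(g <- l) dotL2 g (v n) * g k.

(** Each step needs all earlier vectors; carrying them in a list keeps the recursion structural, and
    [gsE] recovers the usual formula. *)
Fixpoint gs_list n : seq (dist R d) :=
  if n is m.+1 then rcons (gs_list m) (normalize (gs_residue (gs_list m) m)) else [::].

Definition gs n : dist R d := normalize (gs_residue (gs_list n) n).

Lemma gs_listE n : gs_list n = [seq gs i | i <- iota 0 n].
Proof.
elim: n => [//|n IH]; rewrite -addn1 iotaD map_cat -IH add0n addn1 /=.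
by rewrite cats1.
Qed.

Lemma gsE n : gs n = normalize (fun k => v n k - \sum_(j < n) dotL2 (gs j) (v n) * gs j k).
Proof.
rewrite {1}/gs; congr normalize; apply/funext => k; rewrite /gs_residue gs_listE big_map.
by rewrite -(big_mkord xpredT (fun j => dotL2 (gs j) (v n) * gs j k)) /index_iota subn0.
Qed.

Variables (A : operator R d) (c : nat -> R).
Hypothesis lA : linear_op 0 0 A.
Hypothesis sA : forall u w, inL2 u -> inL2 w -> dotL2 (A u) w = dotL2 u (A w).
Hypothesis iv : forall n, inL2 (v n).
Hypothesis Av : forall n, A (v n) = fun k => (c n)%:C%C * v n k.

(** Subtracting projections keeps eigenvectors: a nonzero scalar product of [gs j] with [v n] forces
    c_j = c_n, as A is symmetric. The last clause expresses by orthogonality that v_n lies in the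
    span of the first n + 1 vectors. *)
Lemma gram_schmidt_step n :
  [/\ inL2 (gs n), gs n = (fun=> 0) \/ nsq (gs n) = 1,
      A (gs n) = (fun k => (c n)%:C%C * gs n k),
      forall i, (i < n)%N -> dotL2 (gs i) (gs n) = 0 &
      forall u, inL2 u -> (forall i, (i <= n)%N -> dotL2 (gs i) u = 0) -> dotL2 (v n) u = 0].
Proof.
elim/ltn_ind: n => n IH.
have ig (j : 'I_n) : inL2 (gs j) by have [] := IH j (ltn_ord j).
have nz (j : 'I_n) : gs j = (fun=> 0) \/ nsq (gs j) = 1 by have [] := IH j (ltn_ord j).
have eig (j : 'I_n) : A (gs j) = fun k => (c j)%:C%C * gs j k by have [] := IH j (ltn_ord j).
have og (i j : 'I_n) : i != j -> dotL2 (gs i) (gs j) = 0.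
  move=> ij; have [lij|lji|eij] := ltngtP i j.
  - by have [_ _ _ h _] := IH j (ltn_ord j); exact: h.
  - rewrite (dotL2J (ig j) (ig i)); have [_ _ _ h _] := IH i (ltn_ord i).
    by rewrite h// conjc0.
  - by rewrite -val_eqE /= eij eqxx in ij.
pose a (j : 'I_n) := dotL2 (gs j) (v n).
pose r : dist R d := fun k => v n k - \sum_(j < n) a j * gs j k.
have gr : gs n = normalize r by rewrite gsE.
have iP : inL2 (fun k => \sum_(j < n) a j * gs j k).
  by apply: inL2_sum => j _; exact: inL2Z.
have ir : inL2 r by exact: inL2B.
have orr (i : 'I_n) : dotL2 (gs i) r = 0.
  rewrite dotL2B// dotL2_sumr => [|//|j]; last exact: inL2Z.
  rewrite (bigD1 i)//= big1 ?addr0 => [|j ji]; last by rewrite dotL2Z// og ?mulr0// eq_sym.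
  rewrite dotL2Z// dotL2xx// -/(a i).
  have [g0|->] := nz i; last by rewrite mulr1 subrr.
  by rewrite /a g0 dotL20l// mul0r subrr.
have Ar : A r = fun k => (c n)%:C%C * r k.
  rewrite linear_opB// linear_op_sum// Av; apply/funext => k.
  rewrite mulrBr; congr (_ - _); rewrite mulr_sumr; apply: eq_bigr => j _.
  rewrite eig [RHS]mulrCA; have : (c j)%:C%C * a j = (c n)%:C%C * a j.
    by rewrite -[RHS]dotL2Z// -Av -sA// eig dotL2Zl// conjc_real.
  have [->|aj] := eqVneq (a j) 0; first by rewrite !mul0r.
  by move=> /(mulIf aj) ->.
split.
- by rewrite gr; exact: inL2_normalize.
- by rewrite gr; exact: normalize_cases.
- by rewrite gr linear_opZ// Ar; apply/funext => k; rewrite mulrCA.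
- by move=> i lin; rewrite gr dotL2Z ?(orr (Ordinal lin)) ?mulr0//; exact: (ig (Ordinal lin)).
move=> u iu u0.
have -> : v n = fun k => r k + \sum_(j < n) a j * gs j k by apply/funext => k; rewrite subrK.
rewrite dotL2Dl// dotL2_suml => [|//|j]; last exact: inL2Z.
rewrite big1 ?addr0 => [|j _]; last by rewrite dotL2Zl// u0 ?mulr0// ltnW.
rewrite (normalizeK ir) dotL2Zl//; last exact: inL2_normalize.
by rewrite -gr u0 ?mulr0.
Qed.

Lemma gs_orthogonal i j : i != j -> dotL2 (gs i) (gs j) = 0.
Proof.
move=> ij; have [lij|lji|eij] := ltngtP i j.
- by have [_ _ _ h _] := gram_schmidt_step j; exact: h.
- have [ii _ _ h _] := gram_schmidt_step i; have [ijj _ _ _ _] := gram_schmidt_step j.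
  by rewrite (dotL2J ijj ii) h// conjc0.
- by rewrite eij eqxx in ij.
Qed.

Hypothesis tv : forall u, inL2 u -> (forall n, dotL2 (v n) u = 0) -> u = fun=> 0.

Lemma gs_total u : inL2 u -> (forall n, dotL2 (gs n) u = 0) -> u = fun=> 0.
Proof.
move=> iu u0; apply: tv => // n; have [_ _ _ _ h] := gram_schmidt_step n.
exact: h.
Qed.

(** If all vectors from index M on were zero, the first M would be total, so the sum of |gs_j(k)|^2
    over j would be 1 for every k. Summing over a box of (2 M + 1)^d frequencies would then give (2
    M + 1)^d <= M. *)
Lemma gs_infinite : (0 < d)%N -> infinite_set [set n | gs n <> fun=> 0].
Proof.
move=> d0 /finite_seqP[l lE].
have [M hM] : exists M, forall n, (M <= n)%N -> gs n = fun=> 0.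
  exists (\max_(i <- l) i).+1 => n Mn; apply: contrapT => gn.
  have nl : n \in l by have : [set n | gs n <> fun=> 0] n := gn; rewrite lE.
  have : (id n <= \max_(i <- l) id i)%N by apply: leq_bigmax_seq.
  by rewrite /= leqNgt Mn.
have ig n : inL2 (gs n) by have [] := gram_schmidt_step n.
have coord k : \sum_(j < M) sqmod (gs j k) = 1.
  have ik := inL2_character R k; have iS : inL2 (fun l =>
    \sum_(j < M) dotL2 (gs j) (character R k) * gs j l).
    by apply: inL2_sum => j _; exact: inL2Z.
  have e : (fun l => character R k l -
      \sum_(j < M) dotL2 (gs j) (character R k) * gs j l) = fun=> 0.
    apply: gs_total; first exact: inL2B.
    move=> n; have [Mn|nM] := leqP M n.
      by rewrite (hM n Mn) dotL20l//; exact: inL2B.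
    rewrite dotL2B// dotL2_sumr => [|//|j]; last exact: inL2Z.
    rewrite (bigD1 (Ordinal nM))//= big1 ?addr0 => [|j ji]; last first.
      have nj : n != j :> nat by apply: contra ji => /eqP nj; apply/eqP/val_inj.
      by rewrite dotL2Z// [X in _ * X](gs_orthogonal nj) mulr0.
    rewrite dotL2Z// dotL2xx//; have [_ [g0|->] _ _ _] := gram_schmidt_step n.
      by rewrite g0 dotL20l// mul0r subrr.
    by rewrite mulr1 subrr.
  have := congr1 (fun w => complex.Re (w k)) e.
  rewrite /= ReD ReN Re_sum {1}/character eqxx /=.
  under eq_bigr do rewrite dotL2_characterr// mulJc.
  by move/eqP; rewrite subr_eq0 => /eqP.
have : \sum_(k <- box d M) \sum_(j < M) sqmod (gs j k) <= M%:R.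
  rewrite exchange_big /= -[leRHS]mulr_natl mulr1 -[X in X%:R]card_ord -sumr_const.
  apply: ler_sum => j _; apply: le_trans (bessel_characters (box_uniq _ _) (ig j)) _.
  by have [_ [->|->] _ _ _] := gram_schmidt_step j; rewrite ?nsq0.
under eq_bigr do rewrite coord.
rewrite big_const_seq count_predT size_box iter_addr_0 ler_nat.
have : (M.*2.+1 <= M.*2.+1 ^ d)%N by rewrite -{1}[M.*2.+1]expn1 leq_pexp2l.
by lia.
Qed.

Lemma eigenbasis : (0 < d)%N -> exists (f : nat -> dist R d) (phi : nat -> nat),
  orthonormal_basis f /\ forall j, A (f j) = fun k => (c (phi j))%:C%C * f j k.
Proof.
move=> /gs_infinite/infiniteP le1.
have : ([set: nat] #= [set n | gs n <> fun=> 0])%card.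
  by rewrite card_eq_le le1 subset_card_le.
move=> /card_set_bijP[phi [pfun pinj psurj]].
have ig n : inL2 (gs n) by have [] := gram_schmidt_step n.
exists (fun j => gs (phi j)), phi; split; last first.
  by move=> j; have [] := gram_schmidt_step (phi j).
split; [split; [by move=> j; exact: ig|move=> i j]|move=> u iu u0].
  have [->|ij] := eqVneq i j.
    rewrite dotL2xx//; have [_ [g0|->] _ _ _] := gram_schmidt_step (phi j) => //.
    by have := pfun j I.
  by rewrite gs_orthogonal//; apply: contra ij => /eqP/pinj ->//; rewrite ?inE.
apply: (gs_total iu) => n; have [g0|gn] := pselect (gs n = fun=> 0).
  by rewrite g0 dotL20l//.
by have [j _ <-] := psurj n gn.
Qed.

End GramSchmidt.

(** * The decomposition of the initial operator *)

Section SpectralDecomposition.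
Variables (R : realType) (d : nat) (s alpha : R) (gamma0 : operator R d).
Hypotheses (d0 : (0 < d)%N) (s0 : 0 <= s) (alpha0 : 0 < alpha).
Hypothesis hgamma : sobolev_schatten alpha s gamma0.
Hypothesis sgamma : self_adjoint gamma0.
Implicit Types (u v : dist R d) (k : d.-tuple int).

Let A : operator R d := fun u => bessel s (gamma0 (bessel s u)).

Let lgamma : linear_op (- s) s gamma0. Proof. by have [[]] := hgamma. Qed.

Let lA : linear_op 0 0 A. Proof. by have [_ [[]]] := hgamma. Qed.

Lemma bessel_character k : bessel s (character R k) =
  fun l => ((1 + sqnorm R k) `^ (s / 2))%:C%C * character R k l.
Proof.
apply/funext => l; rewrite /bessel /character.
by case: eqP => [->//|_]; rewrite !mulr0.
Qed.

(** [self_adjoint] speaks of vectors in L^2, while [bessel s u] is in general only in H^(-s) for u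
    in L^2. On a character [bessel s] is a scalar, so there the hypothesis applies directly. *)
Lemma sandwich_symmetric_characters k l :
  dotL2 (A (character R k)) (character R l) = A (character R l) k.
Proof.
have ic (m : d.-tuple int) : inL2 (bessel s (character R m)).
  by rewrite bessel_character; apply: inL2Z; exact: inL2_character.
have ig (m : d.-tuple int) : inL2 (gamma0 (bessel s (character R m))).
  have : inH s (gamma0 (bessel s (character R m))).
    by apply: lgamma.1; rewrite /inH besselK; exact: inL2_character.
  by move=> /(inL2_bessel s0); rewrite besselK.
have iA (m : d.-tuple int) : inL2 (A (character R m)) by apply: linear_op_inL2 => //; exact: inL2_character.
rewrite dotL2_characterr//.
have := sgamma (ic k) (ic l).
rewrite [X in dotL2 _ X = _]bessel_character dotL2Z ?dotL2_characterr//; last exact: inL2_character.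
rewrite [X in _ = dotL2 X _]bessel_character dotL2Zl ?dotL2_character//; last exact: inL2_character.
by rewrite conjc_real /A {1 3}/bessel conjc_mul conjc_real.
Qed.

(* Symmetry on characters gives A = B there; the k-th coefficients of A u and
   B u are then both the scalar product of A (character k) and u. *)
Lemma sandwich_eq_adjoint (B : operator R d) : bounded_op B ->
  (forall u v, inL2 u -> inL2 v -> dotL2 (A u) v = dotL2 u (B v)) ->
  forall u, inL2 u -> A u = B u.
Proof.
move=> [lB _] adj u iu.
have iA v : inL2 v -> inL2 (A v) by exact: linear_op_inL2.
have iB v : inL2 v -> inL2 (B v) by exact: linear_op_inL2.
have eqc (k : d.-tuple int) : A (character R k) = B (character R k).
  apply/funext => l; rewrite -sandwich_symmetric_characters adj; [|exact: inL2_character..].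
  by rewrite dotL2_character//; apply: iB; exact: inL2_character.
apply/funext => k; have ik := inL2_character R k.
have iBk := iB _ ik.
transitivity (dotL2 (B (character R k)) u).
  rewrite (dotL2J iu iBk) -(adj _ _ iu ik) -(dotL2J (iA _ iu) ik) dotL2_character//.
  exact: iA.
by rewrite -eqc (adj _ _ ik iu) dotL2_character//; exact: iB.
Qed.

Lemma exists_decomposition : exists (lam : nat -> R) (f : nat -> dist R d),
  decomposition alpha s gamma0 lam f.
Proof.
have [_ [_ [P [Q [[[bP _] [B [bB adj PP]]] [bQ [e [mu [be heig]]]] trQ]]]]] := hgamma.
have AB := sandwich_eq_adjoint bB adj.
have bA : bounded_op A.
  by have [_ [M hM]] := bB; split=> //; exists M => u iu; rewrite AB//; exact: hM.
have sA u v : inL2 u -> inL2 v -> dotL2 (A u) v = dotL2 u (A v).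
  by move=> iu iv; rewrite adj// AB.
have ie n : inL2 (e n) := be.1.1 n.
have iA u : inL2 u -> inL2 (A u) by exact: linear_op_inL2.
have mu0 n : 0 <= mu n by have [] := heig n.
have Qe n : Q (e n) = fun k => (mu n `^ alpha)%:C%C * e n k by have [] := heig n.
have AA n : A (A (e n)) = fun k => (mu n ^+ 2)%:C%C * e n k.
  have [_ Pe _] := heig n; rewrite (AB (A (e n))); last exact: iA.
  rewrite -PP// Pe linear_opZ//; last by case: bP.
  by rewrite Pe; apply/funext => k; rewrite mulrA -rmorphM.
(* The indices 2 n and 2 n + 1 stand for the eigenvalues mu_n and -mu_n. *)
pose sg (n : nat) : R := (-1) ^+ odd n.
pose c n := sg n * mu n./2.
have A0 n : mu n = 0 -> A (e n) = fun=> 0.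
  move=> mun; apply: nsq_eq0; first exact: iA.
  rewrite /nsq sA//; last exact: iA.
  by rewrite AA mun expr0n dotL2Z// mul0r.
(* Since A^2 e = mu^2 e, the vector A e + c e with c^2 = mu^2 satisfies the eigenvector equation for
   c, though it may be zero. If mu = 0 then A e = 0 and the sum would lose e, so e itself is
   taken. *)
pose v n : dist R d :=
  if mu n./2 == 0 then e n./2 else fun k => A (e n./2) k + (c n)%:C%C * e n./2 k.
have iv n : inL2 (v n).
  by rewrite /v; case: ifP => _ //; apply: inL2D; [exact: iA|exact: inL2Z].
have Av n : A (v n) = fun k => (c n)%:C%C * v n k.
  rewrite /v; case: eqP => [mun|_].
    by rewrite A0//; apply/funext => k; rewrite /c mun mulr0 mul0r.
  rewrite (_ : (fun k => A _ k + _) = fun k => (c n)%:C%C * e n./2 k + A (e n./2) k); last first.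
    by apply/funext => k; rewrite addrC.
  rewrite (linear_op_comb _ lA (ie _) (iA _ (ie _))) AA; apply/funext => k.
  have -> : (mu n./2 ^+ 2)%:C%C = (c n)%:C%C * (c n)%:C%C.
    by rewrite -rmorphM; congr (_%:C%C); rewrite /c /sg; case: (odd n); rewrite ?expr1 ?expr0; ring.
  by move: (A _ k) (e _ k) (c n)%:C%C => a b p; ring.
(* The vectors for the two signs differ by 2 mu_n e_n, so orthogonality to both gives orthogonality
   to e_n. *)
have tv u : inL2 u -> (forall n, dotL2 (v n) u = 0) -> u = fun=> 0.
  move=> iu vu; apply: be.2 => // n; have := vu n.*2; have := vu n.*2.+1.
  rewrite /v /c /sg [n.*2.+1./2]uphalf_double doubleK /= odd_double.
  case: eqP => // /eqP mun; rewrite expr1 expr0 !dotL2Dl ?dotL2Zl//; try exact: iA; try exact: inL2Z.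
  rewrite !conjc_real mul1r mulN1r rmorphN /= mulNr => /eqP; rewrite subr_eq0 => /eqP ->.
  move=> /eqP; rewrite -mulr2n mulrn_eq0 /= mulf_eq0 => /orP[/eqP/(congr1 (@complex.Re R))/= m0|/eqP//].
  by rewrite m0 eqxx in mun.
have [f [phi [bf Af]]] := eigenbasis lA sA iv Av tv d0.
pose lam j := c (phi j).
have Qf j : Q (f j) = fun k => (`|lam j| `^ alpha)%:C%C * f j k.
  exact: (power_eigenvector be alpha0 bQ bA mu0 sA AA Qe (bf.1.1 j) (Af j)).
have lam0 j : 0 <= `|lam j| `^ alpha by exact: powR_ge0.
have trb := trace_bound bf bQ lam0 Qf.
exists lam, f; split.
- apply: (@le_lt_trans _ _ (trace Q)).
    apply: lime_le; first by apply: is_cvg_nneseries => j _ _; rewrite lee_fin.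
    by apply: nearW => N; rewrite sumEFin; exact: trb.
  (* The hypothesis bounds a power of the trace with nonzero exponent, which would be infinite if
     the trace were. *)
  rewrite ltey; apply/eqP => trE; move: trQ; rewrite trE poweRyr ?ltxx//.
  by rewrite invr_eq0 gt_eqF.
- exact: bf.1.
move=> u iu; pose w := bessel (- s) u.
have iw : inL2 w by [].
have Aw : A w = bessel s (gamma0 u).
  by rewrite /A /w; have := besselK (- s) u; rewrite opprK => ->.
pose S n : dist R d := fun k => \sum_(0 <= j < n) dotL2 (f j) w * A (f j) k.
have bS n : bessel s (fun k => \sum_(j < n) (lam j)%:C%C * dotL2 (f j) w * bessel (- s) (f j) k) = S n.
  apply/funext => k; rewrite {1}/bessel mulr_sumr /S big_mkord; apply: eq_bigr => j _.
  have mm : ((1 + sqnorm R k) `^ (s / 2))%:C%C * ((1 + sqnorm R k) `^ (- s / 2))%:C%C = 1.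
    by rewrite -rmorphM /= mulNr powRN mulfV// gt_eqF// powR_gt0// sqnorm1_gt0.
  rewrite Af -[f j k in RHS]mul1r -mm /bessel -/(lam j).
  move: (dotL2 _ _) (f j k) (lam j)%:C%C (_ `^ _)%:C%C (_ `^ _)%:C%C => a b p x y.
  by ring.
have iS n : inL2 (S n).
  by apply: inL2_sum => j _; apply: inL2Z; apply: iA; exact: bf.1.1.
split.
- by move=> n; rewrite /inH bS.
- by rewrite /inH -Aw; exact: iA.
have lim := bounded_expansion bf bA iw.
have : Num.sqrt (nsq (fun k => A w k - S n k)) @[n --> \oo] --> (0 : R).
  rewrite -[X in _ --> X]sqrtr0; apply: (@cvg_comp _ _ _ _ (@Num.sqrt R)); first exact: lim.
  exact: sqrt_continuous.
apply: cvg_trans; apply: near_eq_cvg; apply: nearW => n.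
have diff : (fun k => A w k - S n k) = fun k => (-1) * bessel s (fun k =>
    \sum_(j < n) (lam j)%:C%C * dotL2 (f j) w * bessel (- s) (f j) k - gamma0 u k) k.
  by apply/funext => k; rewrite -bS Aw /bessel; ring.
rewrite diff nsqZ ?sqmodN ?sqmod1 ?mul1r//.
by rewrite (_ : bessel s _ = fun k => S n k - A w k);
  [exact: inL2B (iA _ iw)|apply/funext => k; rewrite -bS Aw /bessel; ring].
Qed.

End SpectralDecomposition.

Theorem corollary1p8 (R : realType) (d : nat) (s alpha : R) (eta1 : R -> R)
    (gamma0 : operator R d) :
  (1 <= d)%N ->
  d%:R / 4 + d%:R / (2 * (d%:R + 2)) < s -> s < d%:R / 2 ->
  1 <= alpha -> alpha < 2 ->
  cutoff eta1 ->
  sobolev_schatten alpha s gamma0 -> self_adjoint gamma0 ->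
  (exists (lam : nat -> R) (f : nat -> dist R d),
     decomposition alpha s gamma0 lam f) /\
  (forall (lam : nat -> R) (f : nat -> dist R d),
     decomposition alpha s gamma0 lam f ->
     let g0 := fun j => bessel (- s) (f j) in
     let g := fun (t : R) j => schrod t (bessel (- s) (f j)) in
     [/\ forall t : R, decomposition alpha s (evolution gamma0 t) lam
                         (fun j => schrod t (f j)),
         density_well_defined lam g0,
         forall t : R, density_well_defined lam (g t) &
         {ae torus R d, forall x : d.-tuple R,
            exists (rho : R -> R) (rho0 : R),
              [/\ density_at eta1 lam g0 x rho0,
                  \forall t \near (0 : R)^', density_at eta1 lam (g t) x (rho t) &
                  rho t @[t --> (0 : R)^'] --> rho0]}]).
Proof.
move=> d1 hs _ alpha1 alpha2 ceta hgamma sgamma.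
have s0 : 0 <= s.
  apply: ltW; apply: le_lt_trans hs.
  by apply: addr_ge0; apply: divr_ge0 => //; rewrite mulr_ge0// addr_ge0.
split; first exact: exists_decomposition d1 s0 (lt_le_trans ltr01 alpha1) hgamma sgamma.
move=> lam f dec g0 g; have [slam onf _] := dec.
have [dw ae_rho] := evolution_density d1 hs alpha1 alpha2 ceta slam onf.
(* The initial density is the evolved one at t = 0, so the limit is continuity of [rho] at 0, and
   one null set serves all times. *)
have g0E : g0 = g 0 by apply/funext => j; rewrite /g schrod0.
split.
- by move=> t; exact: decomposition_evolution.
- by rewrite g0E; exact: dw.
- exact: dw.
apply: filterS ae_rho => x [rho hrho crho]; exists rho, (rho 0); split.
- by rewrite g0E; exact: hrho.
- exact: nearW.
- by apply: cvg_within_filter; exact: crho.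
Qed.
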